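(* Let $\mathcal{C}$ be the category whose objects are the conducts with carrier a finite subset of $\mathbb{N}$, whose morphisms from $\mathbf{A}$ to $\mathbf{B}$ are the projects in $\psi_0(\mathbf{A})\multimap\psi_1(\mathbf{B})$, whose composition is $\mathfrak{g}\circ\mathfrak{f}=\nu(\mathfrak{f}::\mu(\mathfrak{g}))$, and whose identity on an object of carrier $S$ is $\mathfrak{Fax}_{1_S}$ for the bijection $1_S:(x,0)\mapsto(x,1)$. Equip $\mathcal{C}$ with the tensor product $\mathbf{A}\,\bar\otimes\,\mathbf{B}=\phi(\psi_0(\mathbf{A})\otimes\psi_1(\mathbf{B}))$ on objects and $\mathfrak{f}\,\bar\otimes\,\mathfrak{g}=\tau(\psi_0(\phi(\mathfrak{f}))\otimes\psi_1(\phi(\mathfrak{g})))$ on morphisms, with unit $\mathbf{1}=\{(0,\emptyset)\}^{\perp\perp}$, where $\emptyset$ is the empty graph. Then $\mathcal{C}$ is a $*$-autonomous category (a symmetric monoidal closed category with monoidal product $\bar\otimes$ and unit $\mathbf{1}$), with dualizing object $\bot=\mathbf{1}^\perp$.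
   Context: Graphs. A directed weighted graph is a tuple $G=(V_G,E_G,s_G,t_G,\omega_G)$. Here $V_G$ is a finite set of vertices, $E_G$ is a finite or countably infinite set of edges, $s_G,t_G:E_G\to V_G$ are the source and target maps, and $\omega_G:E_G\to(0,1]$ gives the weights. - A path is a finite sequence of edges $(e_0,\dots,e_n)$ with $s(e_{i+1})=t(e_i)$. Its weight is $\prod_i\omega(e_i)$. It is a cycle if $s(e_0)=t(e_n)$. - A cycle $\pi$ is a $1$-cycle if $\pi=\rho^k$ (the concatenation of $k$ copies of a cycle $\rho$) forces $k=1$. A $1$-circuit is the class of a $1$-cycle under cyclic permutation of its edges. - The union $G\cup H$ has vertex set $V_G\cup V_H$ (ordinary union) and edge set $E_G\sqcup E_H$ (disjoint union), with the inherited source, target and weight maps. The colouring $\delta$ sends $G$-edges to $0$ and $H$-edges to $1$. - An alternating path is a path in $G\cup H$ with $\delta(e_i)\neq\delta(e_{i+1})$ for all $i$. An alternating cycle is an alternating path that is a cycle with $\delta(e_n)\neq\delta(e_0)$. $\mathrm{Cycl}(G,H)$ is the set of alternating $1$-circuits. - The reduction $G::H$ has vertex set $V_G\triangle V_H$ (symmetric difference). Its edges are the alternating paths whose source and target lie in $V_G\triangle V_H$, with the path's source, target and weight. - The measurement is $\langle G,H\rangle=\sum_{\pi\in\mathrm{Cycl}(G,H)}-\log(1-\omega(\pi))\in[0,\infty]$, with $-\log 0=\infty$. Projects and conducts. - A project is a pair $\mathfrak{a}=(a,A)$ with $a\in[0,\infty)$ and $A$ a directed weighted graph; its carrier is $V_A$.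 - Set $\langle\!\langle\mathfrak{a},\mathfrak{b}\rangle\!\rangle=a+b+\langle A,B\rangle$. Projects of the same carrier are orthogonal if $\langle\!\langle\mathfrak{a},\mathfrak{b}\rangle\!\rangle\notin\{0,\infty\}$. - For a set $S$ of projects with a common carrier, $S^\perp$ is the set of projects of that carrier orthogonal to all elements of $S$. A conduct is a nonempty set $\mathbf{A}$ of projects with common carrier such that $\mathbf{A}=\mathbf{A}^{\perp\perp}$. - For disjoint carriers, $(a,A)\otimes(b,B)=(a+b,A\cup B)$ and $\mathbf{A}\otimes\mathbf{B}=\{\mathfrak{a}\otimes\mathfrak{b}:\mathfrak{a}\in\mathbf{A},\mathfrak{b}\in\mathbf{B}\}^{\perp\perp}$. - When $\langle\!\langle\mathfrak{f},\mathfrak{g}\rangle\!\rangle\neq\infty$, the cut is $\mathfrak{f}::\mathfrak{g}=(\langle\!\langle\mathfrak{f},\mathfrak{g}\rangle\!\rangle,F::G)$. - For conducts of disjoint carriers, $\mathbf{A}\multimap\mathbf{B}$ is the set of projects $\mathfrak{f}$ such that for every $\mathfrak{a}\in\mathbf{A}$, $\mathfrak{f}::\mathfrak{a}$ is defined and lies in $\mathbf{B}$. Delocation. For a project $(a,A)$ and a bijection $\theta$ from $V_A$ onto another set, $\theta(a,A)=(a,\theta(A))$, where $\theta(A)$ is $A$ with vertices renamed by $\theta$. On conducts, $\theta$ acts elementwise. For a bijection $\theta:X\to Y$ with $X\cap Y=\emptyset$, $\mathfrak{Fax}_\theta=(0,\Theta)$, where $\Theta$ has vertex set $X\cup Y$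 and edges $(x,\theta(x))$ and $(\theta(x),x)$ for $x\in X$, all of weight $1$. Maps used above: - $\psi_0(x)=(x,0)$ and $\psi_1(x)=(x,1)$ for $x\in\mathbb{N}$. - $\mu(x,i)=(x,i+1)$ on $\mathbb{N}\times\{0,1\}$. - $\nu(x,0)=(x,0)$ and $\nu(x,2)=(x,1)$. - $\phi(x,i)=2x+i$ from $\mathbb{N}\times\{0,1\}$ to $\mathbb{N}$. - $\tau$ on $\mathbb{N}\times\{0,1\}$ exchanges $(2x+1,0)$ and $(2x,1)$ and fixes all other points.
   Formalization: Equality of morphisms is taken up to a renaming of the edges of the graph (same wager, carrier, sources, targets and weights), since associativity and unit laws fail for literal equality: edges of a reduction are paths. *)

(* Defs.v *)
From mathcomp Require Import all_boot all_order all_algebra finmap.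
From mathcomp Require Import all_classical all_reals all_analysis.

Set Implicit Arguments.
Unset Strict Implicit.
Unset Printing Implicit Defensive.

Import Order.TTheory GRing.Theory Num.Theory.

Local Open Scope ring_scope.
Local Open Scope classical_set_scope.

(* All vertex sets are finite subsets of an ambient type [V], so that unions,
   symmetric differences and disjointness of carriers make sense.  A
   [countType] of edges is a set of edges that is finite or countable. *)
Record graph (R : realType) (V : choiceType) := Graph {
  vert : {fset V};
  edge : countType;
  src : edge -> V;
  tgt : edge -> V;
  wgt : edge -> R;
  src_vert : forall e, src e \in vert;
  tgt_vert : forall e, tgt e \in vert;
  wgt_itv : forall e, 0 < wgt e <= 1 }.

Arguments src_vert {R V} g e.
Arguments tgt_vert {R V} g e.
Arguments wgt_itv {R V} g e.

Section GraphOperations.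
Context {R : realType} {V : choiceType}.
Implicit Types G H : graph R V.

Definition gempty : graph R V :=
  @Graph R V fset0 void (of_void V) (of_void V) (of_void R)
    (fun e => match e with end) (fun e => match e with end)
    (fun e => match e with end).

Section Union.
Variables G H : graph R V.

Definition usrc (e : edge G + edge H) : V :=
  match e with inl x => src x | inr x => src x end.
Definition utgt (e : edge G + edge H) : V :=
  match e with inl x => tgt x | inr x => tgt x end.
Definition uwgt (e : edge G + edge H) : R :=
  match e with inl x => wgt x | inr x => wgt x end.

Lemma usrc_vert e : usrc e \in (vert G `|` vert H)%fset.
Proof. by case: e => e; rewrite in_fsetU src_vert ?orbT. Qed.

Lemma utgt_vert e : utgt e \in (vert G `|` vert H)%fset.
Proof. by case: e => e; rewrite in_fsetU tgt_vert ?orbT. Qed.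

Lemma uwgt_itv e : 0 < uwgt e <= 1.
Proof. by case: e => e; exact: wgt_itv. Qed.

Definition gunion : graph R V := Graph usrc_vert utgt_vert uwgt_itv.

Definition colour (e : edge gunion) : bool :=
  match e with inl _ => false | inr _ => true end.

End Union.

(* The path (e_0, ..., e_n) is encoded as the pair (e_0, [:: e_1; ...; e_n]). *)
Definition path_src G (p : edge G * seq (edge G)) : V := src p.1.
Definition path_tgt G (p : edge G * seq (edge G)) : V := tgt (last p.1 p.2).
Definition weight G (s : seq (edge G)) : R := \prod_(e <- s) wgt e.

Definition consec G : rel (edge G) := [rel e f | src f == tgt e].
Definition altconsec G H : rel (edge (gunion G H)) :=
  [rel e f | (src f == tgt e) && (colour e != colour f)].

Definition alt_path G H (p : edge (gunion G H) * seq (edge (gunion G H))) :=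
  path (@altconsec G H) p.1 p.2.

(* [cycle r [:: e_0; ...; e_n]] relates consecutive edges by r, and also e_n
   with e_0; it holds of the empty sequence, which is not a path. *)
Definition is_cycle G (s : seq (edge G)) : bool :=
  (s != [::]) && cycle (@consec G) s.
Definition alt_cycle G H (s : seq (edge (gunion G H))) : bool :=
  (s != [::]) && cycle (@altconsec G H) s.

Definition one_cycle G (s : seq (edge G)) : Prop :=
  is_cycle s /\
  forall (r : seq (edge G)) (k : nat),
    is_cycle r -> s = flatten (nseq k r) -> k = 1%N.

Definition circuit G (s : seq (edge G)) : set (seq (edge G)) :=
  [set rot k s | k in [set: nat]].

Definition Cycl G H : set (set (seq (edge (gunion G H)))) :=
  [set circuit s | s in [set s | one_cycle s /\ alt_cycle s]].

Arguments Cycl : clear implicits.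

(* The weight is invariant under rotation: any representative will do. *)
Definition circuit_weight G (c : set (seq (edge G))) : R :=
  weight (xget [::] c).

(* [lne 0 = -oo], so that a circuit of weight 1 contributes [+oo]. *)
Definition measurement G H : \bar R :=
  (\esum_(c in Cycl G H) - lne (1 - circuit_weight c)%:E)%E.

Lemma measurement_ge0 G H : (0 <= measurement G H)%E.
Proof.
apply: esum_ge0 => c [s _ _].
have /andP[w0 w1] : 0 < circuit_weight c <= 1.
  rewrite /circuit_weight /weight; apply/andP; split.
    by apply: prodr_gt0 => e _; have /andP[] := wgt_itv _ e.
  apply: prodr_ile1 => e _.
  by have /andP[/ltW -> ->] := wgt_itv _ e.
rewrite oppe_ge0 /lne; case: ifPn => // _.
by rewrite lee_fin ln_le0// gerBl ltW.
Qed.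

Section Reduction.
Variables G H : graph R V.

Definition rvert : {fset V} :=
  ((vert G `\` vert H) `|` (vert H `\` vert G))%fset.

Definition redge_pred (p : edge (gunion G H) * seq (edge (gunion G H))) :=
  [&& alt_path p, path_src p \in rvert & path_tgt p \in rvert].

Definition redge : countType := {p | redge_pred p}.

Definition rsrc (p : redge) : V := path_src (val p).
Definition rtgt (p : redge) : V := path_tgt (val p).
Definition rwgt (p : redge) : R := weight ((val p).1 :: (val p).2).

Lemma rsrc_vert p : rsrc p \in rvert.
Proof. by have /and3P[] := valP p. Qed.

Lemma rtgt_vert p : rtgt p \in rvert.
Proof. by have /and3P[] := valP p. Qed.

Lemma rwgt_itv p : 0 < rwgt p <= 1.
Proof.
apply/andP; split.
  by apply: prodr_gt0 => e _; have /andP[] := wgt_itv _ e.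
apply: prodr_ile1 => e _.
by have /andP[/ltW -> ->] := wgt_itv _ e.
Qed.

Definition reduction : graph R V := Graph rsrc_vert rtgt_vert rwgt_itv.

End Reduction.

End GraphOperations.

Section Relabel.
Context {R : realType} {V W : choiceType}.
Variables (theta : V -> W) (G : graph R V).

Lemma relabel_src (e : edge G) : theta (src e) \in (theta @` vert G)%fset.
Proof. by rewrite in_imfset//= src_vert. Qed.

Lemma relabel_tgt (e : edge G) : theta (tgt e) \in (theta @` vert G)%fset.
Proof. by rewrite in_imfset//= tgt_vert. Qed.

Definition relabel : graph R W :=
  Graph relabel_src relabel_tgt (wgt_itv G).

End Relabel.

Record project (R : realType) (V : choiceType) := Project {
  wager : {nonneg R};
  pgraph : graph R V }.

Section Projects.
Context {R : realType} {V : choiceType}.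
Implicit Types a b f g : project R V.

Definition carrier a : {fset V} := vert (pgraph a).

Definition pairing a b : \bar R :=
  ((wager a)%:num%:E + (wager b)%:num%:E
    + measurement (pgraph a) (pgraph b))%E.

Lemma pairing_ge0 a b : (0 <= pairing a b)%E.
Proof. by rewrite !adde_ge0 ?measurement_ge0 ?lee_fin. Qed.

Definition orthogonal a b : Prop :=
  [/\ carrier a = carrier b, pairing a b <> 0%E & pairing a b <> +oo%E].

Definition ptensor a b : project R V :=
  Project ((wager a)%:num + (wager b)%:num)%:nng
    (gunion (pgraph a) (pgraph b)).

Definition cut_defined f g : Prop := pairing f g <> +oo%E.

(* Only meaningful under [cut_defined f g], since [fine +oo = 0]. *)
Definition cut f g : project R V :=
  Project (NngNum (fine_ge0 (pairing_ge0 f g)))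
    (reduction (pgraph f) (pgraph g)).

(* Equality of projects up to a renaming of edges.  Composition is
   associative and unital only in this sense: the edges of an iterated
   reduction are paths of paths. *)
Definition project_eq a b : Prop :=
  [/\ wager a = wager b, carrier a = carrier b &
      exists2 h : edge (pgraph a) -> edge (pgraph b), bijective h &
        forall e, [/\ src (h e) = src e, tgt (h e) = tgt e
                    & wgt (h e) = wgt e]].

End Projects.

Definition prelabel {R : realType} {V W : choiceType} (theta : V -> W)
    (a : project R V) : project R W :=
  Project (wager a) (relabel theta (pgraph a)).

Section Fax.
Context {R : realType} {V : choiceType}.
Variables (X : {fset V}) (theta : V -> V).

(* The edge (x, false) goes from x to theta x, the edge (x, true) back. *)
Definition fax_src (e : (X * bool)%type) : V :=
  if e.2 then theta (val e.1) else val e.1.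
Definition fax_tgt (e : (X * bool)%type) : V :=
  if e.2 then val e.1 else theta (val e.1).

Lemma fax_end (b : bool) (x : X) :
  (if b then theta (val x) else val x) \in (X `|` theta @` X)%fset.
Proof.
by case: b; rewrite in_fsetU ?(valP x)// in_imfset ?orbT//= (valP x).
Qed.

Lemma fax_src_vert e : fax_src e \in (X `|` theta @` X)%fset.
Proof. exact: fax_end. Qed.

Lemma fax_tgt_vert e : fax_tgt e \in (X `|` theta @` X)%fset.
Proof. by have := fax_end (~~ e.2) e.1; rewrite if_neg. Qed.

Lemma fax_wgt_itv (e : (X * bool)%type) : 0 < (1 : R) <= 1.
Proof. by rewrite ltr01 lexx. Qed.

Definition fax : project R V :=
  Project 0%:nng (Graph fax_src_vert fax_tgt_vert fax_wgt_itv).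

End Fax.

(* The carrier is recorded because it cannot be read off an empty set of
   projects, whose orthogonal still depends on it. *)
Record pset (R : realType) (V : choiceType) := PSet {
  pcar : {fset V};
  pmem :> project R V -> Prop }.

Section Conducts.
Context {R : realType} {V : choiceType}.
Implicit Types S T : pset R V.

Definition perp S : pset R V :=
  PSet (pcar S)
    (fun a => carrier a = pcar S /\ forall b, S b -> orthogonal a b).

Definition is_conduct S : Prop :=
  [/\ forall a, S a -> carrier a = pcar S,
      exists a, S a &
      S = perp (perp S)].

Definition tensor S T : pset R V :=
  perp (perp (PSet (pcar S `|` pcar T)%fset
    (fun c => exists a b, [/\ S a, T b & c = ptensor a b]))).

Definition lolli S T : pset R V :=
  PSet (pcar S `|` pcar T)%fset
    (fun f => forall a, S a -> cut_defined f a /\ T (cut f a)).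

Definition unit_pset : pset R V :=
  perp (perp (PSet fset0 (fun a => a = Project 0%:nng gempty))).

Definition bot_pset : pset R V := perp unit_pset.

End Conducts.

Definition relabel_set {R : realType} {V W : choiceType} (theta : V -> W)
    (S : pset R V) : pset R W :=
  PSet (theta @` pcar S)%fset (fun b => exists2 a, S a & b = prelabel theta a).

(* The locations N x {0,1} and N x {0,1,2} live in nat * nat; the maps below
   are only used on these points ([nu] only on N x {0,2}), and their values
   elsewhere are irrelevant. *)
Definition psi (i : nat) (x : nat) : (nat * nat)%type := (x, i).
Definition mu (p : nat * nat) : (nat * nat)%type := (p.1, p.2.+1).
Definition nu (p : nat * nat) : (nat * nat)%type :=
  (p.1, if p.2 == 2%N then 1%N else p.2).
Definition phi (p : nat * nat) : nat := (2 * p.1 + p.2)%N.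
Definition tau (p : nat * nat) : (nat * nat)%type :=
  let: (x, i) := p in
  if odd x && (i == 0%N) then (x.-1, 1%N)
  else if ~~ odd x && (i == 1%N) then (x.+1, 0%N)
  else (x, i).

(* Categories whose hom-sets carry an explicit equality of morphisms. *)
Record quiver := Quiver {
  ob :> Type;
  hom : ob -> ob -> Type;
  heq : forall A B, hom A B -> hom A B -> Prop }.

Arguments hom {q} A B.
Arguments heq {q A B} f g.

Record category_on (Q : quiver) := Category {
  idm : forall A : Q, hom A A;
  compm : forall A B D : Q, hom B D -> hom A B -> hom A D;
  heq_refl : forall (A B : Q) (f : hom A B), heq f f;
  heq_sym : forall (A B : Q) (f g : hom A B), heq f g -> heq g f;
  heq_trans : forall (A B : Q) (f g h : hom A B),
    heq f g -> heq g h -> heq f h;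
  comp_heq : forall (A B D : Q) (g g' : hom B D) (f f' : hom A B),
    heq g g' -> heq f f' -> heq (compm g f) (compm g' f');
  comp_idl : forall (A B : Q) (f : hom A B), heq (compm (idm B) f) f;
  comp_idr : forall (A B : Q) (f : hom A B), heq (compm f (idm A)) f;
  compA : forall (A B D E : Q) (h : hom D E) (g : hom B D) (f : hom A B),
    heq (compm h (compm g f)) (compm (compm h g) f) }.

Arguments idm {Q} c A.
Arguments compm {Q} c {A B D} g f.

Definition is_iso {Q : quiver} (C : category_on Q) {A B : Q}
    (f : hom A B) : Prop :=
  exists g : hom B A,
    heq (compm C g f) (idm C A) /\ heq (compm C f g) (idm C B).

Record symmetric_monoidal {Q : quiver} (C : category_on Q) := SymMonoidal {
  tens : Q -> Q -> Q;
  tensm : forall A A' B B' : Q,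
    hom A A' -> hom B B' -> hom (tens A B) (tens A' B');
  tunit : Q;
  assoc : forall A B D : Q,
    hom (tens (tens A B) D) (tens A (tens B D));
  lunit : forall A : Q, hom (tens tunit A) A;
  runit : forall A : Q, hom (tens A tunit) A;
  braid : forall A B : Q, hom (tens A B) (tens B A);
  tensm_heq : forall (A A' B B' : Q) (f f' : hom A A') (g g' : hom B B'),
    heq f f' -> heq g g' -> heq (tensm f g) (tensm f' g');
  tensm_id : forall A B : Q,
    heq (tensm (idm C A) (idm C B)) (idm C (tens A B));
  tensm_comp : forall (A A' A'' B B' B'' : Q)
      (f' : hom A' A'') (f : hom A A') (g' : hom B' B'') (g : hom B B'),
    heq (tensm (compm C f' f) (compm C g' g))
        (compm C (tensm f' g') (tensm f g));
  assoc_iso : forall A B D : Q, is_iso C (assoc A B D);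
  lunit_iso : forall A : Q, is_iso C (lunit A);
  runit_iso : forall A : Q, is_iso C (runit A);
  assoc_nat : forall (A A' B B' D D' : Q)
      (f : hom A A') (g : hom B B') (h : hom D D'),
    heq (compm C (assoc A' B' D') (tensm (tensm f g) h))
        (compm C (tensm f (tensm g h)) (assoc A B D));
  lunit_nat : forall (A A' : Q) (f : hom A A'),
    heq (compm C (lunit A') (tensm (idm C tunit) f)) (compm C f (lunit A));
  runit_nat : forall (A A' : Q) (f : hom A A'),
    heq (compm C (runit A') (tensm f (idm C tunit))) (compm C f (runit A));
  braid_nat : forall (A A' B B' : Q) (f : hom A A') (g : hom B B'),
    heq (compm C (braid A' B') (tensm f g))
        (compm C (tensm g f) (braid A B));
  pentagon : forall A B D E : Q,
    heq (compm C (assoc A B (tens D E)) (assoc (tens A B) D E))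
        (compm C (tensm (idm C A) (assoc B D E))
          (compm C (assoc A (tens B D) E)
                  (tensm (assoc A B D) (idm C E))));
  triangle : forall A B : Q,
    heq (compm C (tensm (idm C A) (lunit B)) (assoc A tunit B))
        (tensm (runit A) (idm C B));
  hexagon : forall A B D : Q,
    heq (compm C (assoc B D A) (compm C (braid A (tens B D)) (assoc A B D)))
        (compm C (tensm (idm C B) (braid A D))
          (compm C (assoc B A D) (tensm (braid A B) (idm C D))));
  braidK : forall A B : Q,
    heq (compm C (braid B A) (braid A B)) (idm C (tens A B)) }.

Arguments tens {Q C} s A B.
Arguments tensm {Q C} s {A A' B B'} f g.
Arguments tunit {Q C} s.
Arguments braid {Q C} s A B.

Record closed_structure {Q : quiver} (C : category_on Q)
    (M : symmetric_monoidal C) := Closed {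
  ihom : Q -> Q -> Q;
  ev : forall B D : Q, hom (tens M (ihom B D) B) D;
  curry : forall A B D : Q, hom (tens M A B) D -> hom A (ihom B D);
  curryP : forall (A B D : Q) (f : hom (tens M A B) D),
    heq (compm C (ev B D) (tensm M (curry f) (idm C B))) f;
  curry_uniq : forall (A B D : Q) (f : hom (tens M A B) D)
      (h : hom A (ihom B D)),
    heq (compm C (ev B D) (tensm M h (idm C B))) f -> heq h (curry f) }.

Arguments ihom {Q C M} c B D.
Arguments ev {Q C M} c B D.
Arguments curry {Q C M} c {A B D} f.

Definition to_bidual {Q : quiver} {C : category_on Q}
    {M : symmetric_monoidal C} (K : closed_structure M) (D A : Q) :
    hom A (ihom K (ihom K A D) D) :=
  curry K (compm C (ev K A D) (braid M A (ihom K A D))).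

Definition star_autonomous {Q : quiver} (C : category_on Q)
    (M : symmetric_monoidal C) (D : Q) : Prop :=
  exists K : closed_structure M, forall A : Q, is_iso C (to_bidual K D A).

(* The carrier of such a conduct is a finite subset of N. *)
Record conduct (R : realType) := Conduct {
  cset :> pset R nat;
  conductP : is_conduct cset }.

Record morphism {R : realType} (A B : conduct R) := Morphism {
  mproj : project R (nat * nat)%type;
  morphismP : lolli (relabel_set (psi 0) A) (relabel_set (psi 1) B) mproj }.

Definition conduct_quiver (R : realType) : quiver :=
  @Quiver (conduct R) (@morphism R)
    (fun A B f g => project_eq (mproj f) (mproj g)).

Definition id_project {R : realType} (X : {fset nat}) :
    project R (nat * nat)%type :=
  fax (psi 0 @` X)%fset (fun p => (p.1, 1%N)).

Definition tensor_object {R : realType} (A B : pset R nat) : pset R nat :=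
  relabel_set phi (tensor (relabel_set (psi 0) A) (relabel_set (psi 1) B)).

Definition tensor_project {R : realType}
    (f g : project R (nat * nat)%type) : project R (nat * nat)%type :=
  prelabel tau (ptensor (prelabel (psi 0) (prelabel phi f))
                        (prelabel (psi 1) (prelabel phi g))).

(* Main.v *)
From mathcomp Require Import all_boot all_order all_algebra finmap zify.
From mathcomp Require Import all_classical all_reals all_analysis.
Require Import Defs.

Set Implicit Arguments.
Unset Strict Implicit.
Unset Printing Implicit Defensive.

Import Order.TTheory GRing.Theory Num.Theory.

Local Open Scope ring_scope.
Local Open Scope classical_set_scope.

(** When A and G have disjoint carriers, cutting an alternating path or cycle
    between F and A u G at its G-edges gives <F, A u G> = <F, A> + <F::A, G> and
    (F::A)::G = F::(A u G).  With the symmetry of the cut this yields its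
    associativity on graphs without common location, and it shows that
    S -o T is the orthogonal of S (x) T^perp, from which the stability of
    morphisms under composition and tensor, the associativity of the tensor of
    conducts and currying follow formally.

    Cutting a project against a Fax renames its locations.  All structural
    morphisms, evaluation and the map to the bidual are renamings of Faxes, so
    that naturality, coherence and the universal property of evaluation become
    equalities between renamings of N x {0,1}, computed on binary digits. *)

(** * Words up to rotation *)

(** Edges of an iterated reduction are paths of paths, so the laws of projects hold only up to [=p],
    whereas conducts are compared by equality. The gap closes because orthogonality ignores the
    names of edges: sets that agree up to [=p] have equal orthogonals, and a conduct is an
    orthogonal.

    The measurement sums over rotation classes of primitive words, so cutting at G-edges must
    respect rotation and primitivity in both directions. It is treated as a code on abstract words:
    a cycle is first rotated to a marked letter, so that it is cut only at block boundaries, and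
    decoding is unique because marked letters and blocks alternate. Disjointness of A and G makes
    the colours agree: an A-edge never touches a G-edge, so a path of F::A that meets a G-edge ends
    there with an F-edge.

    Membership in S -o T also demands that cuts be defined. Additivity of the measurement, with
    infinite values allowed, provides this: an infinite pairing with s stays infinite with the
    tensor of s and t, so a project orthogonal to one such tensor has a defined cut with s. Hence
    the recurring nonemptiness conditions. *)

Section Words.
Variable T : Type.
Implicit Types s t u v : seq T.

Definition conjug s t := exists u v, s = u ++ v /\ t = v ++ u.

Lemma conjug_rot i s : conjug s (rot i s).
Proof. by exists (take i s), (drop i s); rewrite cat_take_drop. Qed.

Lemma conjugP s t : conjug s t <-> exists i, t = rot i s.
Proof.
split=> [[u [v [-> ->]]]|[i ->]]; last exact: conjug_rot.
by exists (size u); rewrite rot_size_cat.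
Qed.

Lemma conjug_refl s : conjug s s.
Proof. by exists [::], s; rewrite cats0. Qed.

Lemma conjug_sym s t : conjug s t -> conjug t s.
Proof. by move=> [u [v [-> ->]]]; exists v, u. Qed.

Lemma conjug_trans s t u : conjug s t -> conjug t u -> conjug s u.
Proof.
move=> /conjugP[i ->] /conjugP[j ->]; rewrite rot_rot_add; exact: conjug_rot.
Qed.

Lemma conjug_nil s t : conjug s t -> (s = [::]) <-> (t = [::]).
Proof. by move=> [u [v [-> ->]]]; case: u => [|? ?]; case: v. Qed.

Lemma conjug_cycle (r : rel T) s t : conjug s t -> cycle r t = cycle r s.
Proof. by move=> /conjugP[i ->]; exact: rot_cycle. Qed.

Definition pow s k := flatten (nseq k s).

Lemma powS s k : pow s k.+1 = s ++ pow s k. Proof. by []. Qed.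

Lemma pow_catC u v k : u ++ pow (v ++ u) k = pow (u ++ v) k ++ u.
Proof. by elim: k => [|k IH]; rewrite ?cats0// !powS -!catA IH. Qed.

(** The root [r] ranges over all words, not only over cycles. The empty word is its own zeroth
    power, hence not primitive. *)
Definition primitive s := forall r k, s = pow r k -> k = 1%N.

Lemma primitive_neq_nil s : primitive s -> s <> [::].
Proof. by move=> + s0; move=> /(_ [::] 0%N); rewrite s0 => /(_ erefl). Qed.

Lemma size_pow s k : size (pow s k) = (k * size s)%N.
Proof. by elim: k => // k IH; rewrite powS size_cat IH mulSn. Qed.

(** The closing step of [r] occurs in the power, either between two copies or as the closing step of
    the single one. So a root of a cycle is a cycle, and [primitive] may ignore this condition. *)
Lemma cycle_pow (e : rel T) r k : cycle e (pow r k.+1) -> cycle e r.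
Proof.
case: r => // x r; rewrite powS; case: k => [|k]; first by rewrite cats0.
by rewrite powS /= rcons_cat cat_path /= => /and3P[p1 p2 _]; rewrite rcons_path p1.
Qed.

(** Rotating a power of [x :: r'] by one letter gives the same power of [rcons r' x]; rotations past
    the length are trivial. *)
Lemma rot_pow i r k : exists r', rot i (pow r k) = pow r' k.
Proof.
elim: i => [|i [r' IH]]; first by exists r; rewrite rot0.
case: (ltnP i (size (pow r k))) => ik; last first.
  by exists r; rewrite rot_oversize// (leq_trans ik).
rewrite rotS// IH; case: r' {IH} => [|x r'].
  by exists [::]; case: k {ik} => //= k; rewrite /pow; elim: k.
exists (rcons r' x); case: k {ik} => // k.
by rewrite powS cat_cons rot1_cons -!cats1 -catA -(pow_catC [:: x] r') powS catA.
Qed.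

Lemma primitive_conjug s t : conjug s t -> primitive s -> primitive t.
Proof.
move=> /conjug_sym/conjugP[i ->] ps r k tr.
have [r' e] := rot_pow i r k; move: ps => /(_ r' k); apply.
by rewrite tr e.
Qed.

End Words.

(** * Sums over circuits of primitive words *)

Section Measure.
Variable R : realType.
Implicit Types E : choiceType.

Definition circ E (s : seq E) : set (seq E) := [set rot k s | k in [set: nat]].

Lemma circP E (s t : seq E) : circ s t <-> conjug s t.
Proof.
by rewrite conjugP; split=> [[k _ <-]|[k ->]]; [exists k|exists k].
Qed.

Lemma circ_eq E (s t : seq E) : circ s = circ t <-> conjug s t.
Proof.
split=> [e|st].
  by apply/circP; rewrite e; apply/circP; exact: conjug_refl.
apply/seteqP; split=> u /circP su; apply/circP; apply: conjug_trans su => //.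
exact: conjug_sym.
Qed.

Lemma xget_circ E (s : seq E) : conjug s (xget [::] (circ s)).
Proof. by apply/circP; apply: (@xgetI _ _ _ s); apply/circP/conjug_refl. Qed.

Definition wprod E (w : E -> R) (s : seq E) : R := \prod_(e <- s) w e.

Lemma wprod_conjug E (w : E -> R) (s t : seq E) :
  conjug s t -> wprod w t = wprod w s.
Proof.
move=> /conjugP[i ->]; rewrite /wprod; by apply: perm_big; rewrite perm_rot.
Qed.

Definition cyc E (r : rel E) : set (seq E) :=
  [set s | cycle r s /\ primitive s].

Definition circ_sum E (S : set (seq E)) (w : E -> R) : \bar R :=
  (\esum_(c in @circ E @` S) - lne (1 - wprod w (xget [::] c))%:E)%E.

(** [F] need not be a bijection of words: it has only to induce one on rotation classes. On a class
    it is evaluated at the representative picked by [xget], which stays in [S] because [S] is closed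
    under rotation. *)
Lemma circ_sum_transfer E E' (S : set (seq E)) (S' : set (seq E'))
    (w : E -> R) (w' : E' -> R) (F : seq E -> seq E') :
  (forall s, S s -> S' (F s)) ->
  (forall s t, S s -> conjug s t -> S t) ->
  (forall s t, S s -> S t -> conjug s t <-> conjug (F s) (F t)) ->
  (forall s', S' s' -> exists2 s, S s & conjug (F s) s') ->
  (forall s, S s -> wprod w' (F s) = wprod w s) ->
  circ_sum S' w' = circ_sum S w.
Proof.
move=> SS' Sc Fc Fs Fw.
have Sx s : S s -> S (xget [::] (circ s)).
  by move=> /Sc; apply; exact: xget_circ.
rewrite /circ_sum.
rewrite (reindex_esum (@circ E @` S) _ (fun c => circ (F (xget [::] c)))).
  apply: eq_esum => _ [s Ss <-]; have Ss' := Sx _ Ss.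
  by rewrite (wprod_conjug _ (xget_circ _)) Fw.
split=> [_ [s Ss <-]|c d|_ [s' Ss' <-]] /=.
- by exists (F (xget [::] (circ s))) => //; apply/SS'/Sx.
- rewrite !inE => -[s Ss <-] [t St <-] /circ_eq/(Fc _ _ (Sx _ Ss) (Sx _ St)) st.
  apply/circ_eq; apply: conjug_trans (xget_circ s) _.
  by apply: conjug_trans st _; exact/conjug_sym/xget_circ.
- have [s Ss ss'] := Fs _ Ss'; exists (circ s); first by exists s.
  apply/circ_eq; apply: conjug_trans ss'; apply/Fc => //; first exact: Sx.
  exact/conjug_sym/xget_circ.
Qed.

Lemma circ_sum_ge0 E (S : set (seq E)) (w : E -> R) :
  (forall e, 0 < w e <= 1) ->
  forall c, (0 <= - lne (1 - wprod w (xget [::] c))%:E :> \bar R)%E.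
Proof.
move=> w01 c; have /andP[w0 w1] : 0 < wprod w (xget [::] c) <= 1.
  apply/andP; split; first by apply: prodr_gt0 => e _; have /andP[] := w01 e.
  by apply: prodr_ile1 => e _; have /andP[/ltW -> ->] := w01 e.
rewrite oppe_ge0 /lne; case: ifPn => // _.
by rewrite lee_fin ln_le0// gerBl ltW.
Qed.

(** Containing a marked letter is invariant under rotation, so whole circuits are sorted; the terms
    are nonnegative, which lets the infinite sum be split. *)
Lemma circ_sum_split E (S : set (seq E)) (w : E -> R) (m : pred E) :
  (forall e, 0 < w e <= 1) ->
  circ_sum S w = (circ_sum [set s | S s /\ ~~ has m s] w
                + circ_sum [set s | S s /\ has m s] w)%E.
Proof.
move=> w01; rewrite /circ_sum.
rewrite (esumID (@circ E @` [set s | ~~ has m s]))//; last first.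
  by move=> c _; exact: circ_sum_ge0.
have hasc (s t : seq E) : conjug s t -> has m s = has m t.
  by move=> [u [v [-> ->]]]; rewrite !has_cat orbC.
congr (_ + _)%E; congr (esum _ _); apply/seteqP; split=> c.
- move=> [[s Ss <-] [t /= tm /circ_eq/hasc st]]; exists s => //=.
  by rewrite st in tm.
- by move=> [s [Ss sm] <-]; split; exists s.
- move=> [[s Ss <-] sm]; exists s => //; split=> //; apply/negPn/negP => sm'.
  by apply: sm; exists s.
- move=> [s [Ss sm] <-]; split; first by exists s.
  by move=> [t /= tm /circ_eq/hasc ts]; rewrite ts sm in tm.
Qed.

Lemma primitive_map (E E' : Type) (f : E -> E') (s : seq E) :
  injective f -> primitive s <-> primitive (map f s).
Proof.
move=> fi; split=> p r k; last first.
  by move=> e; apply: (p (map f r)); rewrite e /pow map_flatten map_nseq.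
case: k => [e|k e]; first by apply: (p [::]); move: e; case: s p.
(* With at least one copy present, the root is a prefix of the image, hence the image of a prefix of
   [s]. *)
have [r' er] : exists r', r = map f r'.
  exists (take (size r) s); rewrite map_take e powS take_size_cat//.
apply: (p r'); apply: (inj_map fi).
by rewrite e er /pow map_flatten map_nseq.
Qed.

Lemma conjug_map (E E' : Type) (f : E -> E') (s t : seq E) :
  injective f -> conjug s t <-> conjug (map f s) (map f t).
Proof.
move=> fi; rewrite !conjugP; split=> -[i e]; exists i; first by rewrite e map_rot.
by apply: (inj_map fi); rewrite e map_rot.
Qed.

Lemma wprod_map E E' (f : E -> E') (w : E -> R) (w' : E' -> R) (s : seq E) :
  (forall e, w' (f e) = w e) -> wprod w' (map f s) = wprod w s.
Proof. by move=> h; rewrite /wprod big_map; apply: eq_bigr. Qed.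

(** Serves for cycles that avoid the marked letters, where [P] is the range of an embedding of
    alphabets, and for bijective renamings, where [P] is everything. *)
Lemma circ_sum_map E E' (f : E -> E') (r : rel E) (r' : rel E')
    (w : E -> R) (w' : E' -> R) (P : pred E') :
  injective f -> (forall x y, r' (f x) (f y) = r x y) ->
  (forall e, w' (f e) = w e) ->
  (forall e, P e <-> exists e0, e = f e0) ->
  circ_sum [set s | cyc r' s /\ all P s] w' = circ_sum (cyc r) w.
Proof.
move=> fi fr fw fP.
have cm s : cycle r' (map f s) = cycle r s.
  case: s => // x s; rewrite /= -map_rcons path_map.
  by apply: eq_path => y z /=; rewrite fr.
apply: (@circ_sum_transfer _ _ _ _ _ _ (map f)) => [s [cs ps]|s t [cs ps] st|||s _].
- split; first by split; [rewrite cm|exact/(primitive_map _ fi)].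
  by rewrite all_map; apply/allP => x _ /=; apply/fP; exists x.
- split; [by rewrite (conjug_cycle _ st)|exact: primitive_conjug st ps].
- by move=> s t _ _; exact: conjug_map.
- move=> s' [[cs ps] /allP aP].
  have [s es] : exists s, s' = map f s.
    elim: s' aP {cs ps} => [|x s IH] aP; first by exists [::].
    have [t ->] : exists t, s = map f t.
      by apply: IH => y ys; apply: aP; rewrite inE ys orbT.
    by have /fP[y ->] : P x by [apply: aP; rewrite mem_head]; exists (y :: t).
  exists s; last by rewrite es; exact: conjug_refl.
  by split; [rewrite -cm -es|apply/(primitive_map _ fi); rewrite -?es].
- exact: wprod_map.
Qed.

End Measure.

(** * Grouping the unmarked letters of a word into blocks *)

(* A letter x of the alphabet E2 stands for the word kw x over E; marked letters
   stand for single marked letters, unmarked ones for blocks of unmarked letters. *)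
Section Code.
Variables (E E2 : choiceType) (r : rel E) (r2 : rel E2) (m : pred E) (m2 : pred E2).
Variables (kh : E2 -> E) (kt : E2 -> seq E).
Let kw x := kh x :: kt x.
Let kl x := last (kh x) (kt x).
Hypothesis kw_inj : injective kw.
Hypothesis kw_marked : forall x, m2 x -> kt x = [::] /\ m (kh x).
Hypothesis kw_unmarked : forall x, ~~ m2 x -> all (predC m) (kw x).
Hypothesis kw_path : forall x, path r (kh x) (kt x).
Hypothesis r2E : forall x y, r2 x y = (m2 x != m2 y) && r (kl x) (kh y).
Hypothesis r_marked : forall e f, r e f -> ~~ (m e && m f).

Definition expand (s : seq E2) : seq E := flatten (map kw s).

Lemma expand_cat s t : expand (s ++ t) = expand s ++ expand t.
Proof. by rewrite /expand map_cat flatten_cat. Qed.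

Lemma expand_cons x s : expand (x :: s) = kh x :: (kt x ++ expand s).
Proof. by []. Qed.

Lemma expandE x s : expand (x :: s) = kw x ++ expand s.
Proof. by []. Qed.

Lemma expand_pow s k : expand (pow s k) = pow (expand s) k.
Proof. by elim: k => // k IH; rewrite !powS expand_cat IH. Qed.

Lemma m_kh x : m (kh x) = m2 x.
Proof.
by apply/idP/idP => [|/kw_marked[]//]; apply: contraTT => /kw_unmarked/andP[].
Qed.

Lemma m_kl x : m (kl x) = m2 x.
Proof.
apply/idP/idP => [|/[dup]/kw_marked[kx mx] _]; last by rewrite /kl kx.
by apply: contraTT => /kw_unmarked/allP/(_ (kl x)); apply; rewrite mem_last.
Qed.

Lemma path_expand x s : path r2 x s -> path r (kh x) (kt x ++ expand s).
Proof.
elim: s x => [|y s IH] x; first by rewrite cats0.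
by rewrite /= r2E => /andP[/andP[_ xy] /IH ys]; rewrite cat_path kw_path /= xy.
Qed.

Lemma last_expand x s : last (kh x) (kt x ++ expand s) = kl (last x s).
Proof.
by elim: s x => [|y s IH] x; rewrite ?cats0// last_cat expand_cons /= IH.
Qed.

Let alt := [rel x y | m2 x != m2 y].

Lemma path_alt x s : path r2 x s -> path alt x s.
Proof. by apply: sub_path => y z; rewrite r2E => /andP[]. Qed.

(** In an alternating word a block is followed by a marked letter or by the end, so the position of
    the first marked letter measures the block. *)
Lemma find_block x s : ~~ m2 x -> path alt x s ->
  find m (expand (x :: s)) = size (kw x).
Proof.
move=> mx; have := kw_unmarked mx; rewrite expandE => am.
rewrite find_cat; have /negPf -> : ~~ has m (kw x) by rewrite -all_predC.
case: s => [|y s]; first by rewrite addn0.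
rewrite expand_cons /= (negPf mx) => /andP[my _]; rewrite m_kh.
by case: (m2 y) my => //; rewrite addn0.
Qed.

(** The first letter tells whether the first code letter is marked, and [find_block] gives the
    length of a block; so the first code word is determined and can be stripped off. Only
    alternation is assumed, as the lemma also serves for powers. *)
Lemma expand_inj_path s t : sorted alt s -> sorted alt t ->
  expand s = expand t -> s = t.
Proof.
elim: s t => [|x s IH] [|y t]//= xs yt e.
have xy : kw x = kw y.
  case: (boolP (m2 x)) => mx.
    have my : m2 y by rewrite -m_kh; move: e; rewrite !expand_cons => -[<- _]; rewrite m_kh.
    rewrite /kw (kw_marked mx).1 (kw_marked my).1.
    by move: e; rewrite !expand_cons => -[-> _].
  have my : ~~ m2 y by rewrite -m_kh; move: e; rewrite !expand_cons => -[<- _]; rewrite m_kh.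
  have sz : size (kw x) = size (kw y) by rewrite -(find_block mx xs) e find_block.
  have := congr1 (take (size (kw x))) e.
  by rewrite !expandE take_size_cat// take_size_cat.
move/kw_inj: (xy) => {}xy; rewrite -xy in yt e *; congr (_ :: _).
apply: IH; [exact: path_sorted xs|exact: path_sorted yt|].
by move: e; rewrite !expand_cons => -[/eqP]; rewrite eqseq_cat// eqxx => /= /eqP.
Qed.

(* The letters at which a block may begin and end. *)
Variables (okh okl : pred E).
Hypothesis okh_marked : forall e f, m e -> r e f -> okh f.
Hypothesis okl_marked : forall e f, m f -> r e f -> okl e.
Hypothesis cover_marked : forall e, m e -> exists x, kw x = [:: e].
Hypothesis cover_unmarked : forall e s, path r e s -> all (predC m) (e :: s) ->
  okh e -> okl (last e s) -> exists x, kw x = e :: s.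

(** Greedy decoding: a marked letter is a code word by itself, an unmarked stretch up to the next
    marked letter is a block. Inner block ends are admissible because they touch a marked letter;
    only the two ends of the path need assumptions. *)
Lemma expand_surj e u : path r e u -> (~~ m e -> okh e) ->
  (~~ m (last e u) -> okl (last e u)) ->
  exists x s, [/\ path r2 x s & expand (x :: s) = e :: u].
Proof.
have [n] := ubnP (size u); elim: n e u => // n IH e u; rewrite ltnS => un eu oe ou.
have marked_kw x e' : kw x = [:: e'] -> m e' -> m2 x.
  by rewrite /kw => -[<- _]; rewrite m_kh.
case: (boolP (m e)) => me.
  have [x kx] := cover_marked me; have mx := marked_kw _ _ kx me.
  have [xe xt] : kh x = e /\ kt x = [::] by case: kx.
  case: u un eu ou => [|f u] un eu ou.
    by exists x, [::]; split=> //; rewrite expand_cons xe xt.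
  move: eu => /= /andP[ef fu].
  have [||y [s [ys us]]] := IH f u un fu; first by move=> _; exact: okh_marked ef.
    exact: ou.
  exists x, (y :: s); split; last by rewrite expand_cons xe xt us.
  rewrite /= ys r2E andbT /kl xt /= xe.
  have <- : f = kh y by move: us; rewrite expand_cons => -[].
  rewrite ef andbT mx -m_kh.
  have <- : f = kh y by move: us; rewrite expand_cons => -[].
  by have := r_marked ef; rewrite me /= => /negPf ->.
(* The block is [e :: take i u]: either the word stops there, or the letter at position [i] is
   marked. *)
pose i := find m u.
have im : all (predC m) (take i u).
  rewrite all_predC; case: (boolP (has m u)) => [hm|]; first by rewrite has_take// ltnn.
  by apply: contra => /hasP[y /mem_take yu my]; apply/hasP; exists y.
have eu' : u = take i u ++ drop i u by rewrite cat_take_drop.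
case: (posnP (size (drop i u))) => [/size0nil d0|].
  have ut : take i u = u by rewrite {2}eu' d0 cats0.
  rewrite ut in im.
  have ml : ~~ m (last e u).
    have : all (predC m) (e :: u) by rewrite /= me.
    by move=> /allP/(_ (last e u)); apply; rewrite mem_last.
  have [|x kx] := cover_unmarked eu _ (oe me) (ou ml); first by rewrite /= me.
  by exists x, [::]; split=> //; rewrite expandE kx cats0.
case ed : (drop i u) => [//|f v] _.
have mf : m f.
  have iu : (i < size u)%N by rewrite ltnNge -subn_eq0 -size_drop ed.
  have hm : has m u by rewrite has_find.
  by have := nth_find f hm; rewrite -/i -[i]addn0 -nth_drop ed.
have := eu; rewrite eu' ed cat_path /= => /andP[p1 /andP[rf p2]].
have [|x kx] := cover_unmarked p1 _ (oe me) (okl_marked mf rf); first by rewrite /= me.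
have vn : (size v < n)%N.
  apply: leq_trans un; rewrite eu' ed size_cat /= addnS ltnS; exact: leq_addl.
have [||y [s [ys vs]]] := IH f v vn p2.
- by rewrite mf.
- by move: ou; rewrite eu' ed last_cat.
exists x, (y :: s); split; last first.
  by rewrite expandE kx vs.
have yf : f = kh y by move: vs; rewrite expand_cons => -[].
have xk : kl x = last e (take i u).
  by move: kx; rewrite /kl /kw => -[-> ->].
have xh : kh x = e by case: kx.
by rewrite /= ys andbT r2E xk -yf rf -!m_kh -yf mf xh (negPf me).
Qed.

Lemma cycle_expand s : cycle r2 s -> cycle r (expand s).
Proof.
case: s => // x s; rewrite /= => /path_expand.
(* The closed path expands to one that runs through the whole last copy of [x]; only the first
   letter of that copy is kept. *)
rewrite -cats1 expand_cat [expand [:: x]]/= catA cat_path => /andP[p].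
by rewrite /= rcons_path p => /andP[].
Qed.

Lemma sorted_cycle_alt s : cycle r2 s -> sorted alt s.
Proof.
case: s => // x s; rewrite /= rcons_path => /andP[]. by move=> /path_alt.
Qed.

(** Starting at a marked letter opens the cycle at a block boundary; the end of the word is
    admissible because the closing step leads to the marked [e]. *)
Lemma cycle_expand_surj e u : m e -> cycle r (e :: u) ->
  exists x s, [/\ m2 x, cycle r2 (x :: s) & expand (x :: s) = e :: u].
Proof.
move=> me; rewrite /= rcons_path => /andP[eu ue].
have [||x [s [xs us]]] := expand_surj eu; first by rewrite me.
  by move=> _; exact: okl_marked ue.
have mx : m2 x by rewrite -m_kh; move: us; rewrite expand_cons => -[->].
exists x, s; split=> //; rewrite /= rcons_path xs r2E.
have -> : kh x = e by move: us; rewrite expand_cons => -[].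
have <- : last e u = kl (last x s).
  by rewrite -last_expand; move: us; rewrite expand_cons => -[-> ->].
rewrite ue andbT -m_kl.
have <- : last e u = kl (last x s).
  by rewrite -last_expand; move: us; rewrite expand_cons => -[-> ->].
by have := r_marked ue; rewrite mx me andbT; case: (m _).
Qed.

Lemma has_expand s : has m (expand s) = has m2 s.
Proof.
elim: s => // x s IH; rewrite expand_cons /= has_cat IH m_kh orbA; congr (_ || _).
case: (boolP (m2 x)) => //= /kw_unmarked; rewrite all_predC /= negb_or.
by move=> /andP[_ /negPf].
Qed.

(** The closing step alternates too, so two neighbours, possibly the same letter, are never both
    unmarked. *)
Lemma cycle_has_marked s : cycle r2 s -> s <> [::] -> has m2 s.
Proof.
case: s => // x s; rewrite /= => cs _; apply/negPn/negP; rewrite negb_or => /andP[mx ms].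
move: cs; case: s ms => [|y s]; rewrite /= r2E; first by rewrite eqxx.
by rewrite negb_or => /andP[/negPf -> _]; rewrite (negPf mx).
Qed.

Lemma conjug_expand s t : conjug s t -> conjug (expand s) (expand t).
Proof. by move=> [u [v [-> ->]]]; exists (expand u), (expand v); rewrite !expand_cat. Qed.

Lemma has_conjug (T : Type) (p : pred T) (s : seq T) :
  has p s -> exists x u, p x /\ conjug s (x :: u).
Proof.
move=> /[dup] ps; rewrite has_find => lt.
case ed : (drop (find p s) s) => [|x u].
  by move: lt; rewrite ltnNge -subn_eq0 -size_drop ed.
exists x, (u ++ take (find p s) s); split.
  by have := nth_find x ps; rewrite -[X in nth _ _ X]addn0 -nth_drop ed.
by exists (take (find p s) s), (drop (find p s) s); rewrite cat_take_drop ed.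
Qed.

(* A marked letter of expand t is the code of a marked letter of t, hence words
   can be rotated simultaneously on both sides. *)
Lemma expand_split t u e v : expand t = u ++ e :: v -> m e ->
  exists t1 x t2, [/\ t = t1 ++ x :: t2, expand t1 = u & kh x = e].
Proof.
elim: t u => [|x t IH] u; first by case: u.
move=> dt me; case: (boolP (m2 x)) => mx.
  case: u dt => [|e' u]; rewrite expand_cons (kw_marked mx).1 /=.
    by move=> -[xe _]; exists [::], x, t.
  move=> [xe /IH[]// t1 [y [t2 [-> <- <-]]]]; exists (x :: t1), y, t2.
  by rewrite expand_cons (kw_marked mx).1 xe.
have eu : take (size (kw x)) u = kw x /\ (size (kw x) <= size u)%N.
  have sz : (size (kw x) <= size u)%N.
    rewrite leqNgt; apply/negP => lt.
    have := congr1 (fun s => nth e s (size u)) dt.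
    rewrite /= nth_cat ltnn subnn expandE nth_cat lt /= => ke.
    have := kw_unmarked mx => /allP/(_ e); rewrite /= me => h.
    by have := h _; rewrite -{1}ke mem_nth// => /(_ isT).
  by have := congr1 (take (size (kw x))) dt; rewrite expandE take_size_cat// takel_cat.
move: eu => [eu _].
have : expand t = drop (size (kw x)) u ++ e :: v.
  have := dt; rewrite -{1}(cat_take_drop (size (kw x)) u) eu -catA.
  rewrite expandE => /eqP.
  by rewrite eqseq_cat// eqxx => /= /eqP.
move=> /IH[//|t1 [y [t2 [-> dt1 <-]]]]; exists (x :: t1), y, t2; split=> //.
by rewrite expandE dt1 -{1}eu cat_take_drop.
Qed.

(** For the converse, [s] is rotated to begin with a marked letter. A rotation of the expansion of
    [t] that begins with a marked letter is the expansion of a rotation of [t], by [expand_split],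
    and injectivity concludes. *)
Lemma conjug_expandP s t : cycle r2 s -> cycle r2 t ->
  conjug s t <-> conjug (expand s) (expand t).
Proof.
move=> cs ct; split; first exact: conjug_expand.
case: (eqVneq s [::]) => [->|/eqP s0].
  by move=> /conjug_nil[/(_ erefl)]; case: t {ct} => // _ _; exact: conjug_refl.
have /has_conjug[x [s' [mx ss']]] := cycle_has_marked cs s0.
move=> st; have := conjug_trans (conjug_sym (conjug_expand ss')) st.
move=> [u [v [xs tv]]].
have [t' tt' dt'] : exists2 t', conjug t t' & expand t' = expand (x :: s').
  case: u xs tv => [|e u] xs.
    by rewrite cats0 xs => tv; exists t => //; exact: conjug_refl.
  have me : m e by move: xs; rewrite expand_cons => -[<- _]; rewrite m_kh.
  move=> /[dup] /expand_split[//|t1 [y [t2 [-> dt1 _]]]] dt.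
  exists ((y :: t2) ++ t1); first by exists t1, (y :: t2).
  move: dt; rewrite xs !expand_cat dt1 => /eqP.
  by rewrite eqseq_cat// => /andP[_ /eqP ->].
suff e : t' = x :: s' by apply: conjug_trans ss' _; rewrite -e; exact: conjug_sym.
apply: expand_inj_path => //; apply: sorted_cycle_alt.
  by rewrite (conjug_cycle _ tt').
by rewrite (conjug_cycle _ ss').
Qed.

(** At the junction of two copies, alternation is the closing step of the cycle. *)
Lemma alt_pow x s k : m2 x -> cycle r2 (x :: s) -> sorted alt (pow (x :: s) k).
Proof.
move=> mx; rewrite /= rcons_path => /andP[/path_alt xs].
rewrite r2E mx => /andP[xl _].
case: k => // k; rewrite powS /= cat_path xs.
by elim: k => // k IH; rewrite powS /= mx xl cat_path xs.
Qed.

(** If the expansion of a cycle that starts with a marked letter is a power, the root is a cycle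
    starting with that same letter, hence the expansion of some [y :: t]; by injectivity the code
    word is the same power of [y :: t]. *)
Lemma primitive_expand s : cycle r2 s -> primitive s <-> primitive (expand s).
Proof.
move=> cs; split=> ps; last first.
  by move=> u k su; apply: (ps (expand u)); rewrite su expand_pow.
have /has_conjug[x [s' [mx ss']]] := cycle_has_marked cs (primitive_neq_nil ps).
apply: (primitive_conjug (conjug_expand (conjug_sym ss'))).
have {}ps := primitive_conjug ss' ps.
have {ss'}cs : cycle r2 (x :: s') by rewrite (conjug_cycle _ ss').
move=> u k; case: k => // k; case: u => [|e u] su.
  by have := congr1 size su; rewrite size_pow muln0.
have eu : e = kh x by move: su; rewrite powS expand_cons => -[->].
have me : m e by rewrite eu m_kh.
have cu : cycle r (e :: u).
  by have := cycle_expand cs; rewrite su => /cycle_pow.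
have [y [t [my ct dt]]] := cycle_expand_surj me cu.
apply: (ps (y :: t)); apply: expand_inj_path.
- exact: sorted_cycle_alt.
- exact: alt_pow.
- by rewrite su expand_pow dt.
Qed.

End Code.

Section CodeMeasure.
Variables (R : realType) (E E2 : choiceType) (w : E -> R) (w2 : E2 -> R).
Variables (kh : E2 -> E) (kt : E2 -> seq E).
Hypothesis wE : forall x, w2 x = wprod w (kh x :: kt x).

Lemma wprod_expand s : wprod w (expand kh kt s) = wprod w2 s.
Proof.
by rewrite /wprod /expand big_flatten big_map; apply: eq_bigr => x _; rewrite wE.
Qed.

End CodeMeasure.

Lemma inj_surj_bij (T T' : Type) (f : T -> T') :
  injective f -> (forall y, exists x, f x = y) -> bijective f.
Proof.
move=> fi /choice[g gK]; exists g => // x; exact: fi (gK (f x)).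
Qed.

(** * Measurement and reduction of graphs *)

Section GraphIso.
Variables (R : realType) (V : choiceType).
Implicit Types F G H A : graph R V.

Definition graph_eq G H := vert G = vert H /\
  exists2 h : edge G -> edge H, bijective h &
    forall e, [/\ src (h e) = src e, tgt (h e) = tgt e & wgt (h e) = wgt e].

(** Alternating cycles are cycles, and roots of cycles are cycles, so requiring [one_cycle] amounts
    to requiring primitivity. *)
Lemma measurementE G H :
  measurement G H = circ_sum (cyc (@altconsec _ _ G H)) (@uwgt _ _ G H).
Proof.
rewrite /measurement /circ_sum /Cycl; congr (esum (_ @` _) _).
apply/seteqP; split=> s /=.
  move=> [[/andP[s0 cs] ps] /andP[_ acs]]; split=> // r [|k] e.
    by rewrite e in s0.
  apply: ps (e); rewrite /is_cycle; apply/andP; split.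
    by apply: contra_neq s0 => r0; rewrite e r0; elim: k {e}.
  by apply: (@cycle_pow _ _ _ k); rewrite -e.
move=> [acs ps]; have s0 : s != [::] by apply/eqP/primitive_neq_nil.
split; last by rewrite /alt_cycle s0.
split=> [|r k _]; last exact: ps.
rewrite /is_cycle s0 /=; move: acs; case: (s) => //= x t.
by apply: sub_path => e f /andP[].
Qed.

Lemma uwgt01 G H (e : edge (gunion G H)) : 0 < uwgt e <= 1.
Proof. exact: uwgt_itv. Qed.

End GraphIso.

(* Paths between F and A u G are coded by paths between F::A and G: the marked
   edges are those of G, the blocks are the paths between F and A. *)
Section Adjunction.
Variables (R : realType) (V : choiceType) (F A G : graph R V).
Hypothesis AG : [disjoint vert A & vert G]%fset.

Let E := (edge F + (edge A + edge G))%type.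
Let r : rel E := @altconsec _ _ F (gunion A G).
Let m (e : E) := if e is inr (inr _) then true else false.
Let E2 := (redge F A + edge G)%type.
Let r2 : rel E2 := @altconsec _ _ (reduction F A) G.
Let m2 (e : E2) := if e is inr _ then true else false.
Let emb (e : edge F + edge A) : E :=
  match e with inl f => inl f | inr a => inr (inl a) end.
Let kh (x : E2) : E :=
  match x with inl p => emb (val p).1 | inr g => inr (inr g) end.
Let kt (x : E2) : seq E :=
  match x with inl p => map emb (val p).2 | inr g => [::] end.
Let es (e : E) : V := src (e : edge (gunion F (gunion A G))).
Let et (e : E) : V := tgt (e : edge (gunion F (gunion A G))).

Let emb_inj : injective emb.
Proof. by move=> [x|x] [y|y] //= [->]. Qed.

Let r_emb x y : r (emb x) (emb y) = @altconsec _ _ F A x y.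
Proof. by case: x => x; case: y => y. Qed.

Let m_emb x : m (emb x) = false. Proof. by case: x. Qed.

Let unmarked_emb e : ~~ m e <-> exists x, e = emb x.
Proof.
split=> [|[x ->]]; last by rewrite m_emb.
by case: e => [f|[a|//]] _; [exists (inl f)|exists (inr a)].
Qed.

Let all_emb s : all (predC m) s -> exists t, s = map emb t.
Proof.
elim: s => [_|e s IH] /=; first by exists [::].
by move=> /andP[/unmarked_emb[x ->] /IH[t ->]]; exists (x :: t).
Qed.

Let notAG x : x \in vert A -> x \in vert G -> False.
Proof. by move=> xA xG; have /fdisjointP/(_ x xA) := AG; rewrite xG. Qed.

Let es_emb x : es (emb x) = src (x : edge (gunion F A)).
Proof. by case: x. Qed.
Let et_emb x : et (emb x) = tgt (x : edge (gunion F A)).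
Proof. by case: x. Qed.

Let path_emb x s : path r (emb x) (map emb s) = path (@altconsec _ _ F A) x s.
Proof. by rewrite path_map; apply: eq_path => y z /=; rewrite r_emb. Qed.

Let last_emb x s : last (emb x) (map emb s) = emb (last x s).
Proof. by rewrite last_map. Qed.

Let kw_inj : injective (fun x => kh x :: kt x).
Proof.
move=> [p|g] [q|g'] //= []; last by move=> ->.
- move=> /emb_inj e1 /(inj_map emb_inj) e2; congr inl; apply: val_inj.
  by rewrite (surjective_pairing (val p)) (surjective_pairing (val q)); congr pair.
- by case: (val p).1.
- by case: (val q).1.
Qed.

Let kw_marked x : m2 x -> kt x = [::] /\ m (kh x).
Proof. by case: x. Qed.

Let kw_unmarked x : ~~ m2 x -> all (predC m) (kh x :: kt x).
Proof.
case: x => // p _; rewrite -[kh _ :: _]/(map emb ((val p).1 :: (val p).2)).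
by rewrite all_map; apply/allP => y _ /=; rewrite m_emb.
Qed.

Let kw_path x : path r (kh x) (kt x).
Proof. by case: x => // p; rewrite path_emb; have /and3P[] := valP p. Qed.

Let r_marked e f : r e f -> ~~ (m e && m f).
Proof.
by case: e => [f1|[a1|g1]]; case: f => [f2|[a2|g2]]; rewrite /r /altconsec /= ?andbF.
Qed.

Let okh e := es e \in rvert F A.
Let okl e := et e \in rvert F A.

(** A vertex common to F and G is not in A. Blocks adjacent to a G-edge therefore end in the
    symmetric difference of F and A, as edges of F::A must. *)
Let in_rvert x : x \in vert F -> x \in vert G -> x \in rvert F A.
Proof.
move=> xF xG; rewrite !inE xF andbT; apply/orP; left.
by apply/negP => /notAG; apply.
Qed.

Let okh_marked e f : m e -> r e f -> okh f.
Proof.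
case: e => [f1|[a1|g1]]; case: f => [f2|[a2|g2]]; rewrite /r /altconsec //= ?andbF//.
rewrite andbT => _ /eqP e; apply: in_rvert; rewrite /es /=; first exact: src_vert.
by rewrite e tgt_vert.
Qed.

Let okl_marked e f : m f -> r e f -> okl e.
Proof.
case: e => [f1|[a1|g1]]; case: f => [f2|[a2|g2]]; rewrite /r /altconsec //= ?andbF//.
rewrite andbT => _ /eqP e; apply: in_rvert; rewrite /et /=; first exact: tgt_vert.
by rewrite -e src_vert.
Qed.

(** Edges of F::A all carry one colour, which hides whether the path ends with an F-edge or an
    A-edge. An A-edge cannot meet a G-edge, so where the path meets one its outer edge belongs to F
    and both notions of alternation agree. *)
Let r2E x y : r2 x y = (m2 x != m2 y) && r (last (kh x) (kt x)) (kh y).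
Proof.
case: x => [p|g]; case: y => [q|g']; rewrite /r2 /altconsec /= ?andbF//.
  rewrite last_emb /r /altconsec /= andbT /rtgt /path_tgt.
  case: (last _ _) => [f|a] /=; rewrite ?andbT// andbF.
  by apply/eqP => e; apply: (@notAG (tgt a)); [exact: tgt_vert|rewrite -e src_vert].
rewrite /r /altconsec /= andbT /rsrc /path_src.
case: (val q).1 => [f|a] /=; rewrite ?andbT// andbF.
by apply/eqP => e; apply: (@notAG (src a)); [exact: src_vert|rewrite e tgt_vert].
Qed.

Let cover_marked e : m e -> exists x, kh x :: kt x = [:: e].
Proof. by case: e => [//|[//|g]] _; exists (inr g). Qed.

Let cover_unmarked e s : path r e s -> all (predC m) (e :: s) ->
  okh e -> okl (last e s) -> exists x, kh x :: kt x = e :: s.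
Proof.
move=> p /all_emb[[//|x t]] [ex et'] oe ol.
rewrite ex et' path_emb last_emb in p oe ol *.
have px : redge_pred (x, t).
  rewrite /redge_pred /alt_path p /=; apply/andP; split.
    by move: oe; rewrite /okh es_emb.
  by move: ol; rewrite /okl et_emb.
by exists (inl (@exist _ (fun p => is_true (redge_pred p)) (x, t) px)).
Qed.

Let w (e : E) : R := uwgt (e : edge (gunion F (gunion A G))).
Let w2 (x : E2) : R := uwgt (x : edge (gunion (reduction F A) G)).

Let w_emb x : w (emb x) = uwgt (x : edge (gunion F A)).
Proof. by case: x. Qed.

Let w2E x : w2 x = wprod w (kh x :: kt x).
Proof.
case: x => [p|g]; last by rewrite /wprod big_seq1.
rewrite -[kh _ :: _]/(map emb ((val p).1 :: (val p).2)).
by rewrite (@wprod_map _ _ _ emb (@uwgt _ _ F A)) //; exact: w_emb.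
Qed.

(** Cycles without a G-edge are the cycles between F and A; those with one decode to cycles between
    F::A and G. *)
Lemma measurement_adj :
  measurement F (gunion A G) = (measurement F A + measurement (reduction F A) G)%E.
Proof.
rewrite !measurementE.
rewrite (@circ_sum_split _ _ _ (@uwgt _ _ F (gunion A G)) m (@uwgt01 _ _ _ _)).
congr (_ + _)%E.
  have -> : [set s | cyc r s /\ ~~ has m s] = [set s | cyc r s /\ all (predC m) s].
    by apply/seteqP; split=> s /=; rewrite all_predC.
  exact: (@circ_sum_map _ _ _ emb).
apply: (@circ_sum_transfer _ _ _ _ _ _ _ (expand kh kt)).
- move=> s [cs ps]; split.
    split; first exact: (cycle_expand kw_path r2E cs).
    by apply/(primitive_expand kw_inj kw_marked kw_unmarked kw_path r2E
      r_marked okh_marked okl_marked cover_marked cover_unmarked).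
  rewrite (has_expand kw_marked kw_unmarked).
  by apply: cycle_has_marked r2E _ cs _; exact: primitive_neq_nil.
- move=> s t [cs ps] st; split; first by rewrite (conjug_cycle _ st).
  exact: primitive_conjug ps.
- move=> s t [cs _] [ct _].
  exact: (conjug_expandP kw_inj kw_marked kw_unmarked r2E).
- move=> s' [[cs ps] /has_conjug[e [u [me su]]]].
  have ceu : cycle r (e :: u) by rewrite (conjug_cycle _ su).
  have [x [s [mx cxs dxs]]] := cycle_expand_surj kw_marked kw_unmarked r2E
    r_marked okh_marked okl_marked cover_marked cover_unmarked me ceu.
  exists (x :: s); last by rewrite dxs; exact: conjug_sym.
  split=> //; apply/(primitive_expand kw_inj kw_marked kw_unmarked kw_path r2E
    r_marked okh_marked okl_marked cover_marked cover_unmarked) => //.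
  by rewrite dxs; exact: primitive_conjug ps.
- by move=> s _; exact: wprod_expand.
Qed.

Lemma rvert_adj : rvert (reduction F A) G = rvert F (gunion A G).
Proof.
apply/fsetP => x; rewrite !inE.
have := @notAG x; case: (x \in vert A); case: (x \in vert G); case: (x \in vert F) => //=.
all: by move=> /(_ isT isT).
Qed.

Let src_kh x : es (kh x) = src (x : edge (gunion (reduction F A) G)).
Proof. by case: x => [p|//]; rewrite es_emb. Qed.

Let tgt_kl x : et (last (kh x) (kt x)) = tgt (x : edge (gunion (reduction F A) G)).
Proof. by case: x => [p|//]; rewrite last_emb et_emb. Qed.

Let src_expand x s :
  path_src (G := gunion F (gunion A G)) (kh x, kt x ++ expand kh kt s)
  = path_src (G := gunion (reduction F A) G) (x, s).
Proof. exact: src_kh. Qed.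

Let tgt_expand x s :
  path_tgt (G := gunion F (gunion A G)) (kh x, kt x ++ expand kh kt s)
  = path_tgt (G := gunion (reduction F A) G) (x, s).
Proof. by rewrite {1}/path_tgt /= last_expand; exact: tgt_kl. Qed.

Let expand_redge_pred (q : redge (reduction F A) G) :
  @redge_pred _ _ F (gunion A G)
    (kh (val q).1, kt (val q).1 ++ expand kh kt (val q).2).
Proof.
have /and3P[p s t] := valP q; apply/and3P; split.
- exact: path_expand kw_path r2E _ _ p.
- by rewrite -rvert_adj src_expand -surjective_pairing.
- by rewrite -rvert_adj tgt_expand -surjective_pairing.
Qed.

Definition expand_redge (q : redge (reduction F A) G) : redge F (gunion A G) :=
  @exist _ (fun p => is_true (redge_pred p)) _ (expand_redge_pred q).

Lemma reduction_adj :
  graph_eq (reduction (reduction F A) G) (reduction F (gunion A G)).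
Proof.
split; first exact: rvert_adj.
exists expand_redge => [|q]; last first.
  split; last exact: (wprod_expand w2E ((val q).1 :: (val q).2)).
    by rewrite /= /rsrc src_expand -surjective_pairing.
  by rewrite /= /rtgt tgt_expand -surjective_pairing.
apply: inj_surj_bij => [p q|[[e u] eu]].
  move=> /(congr1 val) e; apply: val_inj.
  have e1 : kh (val p).1 = kh (val q).1 := congr1 fst e.
  have e2 : kt (val p).1 ++ expand kh kt (val p).2 =
            kt (val q).1 ++ expand kh kt (val q).2 := congr1 snd e.
  have /and3P[+ _ _] := valP p; have /and3P[+ _ _] := valP q.
  move: e1 e2 {e}; case: (val p) (val q) => x s [y t] /= e1 e2 yt xs.
  suff [-> ->] : x :: s = y :: t by [].
  apply: (expand_inj_path kw_inj kw_marked kw_unmarked) => //.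
  - exact: path_alt r2E _ _ xs.
  - exact: path_alt r2E _ _ yt.
  - by rewrite !expand_cons e1 e2.
have /and3P[pr sr tr] := eu.
(* An unmarked end of the path is a vertex of F outside A or of A outside F, hence admissible as the
   end of a block. *)
have rF x : x \in vert F -> x \in rvert F (gunion A G) -> x \in rvert F A.
  by rewrite !inE => ->; case: (x \in vert A).
have rA x : x \in vert A -> x \in rvert F (gunion A G) -> x \in rvert F A.
  by rewrite !inE => ->; case: (x \in vert F).
have he : ~~ m e -> okh e.
  move: sr; rewrite /path_src /okh /es /=; case: e {eu pr tr} => [f|[a|//]] /= + _.
    exact/rF/src_vert.
  exact/rA/src_vert.
have hl : ~~ m (last e u) -> okl (last e u).
  move: tr; rewrite /path_tgt /okl /et /=; case: (last e u) => [f|[a|//]] /= + _.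
    exact/rF/tgt_vert.
  exact/rA/tgt_vert.
have [x [s [xs dxs]]] := expand_surj kw_marked kw_unmarked r2E r_marked
  okh_marked okl_marked cover_marked cover_unmarked pr he hl.
have exs : (kh x, kt x ++ expand kh kt s) = (e, u).
  by move: dxs; rewrite expand_cons => -[-> ->].
have xsr : @redge_pred _ _ (reduction F A) G (x, s).
  apply/and3P; split=> //.
    by rewrite -src_expand exs rvert_adj.
  by rewrite -tgt_expand exs rvert_adj.
exists (@exist _ (fun p => is_true (@redge_pred _ _ (reduction F A) G p)) (x, s) xsr).
exact: val_inj.
Qed.

End Adjunction.

Lemma all_map_surj (T T' : Type) (f : T -> T') :
  (forall y, exists x, y = f x) -> forall s, exists t, s = map f t.
Proof.
move=> fs; elim=> [|y s [t ->]]; first by exists [::].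
by have [x ->] := fs y; exists (x :: t).
Qed.

(** * Invariance under renaming of edges and vertices *)

Section Isomorphism.
Variables (R : realType) (V W : choiceType).
Variables (F G : graph R V) (F' G' : graph R W).
Variable h : edge F + edge G -> edge F' + edge G'.
Hypothesis h_inj : injective h.
Hypothesis h_surj : forall y, exists x, y = h x.
Hypothesis h_alt : forall x y,
  @altconsec _ _ F' G' (h x) (h y) = @altconsec _ _ F G x y.
Hypothesis h_wgt : forall x, @uwgt _ _ F' G' (h x) = @uwgt _ _ F G x.

(** [h] acts on the disjoint sum and must respect alternation but not colours, so it may exchange
    the two graphs: commutativity and renaming are both instances. *)
Lemma measurement_iso : measurement F' G' = measurement F G.
Proof.
rewrite !measurementE -(@circ_sum_map _ _ _ _ (@altconsec _ _ F G)
  (@altconsec _ _ F' G') _ (@uwgt _ _ F' G') predT h_inj h_alt h_wgt).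
  by congr circ_sum; apply/seteqP; split=> s /= => [cs|[]//]; rewrite all_predT.
by move=> e; split=> // _; exact: h_surj.
Qed.

Variable theta : V -> W.
Hypothesis h_src : forall x, @usrc _ _ F' G' (h x) = theta (@usrc _ _ F G x).
Hypothesis h_tgt : forall x, @utgt _ _ F' G' (h x) = theta (@utgt _ _ F G x).
Hypothesis theta_rvert : forall x, x \in (vert F `|` vert G)%fset ->
  (theta x \in rvert F' G') = (x \in rvert F G).
Hypothesis rvert_theta : rvert F' G' = (theta @` rvert F G)%fset.

Let hpred (p : redge F G) :
  @redge_pred _ _ F' G' (h (val p).1, map h (val p).2).
Proof.
have /and3P[q s t] := valP p; apply/and3P; split.
- by rewrite /alt_path /= path_map; apply: sub_path q => x y; rewrite -h_alt.
- by rewrite /path_src /= h_src theta_rvert// usrc_vert.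
- by rewrite /path_tgt /= last_map h_tgt theta_rvert// utgt_vert.
Qed.

Lemma reduction_iso : graph_eq (relabel theta (reduction F G)) (reduction F' G').
Proof.
split; first by rewrite /= rvert_theta.
exists (fun p => @exist _ (fun p => is_true (@redge_pred _ _ F' G' p)) _ (hpred p)).
  apply: inj_surj_bij => [p q /(congr1 val) e|[[e u] eu]].
    have e1 : h (val p).1 = h (val q).1 := congr1 fst e.
    have e2 : map h (val p).2 = map h (val q).2 := congr1 snd e.
    apply: val_inj; rewrite (surjective_pairing (val p)) (surjective_pairing (val q)).
    by congr pair; [exact: h_inj|exact: (inj_map h_inj)].
  have [x ex] := h_surj e; have [s es] := all_map_surj h_surj u.
  have xs : @redge_pred _ _ F G (x, s).
    have /and3P[q sr t] := eu; apply/and3P; split.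
    - move: q; rewrite /alt_path /= ex es path_map.
      by apply: sub_path => y z /=; rewrite -[in X in _ -> X]h_alt.
    - by rewrite -theta_rvert ?usrc_vert// -h_src -ex.
    - rewrite -theta_rvert ?utgt_vert//; move: t.
      by rewrite /path_tgt /= ex es last_map h_tgt.
  exists (@exist _ (fun p => is_true (@redge_pred _ _ F G p)) (x, s) xs).
  by apply: val_inj; rewrite /= ex es.
move=> p; split=> /=.
- by rewrite /rsrc /path_src /= h_src.
- by rewrite /rtgt /path_tgt /= last_map h_tgt.
- exact: (wprod_map ((sval p).1 :: (sval p).2) h_wgt).
Qed.

End Isomorphism.

Section GraphTheory.
Variables (R : realType).

(** The proof fields are irrelevant, so graphs with the same type of edges can be equal outright.
    Laws of renaming such as [prelabel_comp] thus hold as equalities and not merely up to [=p]. *)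
Lemma eq_Graph (V : choiceType) (X Y : {fset V}) (E : countType) (s s' t t' : E -> V)
    (w w' : E -> R) p1 p2 p3 q1 q2 q3 :
  X = Y -> s =1 s' -> t =1 t' -> w =1 w' ->
  @Graph R V X E s t w p1 p2 p3 = @Graph R V Y E s' t' w' q1 q2 q3.
Proof.
move=> XY /funext ss /funext tt /funext ww; subst.
by congr Graph; exact: Prop_irrelevance.
Qed.

Variable V : choiceType.
Implicit Types F G H : graph R V.

Lemma graph_eq_refl G : graph_eq G G.
Proof. by split=> //; exists id => //; exists id. Qed.

Lemma graph_eq_sym F G : graph_eq F G -> graph_eq G F.
Proof.
move=> [vFG [h [g hg gh] he]]; split=> //; exists g; first by exists h.
by move=> e; have [] := he (g e); rewrite gh => -> -> ->.
Qed.

Lemma graph_eq_trans F G H : graph_eq F G -> graph_eq G H -> graph_eq F H.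
Proof.
move=> [vFG [h hb he]] [vGH [g gb ge]]; split; first by rewrite vFG.
exists (g \o h); first exact: bij_comp.
by move=> e /=; have [-> -> ->] := ge (h e); have [-> -> ->] := he e.
Qed.

Lemma rvertC F G : rvert F G = rvert G F.
Proof. exact: fsetUC. Qed.

(** Injectivity is asked on the vertices at hand: the renamings of levels used later, such as [nu],
    are injective only on the levels that occur. *)
Lemma rvert_imfset (W : choiceType) (theta : V -> W) F G :
  {in (vert F `|` vert G)%fset &, injective theta} ->
  forall x, x \in (vert F `|` vert G)%fset ->
  (theta x \in rvert (relabel theta F) (relabel theta G)) = (x \in rvert F G).
Proof.
move=> ti x xFG.
have tm (X : {fset V}) : (X `<=` (vert F `|` vert G))%fset ->
    (theta x \in (theta @` X)%fset) = (x \in X).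
  move=> /fsubsetP XFG; apply/imfsetP/idP => [[y /= yX /ti e]|xX]; last by exists x.
  by rewrite e// XFG.
by rewrite !inE/= !tm ?fsubsetUl ?fsubsetUr.
Qed.

Lemma measurementC F G : measurement F G = measurement G F.
Proof.
apply: (@measurement_iso _ _ _ _ _ _ _
  (fun e => match e with inl x => inr x | inr x => inl x end)).
- by move=> [x|x] [y|y] // [->].
- by move=> [x|x]; [exists (inr x)|exists (inl x)].
- by move=> [x|x] [y|y].
- by move=> [].
Qed.

Lemma relabel_id G : graph_eq (relabel id G) G.
Proof. by split; [rewrite /= imfset_id|exists id => //; exists id]. Qed.

Lemma imfset_idE (X : {fset V}) : X = [fset x | x in X]%fset.
Proof. by rewrite imfset_id. Qed.

Lemma reductionC F G : graph_eq (reduction F G) (reduction G F).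
Proof.
apply: graph_eq_trans (graph_eq_sym (relabel_id _)) _.
apply: (@reduction_iso _ _ _ _ _ _ _
  (fun e => match e with inl x => inr x | inr x => inl x end)).
- by move=> [x|x] [y|y] // [->].
- by move=> [x|x]; [exists (inr x)|exists (inl x)].
- by move=> [x|x] [y|y].
- by move=> [].
- by move=> [].
- by move=> [].
- by move=> x _; rewrite rvertC.
- by rewrite rvertC; exact: imfset_idE.
Qed.

Lemma imfset_rvert (W : choiceType) (theta : V -> W) F G :
  {in (vert F `|` vert G)%fset &, injective theta} ->
  rvert (relabel theta F) (relabel theta G) = (theta @` rvert F G)%fset.
Proof.
move=> ti; have := rvert_imfset ti; set X := (_ `|` _)%fset => rt.
have sX x : x \in rvert F G -> x \in X.
  by rewrite !inE => /orP[/andP[_ ->]|/andP[_ ->]]; rewrite ?orbT.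
apply/fsetP => y; apply/idP/imfsetP => [yr|[x /= xr ->]]; last first.
  by rewrite rt// sX.
have [x xX yx] : exists2 x, x \in X & y = theta x.
  move: yr; rewrite inE => /orP[]; rewrite inE => /andP[_ /imfsetP[x /= xX ->]].
    by exists x => //; rewrite inE xX.
  by exists x => //; rewrite inE xX orbT.
by exists x => //=; rewrite -rt// -yx.
Qed.

Section Congruence.
Variables (W : choiceType) (theta : V -> W) (F G : graph R V) (F' G' : graph R W).
Hypothesis ti : {in (vert F `|` vert G)%fset &, injective theta}.
Hypothesis FF' : graph_eq (relabel theta F) F'.
Hypothesis GG' : graph_eq (relabel theta G) G'.

Lemma measurement_reduction_congr :
  measurement F' G' = measurement F G /\
  graph_eq (relabel theta (reduction F G)) (reduction F' G').
Proof.
have [vF [h hb he]] := FF'; have [vG [k kb ke]] := GG'.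
pose hk (e : edge F + edge G) : edge F' + edge G' :=
  match e with inl x => inl (h x) | inr x => inr (k x) end.
have hk_inj : injective hk.
  by move=> [x|x] [y|y] // [] => [/(bij_inj hb)|/(bij_inj kb)] ->.
have hk_surj y : exists x, y = hk x.
  case: hb => h' _ h'K; case: kb => k' _ k'K.
  by case: y => x; [exists (inl (h' x)); rewrite /= h'K|exists (inr (k' x)); rewrite /= k'K].
have hs x : @usrc _ _ F' G' (hk x) = theta (@usrc _ _ F G x).
  by case: x => x /=; [have [-> _ _] := he x|have [-> _ _] := ke x].
have ht x : @utgt _ _ F' G' (hk x) = theta (@utgt _ _ F G x).
  by case: x => x /=; [have [_ -> _] := he x|have [_ -> _] := ke x].
have hw x : @uwgt _ _ F' G' (hk x) = @uwgt _ _ F G x.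
  by case: x => x /=; [have [_ _ ->] := he x|have [_ _ ->] := ke x].
have hc x : @colour _ _ F' G' (hk x) = @colour _ _ F G x by case: x.
have ha x y : @altconsec _ _ F' G' (hk x) (hk y) = @altconsec _ _ F G x y.
  rewrite /altconsec /= hs ht !hc; congr (_ && _).
  apply/eqP/eqP => [/ti -> //|->//]; [exact: usrc_vert|exact: utgt_vert].
have rv : rvert F' G' = rvert (relabel theta F) (relabel theta G).
  by rewrite /rvert -vF -vG.
split; first exact: measurement_iso hk_inj hk_surj ha hw.
apply: reduction_iso hk_inj hk_surj ha hw _ hs ht _ _; last first.
  by rewrite rv imfset_rvert.
by move=> x xX; rewrite rv rvert_imfset.
Qed.

Lemma graph_eq_gunion : graph_eq (relabel theta (gunion F G)) (gunion F' G').
Proof.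
have [vF [h [h' hK h'K] he]] := FF'; have [vG [k [k' kK k'K] ke]] := GG'.
split; first by rewrite /= -vF -vG imfsetU.
exists (fun e : edge F + edge G =>
    match e with inl x => inl (h x) | inr x => inr (k x) end).
  exists (fun e : edge F' + edge G' =>
    match e with inl x => inl (h' x) | inr x => inr (k' x) end).
    by case=> x; rewrite ?hK ?kK.
  by case=> x; rewrite ?h'K ?k'K.
by case=> x /=; [have [] := he x|have [] := ke x].
Qed.

End Congruence.

End GraphTheory.

(** * Projects up to renaming of edges *)

Notation "a =p b" := (project_eq a b) (at level 70).

Section ProjectTheory.
Variables (R : realType).

Lemma wager_inj (x y : {nonneg R}) : x%:num = y%:num -> x = y.
Proof. exact: val_inj. Qed.

Section OneType.
Variable V : choiceType.
Implicit Types a b c f g : project R V.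

Lemma project_eqP a b :
  a =p b <-> wager a = wager b /\ graph_eq (pgraph a) (pgraph b).
Proof. by split=> [[w v h]|[w [v h]]]; split. Qed.

Lemma peq_refl a : a =p a.
Proof. by apply/project_eqP; split=> //; exact: graph_eq_refl. Qed.

Lemma peq_sym a b : a =p b -> b =p a.
Proof.
by move=> /project_eqP[w g]; apply/project_eqP; split=> //; exact: graph_eq_sym.
Qed.

Lemma peq_trans a b c : a =p b -> b =p c -> a =p c.
Proof.
move=> /project_eqP[w g] /project_eqP[w' g']; apply/project_eqP.
by split; [rewrite w|exact: graph_eq_trans g g'].
Qed.

Lemma peq_carrier a b : a =p b -> carrier a = carrier b.
Proof. by case. Qed.

Lemma prelabel_id a : prelabel id a = a.
Proof.
case: a => w [v e s t wg p1 p2 p3]; congr Project.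
by apply: eq_Graph => //; exact: imfset_id.
Qed.

Lemma ptensorC a b : ptensor a b =p ptensor b a.
Proof.
split; [by apply: wager_inj; rewrite /= addrC|exact: fsetUC|].
exists (fun e : edge (pgraph a) + edge (pgraph b) =>
  match e with inl x => inr x | inr x => inl x end); last by case.
by exists (fun e => match e with inl x => inr x | inr x => inl x end); case.
Qed.

Lemma ptensorA a b c : ptensor (ptensor a b) c =p ptensor a (ptensor b c).
Proof.
split; [by apply: wager_inj; rewrite /= addrA|by rewrite /carrier/= fsetUA|].
exists (fun e : (edge (pgraph a) + edge (pgraph b)) + edge (pgraph c) =>
  match e with inl (inl x) => inl x | inl (inr x) => inr (inl x)
             | inr x => inr (inr x) end); last by case=> [[]|].
by exists (fun e => match e with inl x => inl (inl x) | inr (inl x) => inl (inr x)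
             | inr (inr x) => inr x end); [case=> [[]|]|case=> [|[]]].
Qed.

Lemma ptensor_unitl a b : wager a = 0%:nng -> carrier a = fset0 ->
  ptensor a b =p b.
Proof.
move=> wa ca; have na (e : edge (pgraph a)) : False.
  by have := src_vert _ e; rewrite -/(carrier a) ca.
split; [by apply: wager_inj; rewrite /= wa /= add0r| |].
  by rewrite {1}/carrier /= -!/(carrier _) ca fset0U.
exists (fun e : edge (pgraph a) + edge (pgraph b) =>
  match e with inl x => False_rect _ (na x) | inr x => x end); last by case.
by exists (fun e => inr e) => // -[x|//]; case: (na x).
Qed.

Lemma pairingC a b : pairing a b = pairing b a.
Proof. by rewrite /pairing measurementC [X in (X + _)%E = _]addeC. Qed.

Lemma cut_definedC f g : cut_defined f g <-> cut_defined g f.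
Proof. by rewrite /cut_defined pairingC. Qed.

Lemma carrier_cut f g : carrier (cut f g) =
  ((carrier f `\` carrier g) `|` (carrier g `\` carrier f))%fset.
Proof. by []. Qed.

Lemma cutC f g : cut f g =p cut g f.
Proof.
apply/project_eqP; split; first by apply: wager_inj; rewrite /= pairingC.
exact: reductionC.
Qed.

Definition disj (X Y : {fset V}) := [disjoint X & Y]%fset.

Lemma pairing_adj f a g : disj (carrier a) (carrier g) ->
  cut_defined f a -> pairing f (ptensor a g) = pairing (cut f a) g.
Proof.
move=> ag; rewrite /cut_defined => fa.
(* The wager of the cut is [fine] of the pairing, which is why this pairing must be finite. *)
rewrite /pairing /= fineK; last by rewrite ge0_fin_numE ?pairing_ge0// ltey; apply/eqP.
rewrite measurement_adj// /pairing EFinD !addeA; congr (_ + _)%E.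
by rewrite -!addeA; congr (_ + (_ + _))%E; rewrite addeC.
Qed.

(** Wagers are finite, so an undefined cut comes from an infinite measurement, and adding a
    nonnegative term keeps it infinite. *)
Lemma pairing_adj_undef f a g : disj (carrier a) (carrier g) ->
  ~ cut_defined f a -> pairing f (ptensor a g) = +oo%E.
Proof.
move=> ag /contrapT fa; have mf : measurement (pgraph f) (pgraph a) = +oo%E.
  move: fa; rewrite /pairing; case: (measurement _ _) => //.
rewrite /pairing /= measurement_adj// mf addye ?addey//.
  by rewrite -ltNye (lt_le_trans _ (measurement_ge0 _ _))// ltNye.
Qed.

Lemma cut_adj f a g : disj (carrier a) (carrier g) -> cut_defined f a ->
  cut (cut f a) g =p cut f (ptensor a g).
Proof.
move=> ag fa; apply/project_eqP; split; last exact: reduction_adj.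
by apply: wager_inj; rewrite /= pairing_adj.
Qed.

End OneType.

Section Relabel.
Variables (V W : choiceType).
Implicit Types (theta eta : V -> W) (a b f g : project R V).

Lemma carrier_prelabel theta a : carrier (prelabel theta a) = (theta @` carrier a)%fset.
Proof. by []. Qed.

Lemma eq_prelabel theta eta a : {in carrier a, theta =1 eta} ->
  prelabel theta a = prelabel eta a.
Proof.
move=> e; congr Project; apply: eq_Graph => // [|x|x] /=.
- exact: eq_in_imfset.
- exact/e/src_vert.
- exact/e/tgt_vert.
Qed.

Lemma prelabel_peq theta a b : a =p b -> prelabel theta a =p prelabel theta b.
Proof.
move=> [w v [h hb he]]; split=> //; first by rewrite !carrier_prelabel v.
by exists h => // e; have [/= -> -> ->] := he e.
Qed.

Lemma prelabel_ptensor theta a b :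
  prelabel theta (ptensor a b) = ptensor (prelabel theta a) (prelabel theta b).
Proof. by congr Project; apply: eq_Graph => [|[]|[]|[]] //=; rewrite imfsetU. Qed.

Section Two.
Variables (theta : V -> W) (f g : project R V) (f' g' : project R W).
Hypothesis ti : {in (carrier f `|` carrier g)%fset &, injective theta}.
Hypothesis ff : prelabel theta f =p f'.
Hypothesis gg : prelabel theta g =p g'.

Lemma pairing_congr : pairing f' g' = pairing f g.
Proof.
have /project_eqP[wf hf] := ff; have /project_eqP[wg hg] := gg.
by rewrite /pairing -wf -wg (measurement_reduction_congr ti hf hg).1.
Qed.

Lemma cut_congr : prelabel theta (cut f g) =p cut f' g'.
Proof.
have /project_eqP[wf hf] := ff; have /project_eqP[wg hg] := gg.
apply/project_eqP; split; first by apply: wager_inj; rewrite /= pairing_congr.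
exact: (measurement_reduction_congr ti hf hg).2.
Qed.

End Two.

Lemma pairing_prelabel theta f g :
  {in (carrier f `|` carrier g)%fset &, injective theta} ->
  pairing (prelabel theta f) (prelabel theta g) = pairing f g.
Proof. by move=> ti; apply: pairing_congr ti _ _; exact: peq_refl. Qed.

Lemma cut_prelabel theta f g :
  {in (carrier f `|` carrier g)%fset &, injective theta} ->
  prelabel theta (cut f g) =p cut (prelabel theta f) (prelabel theta g).
Proof. by move=> ti; apply: cut_congr ti _ _; exact: peq_refl. Qed.

End Relabel.

Lemma prelabel_comp (U V W : choiceType) (theta : V -> W) (eta : U -> V) (a : project R U) :
  prelabel theta (prelabel eta a) = prelabel (theta \o eta) a.
Proof.
by congr Project; apply: eq_Graph => //; rewrite /= -imfset_comp.
Qed.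

Section Congruence.
Variable V : choiceType.
Implicit Types a b c f g h : project R V.

Lemma pairing_peq f f' g g' : f =p f' -> g =p g' -> pairing f g = pairing f' g'.
Proof.
by move=> ff gg; rewrite (@pairing_congr _ _ id f g f' g') ?prelabel_id//; exact: in2W.
Qed.

Lemma cut_peq f f' g g' : f =p f' -> g =p g' -> cut f g =p cut f' g'.
Proof.
move=> ff gg; rewrite -[cut f g]prelabel_id.
by apply: cut_congr; rewrite ?prelabel_id//; exact: in2W.
Qed.

Lemma ptensor_peq f f' g g' : f =p f' -> g =p g' -> ptensor f g =p ptensor f' g'.
Proof.
move=> /project_eqP[wf hf] /project_eqP[wg hg]; apply/project_eqP.
split; first by apply: wager_inj; rewrite /= wf wg.
apply: graph_eq_trans (graph_eq_sym (relabel_id _)) _.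
by apply: graph_eq_gunion; apply: graph_eq_trans (relabel_id _) _.
Qed.

Lemma cut_defined_peq f f' g g' : f =p f' -> g =p g' ->
  cut_defined f g -> cut_defined f' g'.
Proof. by move=> ff gg; rewrite /cut_defined (pairing_peq ff gg). Qed.

Lemma disjC (X Y : {fset V}) : disj X Y -> disj Y X.
Proof. by rewrite /disj fdisjoint_sym. Qed.

(** Symmetry and adjunction alternate: (f::g)::h = (g::f)::h = g::(ptensor f h) = g::(ptensor h f) =
    (g::h)::f = f::(g::h). *)
Lemma cutA f g h : disj (carrier f) (carrier h) -> cut_defined f g -> cut_defined g h ->
  cut (cut f g) h =p cut f (cut g h).
Proof.
move=> fh fg gh.
apply: peq_trans (cut_peq (cutC f g) (peq_refl h)) _.
apply: peq_trans (cut_adj fh _) _; first by rewrite cut_definedC.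
apply: peq_trans (cut_peq (peq_refl g) (ptensorC f h)) _.
apply: peq_trans (peq_sym (cut_adj (disjC fh) gh)) _.
exact: cutC.
Qed.

End Congruence.

End ProjectTheory.

(** * Faxes *)

Section FaxCut.
Variables (R : realType) (V : choiceType) (X : {fset V}) (theta : V -> V).
Variable f : project R V.
Hypothesis Xf : {subset X <= carrier f}.
Hypothesis thetaXf : forall x, x \in X -> theta x \notin carrier f.

Let T : graph R V := pgraph (fax X theta).
Let E := edge (gunion T (pgraph f)).
Let alt : rel E := @altconsec _ _ T (pgraph f).
Let rho v := if v \in X then theta v else v.

(** The edge [(x, false)] ends outside the carrier of [f], and two Fax edges share a colour, so it
    can only come last; dually [(x, true)] can only come first. An alternating path thus contains at
    most one edge of [f]. *)
Let after_fax (x : X) (e : E) : ~~ alt (inl (x, false)) e.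
Proof.
case: e => [[y b]|e]; rewrite /alt /altconsec /= ?andbF// andbT /fax_tgt /=.
by apply: contra (thetaXf (valP x)) => /eqP <-; exact: src_vert.
Qed.

Let before_fax (x : X) (e : E) : ~~ alt e (inl (x, true)).
Proof.
case: e => [[y b]|e]; rewrite /alt /altconsec /= ?andbF// andbT /fax_src /=.
by apply: contra (thetaXf (valP x)) => /eqP ->; exact: tgt_vert.
Qed.

(** In a cycle every edge has a predecessor and a successor, so no Fax edge occurs; edges of [f]
    alone do not alternate. *)
Lemma measurement_fax : measurement T (pgraph f) = 0%E.
Proof.
rewrite measurementE /circ_sum; have -> : cyc alt = set0.
  apply/seteqP; split=> // s [cs /primitive_neq_nil s0].
  have nofax z : inl z \in s -> False.
    case: z => x [] zs.
      by have := prev_cycle cs zs; rewrite (negPf (before_fax _ _)).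
    by have := next_cycle cs zs; rewrite (negPf (after_fax _ _)).
  case: s s0 cs nofax => // e s _ cs nofax.
  have es : e \in e :: s by rewrite mem_head.
  have := next_cycle cs es; have := nofax; have : next (e :: s) e \in e :: s by rewrite mem_next.
  case: (next _ _) => [z zs /(_ _ zs)//|g _ _].
  case: e {cs} es nofax => [z zs /(_ _ zs)//|g' _ _].
  by rewrite /alt /altconsec /= andbF.
by rewrite image_set0 esum_set0.
Qed.

Lemma pairing_fax : pairing (fax X theta) f = (wager f)%:num%:E.
Proof. by rewrite /pairing measurement_fax /= add0e adde0. Qed.

Lemma cut_defined_fax : cut_defined (fax X theta) f.
Proof. by rewrite /cut_defined pairing_fax. Qed.

Let rv v : v \in rvert T (pgraph f) =
  ((v \in (theta @` X)%fset) && (v \notin carrier f)) || ((v \in carrier f) && (v \notin X)).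
Proof.
rewrite !inE -!/(carrier f).
case: (boolP (v \in X)) => [/Xf ->|vX]; rewrite /= ?andbF ?andbT//=.
case: (boolP (v \in (theta @` X)%fset)) => [|_] /=; last by rewrite andbF.
by move=> /imfsetP[x /= /thetaXf xf ->]; rewrite (negPf xf).
Qed.

Let rv_theta (x : X) : theta (val x) \in rvert T (pgraph f).
Proof. by rewrite rv thetaXf ?(valP x)// andbT in_imfset//= (valP x). Qed.

Let rv_f v : v \in carrier f -> (v \in rvert T (pgraph f)) = (v \notin X).
Proof. by move=> vf; rewrite rv vf /= andbF. Qed.

Let post (e : edge (pgraph f)) : seq E :=
  match insub (tgt e) with Some x => [:: inl (x, false)] | None => [::] end.

(* The alternating paths of the reduction are the edges of f, preceded and
   followed by an edge of the Fax at the endpoints that lie in X. *)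
Let thru (e : edge (pgraph f)) : E * seq E :=
  match insub (src e) with
  | Some x => (inl (x, true), inr e :: post e)
  | None => (inr e, post e)
  end.

Let path_post e : path alt (inr e) (post e).
Proof.
rewrite /post; case: insubP => //= x _ xe.
by rewrite /alt /altconsec /= andbT andbT /fax_src /= xe.
Qed.

Let tgt_post e : tgt (last (inr e : E) (post e)) = rho (tgt e).
Proof.
by rewrite /post /rho; case: insubP => [x -> xe|/negPf -> //=] /=; rewrite /fax_tgt /= xe.
Qed.

Let rho_rv v : v \in carrier f -> rho v \in rvert T (pgraph f).
Proof.
move=> vf; rewrite /rho; case: (boolP (v \in X)) => vX; last by rewrite rv_f.
by rewrite rv thetaXf// andbT in_imfset.
Qed.

Let thru_pred e : @redge_pred _ _ T (pgraph f) (thru e).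
Proof.
have te := rho_rv (tgt_vert _ e); have se := rho_rv (src_vert _ e).
rewrite /thru; case: insubP => [x xX xe|xX]; apply/and3P; split.
- rewrite /alt_path /= path_post andbT /altconsec /= andbT /fax_tgt /= xe.
  exact: eqxx.
- exact: rv_theta.
- by rewrite -tgt_post in te; exact: te.
- exact: path_post.
- by move: se; rewrite /rho (negPf xX).
- by rewrite -tgt_post in te; exact: te.
Qed.

(** A target in [X] belongs to both carriers, so the path cannot stop there: it leaves by the Fax
    and then ends. At a target outside [X] no Fax edge can follow. *)
Let path_inr e s : path alt (inr e) s -> tgt (last (inr e : E) s) \in rvert T (pgraph f) ->
  s = post e.
Proof.
case: s => [_|[[x b]|g] s] /=; last by rewrite /alt /altconsec /= andbF.
  rewrite rv_f ?tgt_vert// /post; by case: insubP => // x ->.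
case: b => [/andP[]|]; first by rewrite (negPf (before_fax _ _)).
move=> /andP[]; rewrite /alt /altconsec /= andbT /fax_src /= => /eqP xe.
case: s => [_ _|g s /andP[]]; last by move=> ax; have /negP[] := after_fax x g.
by rewrite /post -xe valK.
Qed.

Lemma cut_fax : cut (fax X theta) f =p prelabel (fun v => if v \in X then theta v else v) f.
Proof.
apply: peq_sym; apply/project_eqP; split.
  by apply: wager_inj; rewrite /= pairing_fax.
split.
  apply/fsetP => v; rewrite /= -[v \in rvert _ _]/(v \in rvert T (pgraph f)) rv.
  apply/imfsetP/orP => [[x /= xf ->]|].
    by have := rho_rv xf; rewrite rv => /orP.
  move=> [/andP[/imfsetP[x /= xX ->] _]|/andP[vf /negPf vX]].
    by exists x; [exact: Xf|rewrite xX].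
  by exists v => //; rewrite vX.
exists (fun e => @exist _ (fun p => is_true (@redge_pred _ _ T (pgraph f) p)) _ (thru_pred e)).
  apply: inj_surj_bij => [e e' /(congr1 val)|[[e s] es]].
    by rewrite /= /thru; case: insubP => [x _ _|_]; case: insubP => [y _ _|_] // [].
  suff [e' ee'] : exists e', thru e' = (e, s) by exists e'; exact: val_inj.
  have /and3P[p sr t] := es; rewrite /path_tgt /= in t.
  case: e {es} p sr t => [[x b]|e] p sr t; last first.
    exists e; rewrite /thru; case: insubP => [x xX _|_].
      by move: sr; rewrite /path_src /= rv_f ?xX// src_vert.
    by have <- : s = post e := path_inr p t.
  case: s p sr t => [|[[y c]|e] s] p sr t.
  (* A Fax edge by itself has one end in [X], which both carriers contain, so it is no edge of the
     reduction. *)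
  - move: sr t; rewrite /path_src /= /fax_src /fax_tgt /=.
    by case: b {p} => sr t; [move: t|move: sr]; rewrite rv_f ?(valP x)// Xf ?(valP x).
  - by move: p; rewrite /alt_path /= /altconsec /= andbF.
  - move: p; rewrite /alt_path /= => /andP[]; case: b sr t => sr t; last first.
      by rewrite -/(alt _ _) (negPf (after_fax _ _)).
    rewrite /altconsec /= andbT /fax_tgt /= => /eqP ex p.
    by exists e; rewrite /thru ex valK; have <- : s = post e := path_inr p t.
move=> e; split=> /=.
- rewrite /rsrc /path_src /= /thru; case: insubP => [x -> xe|/negPf -> //] /=.
  by rewrite /fax_src /= xe.
- rewrite /rtgt /path_tgt /= /thru; case: insubP => [x _ xe|_] /=; exact: tgt_post.
- rewrite /rwgt /weight /= /thru /post; case: insubP => [x _ _|_]; case: insubP => [y _ _|_].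
  all: by rewrite /= ?big_cons ?big_nil /= ?mul1r ?mulr1.
Qed.

End FaxCut.

Section FaxTheory.
Variables (R : realType).

Lemma prelabel_fax (V W : choiceType) (lambda : V -> W) (X : {fset V}) theta eta :
  {in X &, injective lambda} ->
  {in X, forall x, eta (lambda x) = lambda (theta x)} ->
  prelabel lambda (fax X theta : project R V) =p fax (lambda @` X)%fset eta.
Proof.
move=> li le; split=> //.
  rewrite /carrier /= imfsetU; congr (_ `|` _)%fset.
  rewrite -!imfset_comp; apply: eq_in_imfset => // x xX /=; exact/esym/le.
have lX (x : X) : lambda (val x) \in (lambda @` X)%fset by rewrite in_imfset//= (valP x).
exists (fun e : X * bool => ([` lX e.1]%fset, e.2)).
  apply: inj_surj_bij => [[x b] [y c] /= [xy ->]|[[y yX] b]].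
    by congr (_, _); apply/val_inj/li => //; exact: valP.
  have /imfsetP[x /= xX e] := yX; exists ([` xX]%fset, b); congr (_, _).
  exact: val_inj.
by move=> [x []]; split=> //=; rewrite /fax_src /fax_tgt /= le ?(valP x).
Qed.

(** The Fax of the inverse has the same edges with the roles of the two directions exchanged, whence
    the negated boolean. *)
Lemma fax_sym (V : choiceType) (X : {fset V}) (theta eta : V -> V) :
  {in X, cancel theta eta} -> fax X theta =p (fax (theta @` X)%fset eta : project R V).
Proof.
move=> te; split=> //.
  rewrite /carrier /= fsetUC; congr (_ `|` _)%fset; rewrite -imfset_comp.
  by rewrite -[LHS]imfset_id; apply: eq_in_imfset => // x xX /=; rewrite te.
have lX (x : X) : theta (val x) \in (theta @` X)%fset by rewrite in_imfset//= (valP x).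
exists (fun e : X * bool => ([` lX e.1]%fset, ~~ e.2)).
  apply: inj_surj_bij => [[x b] [y c] /= [xy /negb_inj ->]|[[y yX] b]].
    by congr (_, _); apply: val_inj; rewrite /= -(te (val x)) ?xy ?te ?(valP x) ?(valP y).
  have /imfsetP[x /= xX e] := yX; exists ([` xX]%fset, ~~ b); rewrite /= negbK; congr (_, _).
  exact: val_inj.
by move=> [x []]; split=> //=; rewrite /fax_src /fax_tgt /= te ?(valP x).
Qed.

Lemma eq_fax (V : choiceType) (X : {fset V}) (theta eta : V -> V) :
  {in X, theta =1 eta} -> fax X theta =p (fax X eta : project R V).
Proof.
move=> te; rewrite -[fax X theta]prelabel_id.
have {2}-> : X = (id @` X)%fset by rewrite imfset_id.
by apply: prelabel_fax => // x xX; rewrite /= te.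
Qed.

Lemma fax_union (V : choiceType) (X Y : {fset V}) (theta eta zeta : V -> V) :
  disj X Y -> {in X, zeta =1 theta} -> {in Y, zeta =1 eta} ->
  ptensor (fax X theta) (fax Y eta) =p (fax (X `|` Y)%fset zeta : project R V).
Proof.
move=> XY zt ze.
apply: peq_trans (ptensor_peq (eq_fax _) (eq_fax _)) _.
- by move=> x /zt e; exact/esym/e.
- by move=> x /ze e; exact/esym/e.
split; first by apply: wager_inj; rewrite /= addr0.
  by rewrite /carrier /= imfsetU fsetUACA.
have lX (x : X) : val x \in (X `|` Y)%fset by rewrite inE (valP x).
have lY (y : Y) : val y \in (X `|` Y)%fset by rewrite inE (valP y) orbT.
exists (fun e : X * bool + Y * bool => match e with
  | inl (x, b) => ([` lX x]%fset, b) | inr (y, b) => ([` lY y]%fset, b) end).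
  apply: inj_surj_bij => [[[x b]|[x b]] [[y c]|[y c]] [xy ->]|[[v vX] b]].
  - by congr (inl (_, _)); exact: val_inj.
  - by have /fdisjointP/(_ _ (valP x)) := XY; rewrite [val x]xy (valP y).
  - by have /fdisjointP/(_ _ (valP y)) := XY; rewrite -[val y]xy (valP x).
  - by congr (inr (_, _)); exact: val_inj.
  have := vX; rewrite inE => /orP[] h.
    by exists (inl ([` h]%fset, b)); congr (_, _); exact: val_inj.
  by exists (inr ([` h]%fset, b)); congr (_, _); exact: val_inj.
by move=> [[x []]|[x []]].
Qed.

End FaxTheory.

(** * Conducts *)

Section ConductTheory.
Variable R : realType.

Section OneType.
Variable V : choiceType.
Implicit Types (S T U : pset R V) (a b f : project R V).

Definition carried S := forall a, S a -> carrier a = pcar S.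
Definition inhabited_pset S := exists a, S a.

Lemma pset_ext S T : pcar S = pcar T -> (forall a, S a <-> T a) -> S = T.
Proof.
case: S T => [X P] [Y Q] /= -> PQ; congr PSet.
by apply/funext => a; apply/propext.
Qed.

Lemma orthogonalC a b : orthogonal a b -> orthogonal b a.
Proof. by case=> c n i; split; rewrite // pairingC. Qed.

Lemma orthogonal_peq a a' b b' : a =p a' -> b =p b' ->
  orthogonal a b -> orthogonal a' b'.
Proof.
move=> aa bb [c n i]; rewrite /orthogonal -(pairing_peq aa bb); split=> //.
by rewrite -(peq_carrier aa) -(peq_carrier bb).
Qed.

Lemma perp_carried S : carried (perp S).
Proof. by move=> a []. Qed.

Lemma perp_peq S a b : a =p b -> perp S a -> perp S b.
Proof.
move=> ab [ca pa]; split; first by rewrite -(peq_carrier ab).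
by move=> c /pa; apply: orthogonal_peq => //; exact: peq_refl.
Qed.

Lemma perp_anti S T : pcar S = pcar T ->
  (forall a, S a -> exists2 b, T b & a =p b) -> forall a, perp T a -> perp S a.
Proof.
move=> e ST a [ca pa]; split; first by rewrite e.
move=> b /ST[b' /pa ab' bb']; apply: orthogonal_peq ab'; [exact: peq_refl|exact: peq_sym].
Qed.

(** Orthogonality ignores the names of edges. This turns laws of projects that hold up to [=p] into
    equalities of conducts. *)
Lemma perp_eq S T : pcar S = pcar T ->
  (forall a, S a -> exists2 b, T b & a =p b) ->
  (forall a, T a -> exists2 b, S b & a =p b) -> perp S = perp T.
Proof. by move=> e ST TS; apply: pset_ext => // a; split; apply: perp_anti. Qed.

Lemma sub_biperp S : carried S -> forall a, S a -> perp (perp S) a.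
Proof.
move=> cS a Sa; split; first exact: cS.
by move=> b [_ /(_ _ Sa)]; exact: orthogonalC.
Qed.

Lemma perp3 S : carried S -> perp (perp (perp S)) = perp S.
Proof.
move=> cS; apply: pset_ext => // a; split; last exact/sub_biperp/perp_carried.
apply: perp_anti => // b Sb; exists b; [exact: sub_biperp|exact: peq_refl].
Qed.

Let discrete_graph (X : {fset V}) : graph R V :=
  @Graph R V X void (of_void V) (of_void V) (of_void R)
    (fun e => match e with end) (fun e => match e with end)
    (fun e => match e with end).

Lemma measurement_discrete (X : {fset V}) G : measurement G (discrete_graph X) = 0%E.
Proof.
rewrite measurementE /circ_sum; set c := cyc _; have -> : c = set0.
  apply/seteqP; split=> // s [+ /primitive_neq_nil]; case: s => // e s cs _.
  have := next_cycle cs (mem_head e s).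
  by case: e {cs} => // e; case: (next _ _) => // g; rewrite /altconsec /= andbF.
by rewrite image_set0 esum_set0.
Qed.

(* An edgeless project with nonzero wager is orthogonal to every project, so
   that orthogonals are never empty. *)
Lemma perp_inhabited S : carried S -> inhabited_pset (perp S).
Proof.
move=> cS; exists (Project 1%:nng (discrete_graph (pcar S))); split=> // b Sb.
apply: orthogonalC; split; first by rewrite /carrier /= -/(carrier b) cS.
  rewrite /pairing measurement_discrete /= adde0 -EFinD => -[].
  by apply/eqP; rewrite gt_eqF// ltr_wpDl.
by rewrite /pairing measurement_discrete.
Qed.

Lemma is_conduct_perp S : carried S -> is_conduct (perp S).
Proof.
move=> cS; split; [exact: perp_carried|exact: perp_inhabited|by rewrite perp3].
Qed.

Lemma conduct_carried S : is_conduct S -> carried S. Proof. by case. Qed.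
Lemma conduct_inhabited S : is_conduct S -> inhabited_pset S. Proof. by case. Qed.
Lemma conduct_biperp S : is_conduct S -> perp (perp S) = S. Proof. by case. Qed.
Lemma conduct_peq S a b : is_conduct S -> a =p b -> S a -> S b.
Proof. by move=> cS; rewrite -(conduct_biperp cS); exact: perp_peq. Qed.

Definition ptens S T : pset R V :=
  PSet (pcar S `|` pcar T)%fset
    (fun c => exists a b, [/\ S a, T b & c = ptensor a b]).

Lemma ptens_carried S T : carried S -> carried T -> carried (ptens S T).
Proof.
by move=> cS cT c [a [b [Sa Tb ->]]]; rewrite /= -(cS a)// -(cT b).
Qed.

Lemma ptens_inhabited S T : inhabited_pset S -> inhabited_pset T ->
  inhabited_pset (ptens S T).
Proof. by move=> [a Sa] [b Tb]; exists (ptensor a b), a, b. Qed.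

Lemma perp_ptensC S T : perp (ptens S T) = perp (ptens T S).
Proof.
apply: perp_eq => [|c [a [b [Sa Tb ->]]]|c [a [b [Sa Tb ->]]]].
- exact: fsetUC.
- by exists (ptensor b a); [exists b, a|exact: ptensorC].
- by exists (ptensor b a); [exists b, a|exact: ptensorC].
Qed.

Lemma perp_ptensA S T U :
  perp (ptens (ptens S T) U) = perp (ptens S (ptens T U)).
Proof.
apply: perp_eq => [|_ [_ [c [[a [b [Sa Tb ->]]] Uc ->]]]|_ [a [_ [Sa [b [c [Tb Uc ->]]] ->]]]].
- by rewrite /= fsetUA.
- exists (ptensor a (ptensor b c)); last exact: ptensorA.
  by exists a, (ptensor b c); split=> //; exists b, c.
- exists (ptensor (ptensor a b) c); last exact/peq_sym/ptensorA.
  by exists (ptensor a b), c; split=> //; exists a, b.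
Qed.

Lemma cut_defined_adj f a b : disj (carrier a) (carrier b) ->
  pairing f (ptensor a b) <> +oo%E -> cut_defined f a.
Proof. by move=> ab; apply: contra_notP => /(pairing_adj_undef ab). Qed.

Lemma carrier_cutE f (X Y : {fset V}) a : disj X Y ->
  carrier f = (X `|` Y)%fset -> carrier a = X -> carrier (cut f a) = Y.
Proof.
move=> /fdisjointP XY fXY aX; rewrite carrier_cut fXY aX; apply/fsetP => x.
by rewrite !inE; have := XY x; case: (x \in X) => [/(_ isT)/negPf ->|_]; case: (x \in Y).
Qed.

Lemma carrier_cut_inv f (X Y : {fset V}) a : disj X Y ->
  carrier (cut f a) = Y -> carrier a = X -> carrier f = (X `|` Y)%fset.
Proof.
move=> /fdisjointP XY fXY aX; apply/fsetP => x; have := XY x; rewrite -fXY carrier_cut aX !inE.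
by case: (x \in X); case: (x \in carrier f) => //= /(_ isT).
Qed.

(** If [f] is orthogonal to every tensor of s and t, then f::t is orthogonal to every s, so it lies
    in [perp S] and is orthogonal to the members of the biorthogonal. The element [s0] guarantees
    that f::t is defined. *)
Lemma perp_ptens_biperp S T : carried S -> inhabited_pset S -> carried T ->
  disj (pcar S) (pcar T) -> perp (ptens (perp (perp S)) T) = perp (ptens S T).
Proof.
move=> cS [s0 Ss0] cT ST; apply: pset_ext => // f; split.
  apply: perp_anti => // _ [a [b [Sa Tb ->]]].
  exists (ptensor a b); last exact: peq_refl.
  by exists a, b; split=> //; exact: sub_biperp.
move=> [cf pf]; split=> // _ [u [t [Su Tt ->]]].
have dis a : carrier a = pcar S -> disj (carrier t) (carrier a).
  by move=> ->; rewrite cT//; exact: disjC.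
have cS2 := perp_carried Su.
have pf' s : S s -> orthogonal f (ptensor t s).
  move=> Ss; apply: orthogonal_peq (peq_refl _) (ptensorC _ _) (pf _ _).
  by exists s, t.
have ft : cut_defined f t.
  by have [_ _] := pf' _ Ss0; apply: cut_defined_adj; apply/dis/cS.
have cft : carrier (cut f t) = pcar S.
  apply: (@carrier_cutE _ (pcar T)); [exact: disjC| |exact: cT].
  by rewrite cf /= fsetUC.
have [_ n i] : orthogonal u (cut f t).
  apply: Su.2; split=> // s Ss; have [_ n i] := pf' _ Ss.
  by split; rewrite ?cft ?(cS s)// -pairing_adj//; apply/dis/cS.
apply: orthogonal_peq (peq_refl _) (ptensorC _ _) _.
split; first by rewrite cf /= /carrier /= -!/(carrier _) cS2 cT// fsetUC.
  by rewrite pairing_adj// 1?pairingC//; exact/dis.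
by rewrite pairing_adj// 1?pairingC//; exact/dis.
Qed.

Lemma perp_ptens_biperpr S T : carried S -> inhabited_pset T -> carried T ->
  disj (pcar S) (pcar T) -> perp (ptens S (perp (perp T))) = perp (ptens S T).
Proof.
move=> cS T0 cT ST; rewrite perp_ptensC perp_ptens_biperp//; last exact: disjC.
exact: perp_ptensC.
Qed.

Lemma tensor_conduct S T : carried S -> carried T -> is_conduct (tensor S T).
Proof. by move=> cS cT; apply/is_conduct_perp/perp_carried. Qed.

Lemma ptensor_tensor S T a b : carried S -> carried T -> S a -> T b ->
  tensor S T (ptensor a b).
Proof.
move=> cS cT Sa Tb; apply: sub_biperp; first exact: ptens_carried.
by exists a, b.
Qed.

Lemma tensorC S T : tensor S T = tensor T S.
Proof. by congr perp; exact: perp_ptensC. Qed.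

(** Once the inner closures are removed, both sides are the biorthogonal of the triple tensors. *)
Lemma tensorA S T U : carried S -> carried T -> carried U ->
  inhabited_pset S -> inhabited_pset T -> inhabited_pset U ->
  disj (pcar S) (pcar T) -> disj (pcar S) (pcar U) -> disj (pcar T) (pcar U) ->
  tensor (tensor S T) U = tensor S (tensor T U).
Proof.
move=> cS cT cU S0 T0 U0 ST SU TU; congr perp.
rewrite -[LHS]/(perp (ptens (perp (perp (ptens S T))) U)).
rewrite -[RHS]/(perp (ptens S (perp (perp (ptens T U))))).
rewrite perp_ptens_biperp ?perp_ptens_biperpr ?perp_ptensA//.
- exact: ptens_inhabited.
- exact: ptens_carried.
- by rewrite /disj fdisjointXU; apply/andP.
- exact: ptens_carried.
- exact: ptens_inhabited.
- by rewrite /disj fdisjointUX; apply/andP.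
Qed.

Let one_pset : pset R V := PSet fset0 (fun a => a = Project 0%:nng gempty).

Let one_carried : carried one_pset. Proof. by move=> a ->. Qed.

Lemma unit_conduct : is_conduct (unit_pset : pset R V).
Proof. by apply/is_conduct_perp/perp_carried. Qed.

Lemma bot_conduct : is_conduct (bot_pset : pset R V).
Proof. by apply/is_conduct_perp/perp_carried. Qed.

Lemma perp_bot : perp (bot_pset : pset R V) = unit_pset.
Proof. exact/conduct_biperp/unit_conduct. Qed.

(** The unit is generated by the empty project, whose tensor with [b] is [b] up to [=p]. *)
Lemma perp_ptens_unit S : carried S -> perp (ptens unit_pset S) = perp S.
Proof.
move=> cS; rewrite perp_ptens_biperp//; last 2 first.
- by exists (Project 0%:nng gempty).
- by rewrite /disj fdisjoint0X.
apply: perp_eq => [|_ [a [b [-> Sb ->]]]|b Sb]; first by rewrite /= fset0U.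
  by exists b => //; exact: ptensor_unitl.
exists (ptensor (Project 0%:nng gempty) b); last exact/peq_sym/ptensor_unitl.
by exists (Project 0%:nng gempty), b.
Qed.

Lemma tensor_unitl S : is_conduct S -> tensor unit_pset S = S.
Proof.
move=> cS; rewrite -[RHS]conduct_biperp//; congr perp.
exact/perp_ptens_unit/conduct_carried.
Qed.

Lemma tensor_unitr S : is_conduct S -> tensor S unit_pset = S.
Proof. by rewrite tensorC; exact: tensor_unitl. Qed.

(** By adjunction [f] is orthogonal to the tensor of s and t exactly when f::s is orthogonal to t,
    and [T] is its own biorthogonal. *)
Lemma lolliE S T : carried S -> inhabited_pset S -> is_conduct T ->
  disj (pcar S) (pcar T) -> lolli S T = perp (ptens S (perp T)).
Proof.
move=> cS [s0 Ss0] cT ST; apply: pset_ext => // f; split=> [lf|[cf pf] s Ss].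
  (* [lolli] does not prescribe the carrier of [f]; it is recovered from f::s for a single s. *)
  have cf : carrier f = (pcar S `|` pcar T)%fset.
    have [_ Tf] := lf _ Ss0; apply: (@carrier_cut_inv _ _ _ s0) => //; last exact: cS.
    exact: conduct_carried Tf.
  split=> // _ [s [t [Ss [ct pt] ->]]]; have [fs Tfs] := lf _ Ss.
  have [_ n i] := pt _ Tfs; have st : disj (carrier s) (carrier t) by rewrite cS// ct.
  split; [by rewrite cf /carrier /= -!/(carrier _) cS// ct| |];
    by rewrite pairing_adj// pairingC.
have st t : perp T t -> disj (carrier s) (carrier t) by move=> [+ _]; rewrite (cS s)// => ->.
have pst t : perp T t -> orthogonal f (ptensor s t).
  by move=> Tt; apply: pf; exists s, t.
(* One element of [perp T] suffices to make f::s defined; it exists because orthogonals are never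
   empty. *)
have [t0 Tt0] := perp_inhabited (conduct_carried cT).
have fs : cut_defined f s.
  by have [_ _] := pst _ Tt0; apply: cut_defined_adj; exact: st.
split=> //; rewrite -(conduct_biperp cT).
have cfs : carrier (cut f s) = pcar T.
  by apply: (@carrier_cutE _ (pcar S)) => //; exact: cS.
split=> // t Tt; have [_ n i] := pst _ Tt.
by split; [rewrite cfs; case: Tt| |]; rewrite -?pairing_adj//; exact: st.
Qed.

Lemma lolli_conduct S T : carried S -> inhabited_pset S -> is_conduct T ->
  disj (pcar S) (pcar T) -> is_conduct (lolli S T).
Proof.
move=> cS S0 cT ST; rewrite lolliE//; apply/is_conduct_perp/ptens_carried => //.
exact: perp_carried.
Qed.

(** A project out of a biorthogonal has only to be tested on generators. *)
Lemma lolli_biperp S T : carried S -> inhabited_pset S -> is_conduct T ->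
  disj (pcar S) (pcar T) -> lolli (perp (perp S)) T = lolli S T.
Proof.
move=> cS S0 cT ST; rewrite !lolliE//; last 2 first.
- exact: perp_carried.
- exact/perp_inhabited/perp_carried.
by rewrite perp_ptens_biperp//; exact: perp_carried.
Qed.

(** Both sides are the orthogonal of the triple tensors of [S], [T] and [perp U]. *)
Lemma lolli_tensor S T U : carried S -> carried T -> is_conduct U ->
  inhabited_pset S -> inhabited_pset T ->
  disj (pcar S) (pcar T) -> disj (pcar S) (pcar U) -> disj (pcar T) (pcar U) ->
  lolli (tensor S T) U = lolli S (lolli T U).
Proof.
move=> cS cT cU S0 T0 ST SU TU.
have cST := ptens_carried cS cT; have ST0 := ptens_inhabited S0 T0.
have cU' : carried (perp U) by exact: perp_carried.
have U'0 := perp_inhabited (conduct_carried cU).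
rewrite (@lolli_biperp (ptens S T))//; last by rewrite /disj fdisjointUX; apply/andP.
rewrite lolliE//; last by rewrite /disj fdisjointUX; apply/andP.
rewrite lolliE//; last 2 first.
- exact: lolli_conduct.
- by rewrite /disj fdisjointXU; apply/andP.
rewrite [in RHS]lolliE// perp_ptens_biperpr ?perp_ptensA//.
- exact: ptens_inhabited.
- exact: ptens_carried.
- by rewrite /disj fdisjointXU; apply/andP.
Qed.

Lemma lolli_bot S : carried S -> inhabited_pset S -> lolli S bot_pset = perp S.
Proof.
move=> cS S0; rewrite lolliE//; [|exact: bot_conduct|by rewrite /disj fdisjointX0].
by rewrite perp_bot perp_ptensC perp_ptens_unit.
Qed.

Lemma lolli_carrier S T f : carried S -> inhabited_pset S -> is_conduct T ->
  disj (pcar S) (pcar T) -> lolli S T f -> carrier f = (pcar S `|` pcar T)%fset.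
Proof. by move=> cS S0 cT ST; rewrite lolliE// => -[]. Qed.

(** Adjunction identifies (f::g)::s with g::(f::s), which lies in [U]. The pairing of [f] with
    [ptensor g s] is that of [g] with f::s, hence finite; this makes both f::g and its cut with s
    defined. *)
Lemma lolli_cut S T U f g : carried S -> inhabited_pset S -> is_conduct T -> is_conduct U ->
  disj (pcar S) (pcar T) -> disj (pcar S) (pcar U) -> disj (pcar T) (pcar U) ->
  lolli S T f -> lolli T U g -> cut_defined f g /\ lolli S U (cut f g).
Proof.
move=> cS S0 cT cU ST SU TU lf lg.
have cf := lolli_carrier cS S0 cT ST lf.
have cg := lolli_carrier (conduct_carried cT) (conduct_inhabited cT) cU TU lg.
have dg s : S s -> disj (carrier s) (carrier g).
  by move=> Ss; rewrite cS// cg /disj fdisjointXU; apply/andP.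
have key s : S s -> pairing f (ptensor g s) <> +oo%E.
  move=> Ss; have [fs Tfs] := lf _ Ss; have [gfs _] := lg _ Tfs.
  rewrite (pairing_peq (peq_refl f) (ptensorC _ _)) pairing_adj//; last exact: dg.
  by rewrite pairingC.
have [s0 Ss0] := S0.
have fg : cut_defined f g.
  by apply: cut_defined_adj (key _ Ss0); apply: disjC; exact: dg.
split=> // s Ss; have [fs Tfs] := lf _ Ss; have [gfs Ugfs] := lg _ Tfs.
have e : cut (cut f g) s =p cut g (cut f s).
  apply: peq_trans (cut_adj (disjC (dg _ Ss)) fg) _.
  apply: peq_trans (cut_peq (peq_refl f) (ptensorC _ _)) _.
  apply: peq_trans (peq_sym (cut_adj (dg _ Ss) fs)) _.
  exact: cutC.
split; last exact: conduct_peq (peq_sym e) Ugfs.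
by rewrite /cut_defined -pairing_adj//; [exact: key|exact/disjC/dg].
Qed.

End OneType.
End ConductTheory.

(** * Renaming of conducts *)

Section ConductRelabel.
Variable R : realType.

Section Two.
Variables (V W : choiceType).
Implicit Types (theta eta : V -> W) (S T : pset R V) (a b f : project R V).

Definition inj_on theta (X : {fset V}) := {in X &, injective theta}.

Lemma inj_onS theta (X Y : {fset V}) : (X `<=` Y)%fset -> inj_on theta Y -> inj_on theta X.
Proof. by move=> /fsubsetP XY ti x y xX yX; apply: ti; exact: XY. Qed.

Lemma inj_onUr theta (X Y : {fset V}) : inj_on theta (X `|` Y)%fset -> inj_on theta Y.
Proof. by apply: inj_onS; exact: fsubsetUr. Qed.

Lemma disj_imfset theta (X Y : {fset V}) : inj_on theta (X `|` Y)%fset ->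
  disj X Y -> disj (theta @` X)%fset (theta @` Y)%fset.
Proof.
move=> ti /fdisjointP XY; apply/fdisjointP => _ /imfsetP[x /= xX ->].
apply/negP => /imfsetP[y /= yY e]; have := XY _ xX.
by rewrite (ti x y _ _ e) ?yY// inE ?xX ?yY ?orbT.
Qed.

(** Endpoints are pulled back edge by edge with choice. Hence the orthogonal of a renamed set
    contains only renamed projects, on which [perp_relabel] rests. *)
Lemma prelabel_surj theta (X : {fset V}) (b : project R W) :
  carrier b = (theta @` X)%fset -> exists2 a, carrier a = X & b = prelabel theta a.
Proof.
case: b => w [v E s t wg sv tv w01]; rewrite /carrier /= => vX.
have /choice[s' hs] : forall e, exists x, x \in X /\ s e = theta x.
  by move=> e; have := sv e; rewrite vX => /imfsetP[x /= xX ->]; exists x.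
have /choice[t' ht] : forall e, exists x, x \in X /\ t e = theta x.
  by move=> e; have := tv e; rewrite vX => /imfsetP[x /= xX ->]; exists x.
exists (Project w (@Graph R V X E s' t' wg (fun e => (hs e).1) (fun e => (ht e).1) w01)) => //.
congr Project; apply: eq_Graph => // e; [exact: (hs e).2|exact: (ht e).2].
Qed.

Lemma carried_relabel theta S : carried S -> carried (relabel_set theta S).
Proof. by move=> cS b [a Sa ->]; rewrite carrier_prelabel cS. Qed.

Lemma inhabited_relabel theta S : inhabited_pset S -> inhabited_pset (relabel_set theta S).
Proof. by move=> [a Sa]; exists (prelabel theta a), a. Qed.

Lemma orthogonal_prelabel theta a b : carrier a = carrier b -> inj_on theta (carrier b) ->
  orthogonal (prelabel theta a) (prelabel theta b) <-> orthogonal a b.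
Proof.
move=> ab ti; rewrite /orthogonal pairing_prelabel ?ab ?fsetUid//.
by split=> -[_ n i]; split; rewrite // !carrier_prelabel ab.
Qed.

Lemma perp_relabel theta S : inj_on theta (pcar S) -> carried S ->
  perp (relabel_set theta S) = relabel_set theta (perp S).
Proof.
move=> ti cS; apply: pset_ext => // b; split=> [[/prelabel_surj[a ca ->] pb]|[a [ca pa] ->]].
  exists a => //; split=> // c Sc; apply/(@orthogonal_prelabel theta); rewrite ?(cS c)//.
  by apply: pb; exists c.
split; first by rewrite carrier_prelabel ca.
move=> _ [c Sc ->]; apply/orthogonal_prelabel; rewrite ?(cS c)//; exact: pa.
Qed.

Lemma is_conduct_relabel theta S : inj_on theta (pcar S) -> is_conduct S ->
  is_conduct (relabel_set theta S).
Proof.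
move=> ti cS; have cc := conduct_carried cS; split.
- exact: carried_relabel.
- exact/inhabited_relabel/conduct_inhabited.
- by rewrite perp_relabel// perp_relabel//; [rewrite conduct_biperp|exact: perp_carried].
Qed.

Lemma relabel_ptens theta S T :
  relabel_set theta (ptens S T) = ptens (relabel_set theta S) (relabel_set theta T).
Proof.
apply: pset_ext => [|b]; first by rewrite /= imfsetU.
split=> [[_ [a [c [Sa Tc ->]]] ->]|[_ [_ [[a Sa ->] [c Tc ->] ->]]]].
  exists (prelabel theta a), (prelabel theta c); split; [by exists a|by exists c|].
  exact: prelabel_ptensor.
exists (ptensor a c); last by rewrite prelabel_ptensor.
by exists a, c.
Qed.

Lemma relabel_tensor theta S T : carried S -> carried T ->
  inj_on theta (pcar S `|` pcar T)%fset ->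
  relabel_set theta (tensor S T) = tensor (relabel_set theta S) (relabel_set theta T).
Proof.
move=> cS cT ti; have cST := ptens_carried cS cT.
rewrite -[tensor S T]/(perp (perp (ptens S T))) -!perp_relabel//.
- by rewrite relabel_ptens.
- exact: perp_carried.
Qed.

Lemma relabel_lolli theta S T : carried S -> inhabited_pset S -> is_conduct T ->
  disj (pcar S) (pcar T) -> inj_on theta (pcar S `|` pcar T)%fset ->
  relabel_set theta (lolli S T) = lolli (relabel_set theta S) (relabel_set theta T).
Proof.
move=> cS S0 cT ST ti; rewrite !lolliE//.
- rewrite -perp_relabel//; last by apply: ptens_carried => //; exact: perp_carried.
  rewrite relabel_ptens perp_relabel//; [exact: inj_onUr ti|exact: conduct_carried].
- exact: carried_relabel.
- exact: inhabited_relabel.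
- by apply: is_conduct_relabel => //; exact: inj_onUr ti.
- exact: disj_imfset.
Qed.

Lemma eq_relabel_set theta eta S : carried S -> {in pcar S, theta =1 eta} ->
  relabel_set theta S = relabel_set eta S.
Proof.
move=> cS te; have e a : S a -> prelabel theta a = prelabel eta a.
  by move=> Sa; apply: eq_prelabel; rewrite cS.
apply: pset_ext => [|b]; first exact: eq_in_imfset.
by split=> -[a Sa ->]; exists a => //; rewrite e.
Qed.

Lemma relabel_mem theta S a : S a -> relabel_set theta S (prelabel theta a).
Proof. by exists a. Qed.

End Two.

Lemma relabel_set_comp (U V W : choiceType) (theta : V -> W) (eta : U -> V) (S : pset R U) :
  relabel_set theta (relabel_set eta S) = relabel_set (theta \o eta) S.
Proof.
apply: pset_ext => [|b]; first by rewrite /= -imfset_comp.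
split=> [[_ [a Sa ->] ->]|[a Sa ->]]; first by exists a => //; rewrite prelabel_comp.
by exists (prelabel eta a); [exists a|rewrite prelabel_comp].
Qed.

Lemma relabel_set_id (V : choiceType) (S : pset R V) : relabel_set id S = S.
Proof.
apply: pset_ext => [|b]; first exact: imfset_id.
by split=> [[a Sa ->]|Sb]; [rewrite prelabel_id|exists b => //; rewrite prelabel_id].
Qed.

End ConductRelabel.

(** * Cuts between projects of disjoint carriers *)

Section Interchange.
Variables (R : realType) (V : choiceType).
Implicit Types a b c d f g : project R V.

Lemma altconsec_disj (F G : graph R V) e e' : disj (vert F) (vert G) ->
  ~~ @altconsec _ _ F G e e'.
Proof.
move=> FG; have h (x : edge F) (y : edge G) v : v \in vert F -> v \in vert G -> False.
  by move=> vF; have /fdisjointP/(_ v vF)/negPf -> := FG.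
apply/negP; case: e => x; case: e' => y; rewrite /altconsec /= ?andbF// andbT => /eqP e.
  by apply: (h x y (tgt x)); [exact: tgt_vert|rewrite -e src_vert].
by apply: (h y x (tgt x)); [rewrite -e src_vert|exact: tgt_vert].
Qed.

Lemma measurement_disj (F G : graph R V) : disj (vert F) (vert G) -> measurement F G = 0%E.
Proof.
move=> FG; rewrite measurementE /circ_sum; set c := cyc _; have -> : c = set0.
  apply/seteqP; split=> // s [+ /primitive_neq_nil]; case: s => // e s cs _.
  by have := next_cycle cs (mem_head e s); rewrite (negPf (altconsec_disj _ _ FG)).
by rewrite image_set0 esum_set0.
Qed.

Lemma cut_defined_disj f g : disj (carrier f) (carrier g) -> cut_defined f g.
Proof. by move=> fg; rewrite /cut_defined /pairing measurement_disj. Qed.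

(** Nothing can alternate, so the paths of the reduction are the single edges. *)
Lemma cut_disj f g : disj (carrier f) (carrier g) -> cut f g =p ptensor f g.
Proof.
move=> fg; apply: peq_sym; apply/project_eqP; split.
  by apply: wager_inj; rewrite /= /pairing measurement_disj// adde0.
have vr : rvert (pgraph f) (pgraph g) = (carrier f `|` carrier g)%fset.
  apply/fsetP => x; have /fdisjointP/(_ x) := fg; rewrite !inE.
  by rewrite /carrier; case: (x \in vert (pgraph f)) => [/(_ isT)/negPf -> //|_];
     case: (x \in _).
split; first by rewrite /= vr.
have pe (e : edge (pgraph f) + edge (pgraph g)) : @redge_pred _ _ (pgraph f) (pgraph g) (e, [::]).
  apply/and3P; split=> //; rewrite vr; [exact: usrc_vert|exact: utgt_vert].
exists (fun e => @exist _ (fun p => is_true (@redge_pred _ _ (pgraph f) (pgraph g) p)) _ (pe e)).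
  apply: inj_surj_bij => [e e' /(congr1 val)[]//|[[e s] es]].
  exists e; apply: val_inj => /=; congr pair.
  have /and3P[+ _ _] := es; case: s {es} => // e' s /=.
  rewrite /alt_path /= -/(altconsec _ _) => /andP[].
  by have /negP h := altconsec_disj e e' fg; move=> /h.
by move=> e; split=> //; rewrite /= /rwgt /weight big_seq1.
Qed.

(** By adjunction the cut is that of [ptensor a b] with [c], then with [d]. The first of these is
    (c::a)::b, which by disjointness is the tensor of c::a and [b]; then [d] is treated in the same
    way. *)
Lemma cut_interchange a b c d :
  disj (carrier a `|` carrier c)%fset (carrier b `|` carrier d)%fset ->
  cut_defined a c -> cut_defined b d ->
  cut_defined (ptensor a b) (ptensor c d) /\
  cut (ptensor a b) (ptensor c d) =p ptensor (cut a c) (cut b d).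
Proof.
rewrite /disj fdisjointUX !fdisjointXU => /andP[/andP[ab ad] /andP[cb cd]] ac bd.
have dca X : disj (carrier a) X -> disj (carrier c) X -> disj (carrier (cut c a)) X.
  move=> aX cX; apply/fdisjointP => x; rewrite carrier_cut !inE.
  by move=> /orP[/andP[_]|/andP[_]]; move: x; exact/fdisjointP.
have ca : cut_defined c a by rewrite cut_definedC.
have e1 : cut (ptensor a b) c =p ptensor (cut c a) b.
  apply: peq_trans (cutC _ _) _; apply: peq_trans (peq_sym (cut_adj ab ca)) _.
  exact/cut_disj/dca.
have dabc : cut_defined (ptensor a b) c.
  rewrite cut_definedC /cut_defined pairing_adj//.
  exact/cut_defined_disj/dca.
have db : cut_defined d b by rewrite cut_definedC.
have dd : disj (carrier (cut d b)) (carrier (cut c a)).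
  apply/disjC/dca.
    apply/fdisjointP => x xa; rewrite carrier_cut !inE.
    by rewrite (negPf (fdisjointP ab _ xa)) (negPf (fdisjointP ad _ xa)) !andbF.
  apply/fdisjointP => x xa; rewrite carrier_cut !inE.
  by rewrite (negPf (fdisjointP cb _ xa)) (negPf (fdisjointP cd _ xa)) !andbF.
have e2 : ptensor (cut c a) b =p ptensor b (cut c a) := ptensorC _ _.
split.
  rewrite /cut_defined pairing_adj// (pairing_peq e1 (peq_refl d)).
  rewrite (pairing_peq e2 (peq_refl d)) pairingC pairing_adj//; last exact/disjC/dca.
  exact: cut_defined_disj.
apply: peq_trans (peq_sym (cut_adj cd dabc)) _.
apply: peq_trans (cut_peq e1 (peq_refl d)) _.
apply: peq_trans (cut_peq e2 (peq_refl d)) _.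
apply: peq_trans (cutC _ _) _.
apply: peq_trans (peq_sym (cut_adj _ db)) _; first exact/disjC/dca.
apply: peq_trans (cut_disj dd) _; apply: peq_trans (ptensorC _ _) _.
by apply: ptensor_peq; exact: cutC.
Qed.

End Interchange.

(** * Locations N x {0,1} *)

Section Levels.
Implicit Types (X Y Z : {fset nat}) (p : nat * nat) (i j : nat).

Definition lev i X : {fset nat * nat} := (psi i @` X)%fset.

Lemma in_lev i X p : (p \in lev i X) = (p.1 \in X) && (p.2 == i).
Proof.
apply/imfsetP/andP => [[x /= xX ->]//|[pX /eqP pi]].
by exists p.1 => //; rewrite /psi -pi -surjective_pairing.
Qed.

Lemma disj_lev i j X Y : i != j -> disj (lev i X) (lev j Y).
Proof.
move=> ij; apply/fdisjointP => p; rewrite !in_lev => /andP[_ /eqP ->].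
by rewrite (negPf ij) andbF.
Qed.

Lemma imfset_lev i (W : choiceType) (theta : nat * nat -> W) X :
  (theta @` lev i X)%fset = ((fun x => theta (x, i)) @` X)%fset.
Proof. by rewrite /lev -imfset_comp. Qed.

Lemma psi_inj i : injective (psi i).
Proof. by move=> x y []. Qed.

Lemma inj_on_psi i X : inj_on (psi i) X.
Proof. by move=> x y _ _ /psi_inj. Qed.

Variable R : realType.
Implicit Types f g h : project R (nat * nat)%type.

Lemma disjU4 (V : choiceType) (A B C D : {fset V}) : disj A C -> disj A D ->
  disj B C -> disj B D -> disj (A `|` B)%fset (C `|` D)%fset.
Proof. by rewrite /disj fdisjointUX !fdisjointXU => -> -> -> ->. Qed.

Definition typed f X Y := carrier f = (lev 0 X `|` lev 1 Y)%fset.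

Lemma typed_mem f X Y p : typed f X Y -> p \in carrier f ->
  (exists2 x, x \in X & p = (x, 0%N)) \/ (exists2 y, y \in Y & p = (y, 1%N)).
Proof.
move=> ->; rewrite inE !in_lev; case: p => x i /=.
by move=> /orP[] /andP[xX /eqP ->]; [left|right]; exists x.
Qed.

Lemma eq_prelabel_typed (W : choiceType) (theta eta : nat * nat -> W) f X Y :
  typed f X Y -> (forall x, x \in X -> theta (x, 0%N) = eta (x, 0%N)) ->
  (forall y, y \in Y -> theta (y, 1%N) = eta (y, 1%N)) ->
  prelabel theta f = prelabel eta f.
Proof.
move=> tf t0 t1; apply: eq_prelabel => p /(typed_mem tf)[[x xX ->]|[y yY ->]].
  exact: t0.
exact: t1.
Qed.

Lemma typed_peq f g X Y : f =p g -> typed f X Y -> typed g X Y.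
Proof. by move=> fg; rewrite /typed (peq_carrier fg). Qed.

Lemma carrier_cut3 (A B C : {fset nat * nat}) f g : disj A B -> disj A C -> disj B C ->
  carrier f = (A `|` B)%fset -> carrier g = (B `|` C)%fset ->
  carrier (cut f g) = (A `|` C)%fset.
Proof.
move=> /fdisjointP AB /fdisjointP AC /fdisjointP BC cf cg.
rewrite carrier_cut cf cg; apply/fsetP => p; rewrite !inE.
have := AB p; have := AC p; have := BC p.
case: (p \in A) => [_ /(_ isT)/negPf -> /(_ isT)/negPf -> //|+ _ _].
by case: (p \in B) => [/(_ isT)/negPf ->|_]; rewrite ?orbF ?andbF.
Qed.

Lemma carrier_mu f i X j Y : carrier f = (lev i X `|` lev j Y)%fset ->
  carrier (prelabel mu f) = (lev i.+1 X `|` lev j.+1 Y)%fset.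
Proof. by move=> cf; rewrite carrier_prelabel cf imfsetU !imfset_lev. Qed.

Lemma mu_inj : injective mu.
Proof. by move=> [x i] [y j] [-> ->]. Qed.

Definition pcomp g f : project R (nat * nat)%type :=
  prelabel nu (cut f (prelabel mu g)).

Lemma pcomp_peq f f' g g' : f =p f' -> g =p g' -> pcomp g f =p pcomp g' f'.
Proof. by move=> ff gg; apply/prelabel_peq/cut_peq => //; exact: prelabel_peq. Qed.

Lemma carrier_pcomp f g X Y Z : typed f X Y -> typed g Y Z ->
  carrier (cut f (prelabel mu g)) = (lev 0 X `|` lev 2 Z)%fset.
Proof.
move=> tf tg; apply: (carrier_cut3 _ _ _ tf (carrier_mu tg)); exact: disj_lev.
Qed.

Lemma typed_pcomp f g X Y Z : typed f X Y -> typed g Y Z -> typed (pcomp g f) X Z.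
Proof.
move=> tf tg; rewrite /typed carrier_prelabel (carrier_pcomp tf tg).
by rewrite imfsetU !imfset_lev.
Qed.

Lemma inj_on_lev (s : nat -> nat) (l : seq nat) (X : {fset nat * nat}) :
  (forall p, p \in X -> p.2 \in l) -> {in l &, injective s} ->
  inj_on (fun p => (p.1, s p.2)) X.
Proof.
move=> Xl si [x i] [y j] /Xl /= il /Xl /= jl [-> /si -> //].
Qed.

(** The three projects are laid out on levels 0 to 3, where [f] and the copy of [h] share no
    location and [cutA] applies. Both composites are renamings of the resulting cut, which lives on
    levels 0 and 3. *)
Lemma pcompA f g h X Y Z W : typed f X Y -> typed g Y Z -> typed h Z W ->
  cut_defined f (prelabel mu g) -> cut_defined g (prelabel mu h) ->
  pcomp h (pcomp g f) =p pcomp (pcomp h g) f.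
Proof.
move=> tf tg th dfg dgh; pose G := prelabel mu g; pose H := prelabel mu (prelabel mu h).
have cG : carrier G = (lev 1 Y `|` lev 2 Z)%fset by exact: carrier_mu.
have cH : carrier H = (lev 2 Z `|` lev 3 W)%fset by apply/carrier_mu/carrier_mu.
have cfG := carrier_pcomp tf tg.
have cGH : carrier (cut G H) = (lev 1 Y `|` lev 3 W)%fset.
  by apply: carrier_cut3 cG cH; exact: disj_lev.
have cfGH : carrier (cut f (cut G H)) = (lev 0 X `|` lev 3 W)%fset.
  by apply: carrier_cut3 tf cGH; exact: disj_lev.
have dGH : cut_defined G H by rewrite /cut_defined pairing_prelabel//; exact: in2W mu_inj.
(* [rho] lowers levels 2 and 3, bringing f::G to levels 0 and 1; [sigma] fills the gap that G::H
   leaves at level 2. Each is injective on the levels that occur, and [nu] after either sends level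
   3 to level 1. *)
pose rho p : nat * nat := (p.1, p.2.-1).
pose sigma p : nat * nat := (p.1, if p.2 == 3%N then 2%N else p.2).
have l1 : pcomp h (pcomp g f) =p prelabel nu (prelabel rho (cut (cut f G) H)).
  apply: prelabel_peq; apply: peq_sym; rewrite /pcomp.
  have -> : prelabel nu (cut f (prelabel mu g)) = prelabel rho (cut f G).
    apply: eq_prelabel => -[x i]; rewrite cfG !inE !in_lev /= => /orP[]/andP[_ /eqP ->] //.
  have -> : prelabel mu h = prelabel rho H by rewrite /H !prelabel_comp.
  apply: cut_prelabel; apply: (@inj_on_lev predn [:: 0; 2; 3]%N) => [[x i]|i j].
    by rewrite cfG cH !inE !in_lev /= => /orP[]/orP[]/andP[_ /eqP ->].
  by rewrite !inE => /or3P[]/eqP -> /or3P[]/eqP ->.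
have l2 : pcomp (pcomp h g) f =p prelabel nu (prelabel sigma (cut f (cut G H))).
  apply: prelabel_peq; apply: peq_sym.
  have e : prelabel sigma (cut G H) =p prelabel mu (pcomp h g).
    apply: peq_trans (prelabel_peq sigma (peq_sym (cut_prelabel _))) _.
      exact: in2W mu_inj.
    rewrite /pcomp !prelabel_comp.
    rewrite (@eq_prelabel _ _ _ (sigma \o mu) (mu \o nu)); first exact: peq_refl.
    by move=> [x i]; rewrite (carrier_pcomp tg th) !inE !in_lev /= => /orP[]/andP[_ /eqP ->].
  apply: (@cut_congr _ _ _ sigma f _ f) => //.
    apply: (@inj_on_lev (fun i => if i == 3%N then 2%N else i) [:: 0; 1; 3]%N) => [[x i]|i j].
      by rewrite tf cGH !inE !in_lev /= => /orP[]/orP[]/andP[_ /eqP ->].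
    by rewrite !inE => /or3P[]/eqP -> /or3P[]/eqP ->.
  by rewrite (@eq_prelabel_typed _ sigma id _ _ _ tf)// prelabel_id; exact: peq_refl.
apply: peq_trans l1 _; apply: peq_sym; apply: peq_trans l2 _; apply: peq_sym.
rewrite !prelabel_comp.
have dis : disj (carrier f) (carrier H).
  by rewrite tf cH; apply: disjU4; exact: disj_lev.
apply: peq_trans (prelabel_peq _ (cutA dis dfg dGH)) _.
rewrite (@eq_prelabel _ _ _ (nu \o rho) (nu \o sigma)); first exact: peq_refl.
by move=> [x i]; rewrite cfGH !inE !in_lev /= => /orP[]/andP[_ /eqP ->].
Qed.

Definition faxm X (theta : nat -> nat) : project R (nat * nat)%type :=
  fax (lev 0 X) (fun p => (theta p.1, 1%N)).

Lemma typed_faxm X theta : typed (faxm X theta) X (theta @` X)%fset.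
Proof. by rewrite /typed /carrier /= imfset_lev /lev -imfset_comp. Qed.

Lemma eq_faxm X theta eta : {in X, theta =1 eta} -> faxm X theta =p faxm X eta.
Proof.
by move=> te; apply: eq_fax => -[x i]; rewrite in_lev /= => /andP[/te -> _].
Qed.

Lemma prelabel_mu_faxm X theta : prelabel mu (faxm X theta) =p
  fax (lev 1 X) (fun p => (theta p.1, 2%N)).
Proof.
have -> : lev 1 X = (mu @` lev 0 X)%fset by rewrite imfset_lev.
by apply: prelabel_fax => //; exact: in2W mu_inj.
Qed.

Lemma pcomp_faxml f X Y theta : typed f X Y ->
  pcomp (faxm Y theta) f =p prelabel (fun p => if p.2 == 1%N then (theta p.1, 1%N) else p) f.
Proof.
move=> tf; rewrite /pcomp.
have e : cut f (prelabel mu (faxm Y theta)) =p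
    prelabel (fun v => if v \in lev 1 Y then (theta v.1, 2%N) else v) f.
  apply: peq_trans (cutC _ _) _.
  apply: peq_trans (cut_peq (prelabel_mu_faxm _ _) (peq_refl _)) _.
  apply: cut_fax => p; first by rewrite tf inE => ->; rewrite orbT.
  by rewrite tf !inE !in_lev !andbF.
apply: peq_trans (prelabel_peq nu e) _; rewrite prelabel_comp.
rewrite (eq_prelabel_typed (eta := fun p => if p.2 == 1%N then (theta p.1, 1%N) else p) tf).
- exact: peq_refl.
- by move=> x xX /=; rewrite in_lev andbF.
- by move=> y yY /=; rewrite in_lev yY.
Qed.

Lemma faxm_sym X theta eta : {in X, cancel theta eta} ->
  faxm X theta =p fax (lev 1 (theta @` X)%fset) (fun p => (eta p.1, 0%N)).
Proof.
move=> te; have -> : lev 1 (theta @` X)%fset = ((fun p => (theta p.1, 1%N)) @` lev 0 X)%fset.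
  by rewrite imfset_lev /lev -imfset_comp.
by apply: fax_sym => -[x i]; rewrite in_lev /= => /andP[/te -> /eqP ->].
Qed.

(** On the source side the Fax moves level 1 back to level 0, against its own direction: it is first
    turned round by [faxm_sym], and the renaming is the inverse [eta]. *)
Lemma pcomp_faxmr f X Y Z theta eta : {in X, cancel theta eta} ->
  Y = (theta @` X)%fset -> typed f Y Z ->
  pcomp f (faxm X theta) =p prelabel (fun p => if p.2 == 0%N then (eta p.1, 0%N) else p) f.
Proof.
move=> te YX tf; rewrite /pcomp; have cf := carrier_mu tf.
have e : cut (faxm X theta) (prelabel mu f) =p
    prelabel (fun v => if v \in lev 1 Y then (eta v.1, 0%N) else v) (prelabel mu f).
  rewrite YX; apply: peq_trans (cut_peq (faxm_sym te) (peq_refl _)) _; rewrite -YX.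
  apply: cut_fax => p; first by rewrite cf inE => ->.
  by rewrite cf !inE !in_lev !andbF.
apply: peq_trans (prelabel_peq nu e) _; rewrite !prelabel_comp.
rewrite (eq_prelabel_typed (eta := fun p => if p.2 == 0%N then (eta p.1, 0%N) else p) tf).
- exact: peq_refl.
- by move=> x xX /=; rewrite in_lev xX.
- by move=> y yY /=; rewrite in_lev andbF.
Qed.

Lemma prelabel_faxm X theta (lambda : nat * nat -> nat * nat) Y eta : inj_on lambda (lev 0 X) ->
  (forall x, x \in X -> lambda (x, 0%N) \in lev 0 Y) ->
  (forall y, y \in Y -> exists2 x, x \in X & lambda (x, 0%N) = (y, 0%N)) ->
  (forall x, x \in X -> lambda (theta x, 1%N) = (eta (lambda (x, 0%N)).1, 1%N)) ->
  prelabel lambda (faxm X theta) =p faxm Y eta.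
Proof.
move=> li lY Yl le.
have -> : faxm Y eta = fax (lambda @` lev 0 X)%fset (fun p => (eta p.1, 1%N)).
  congr fax; rewrite imfset_lev; apply/fsetP => -[y i]; apply/idP/imfsetP => [|[x /= xX ->]].
    by rewrite in_lev /= => /andP[/Yl[x xX e] /eqP ->]; exists x.
  exact: lY.
apply: prelabel_fax => // -[x i]; rewrite in_lev /= => /andP[xX /eqP ->]; exact/esym/le.
Qed.

End Levels.

(** * Renamings of N by binary digits *)

Section Doubling.
Implicit Types (X Y Z : {fset nat}) (n x : nat).

(* [dbl i] is [phi \o psi i]. *)
Definition dbl i x : nat := (2 * x + i)%N.

Lemma odd_dbl0 x : odd (dbl 0 x) = false. Proof. by rewrite /dbl; lia. Qed.
Lemma odd_dbl1 x : odd (dbl 1 x) = true. Proof. by rewrite /dbl; lia. Qed.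
Lemma half_dbl0 x : (dbl 0 x)./2 = x. Proof. by rewrite /dbl; lia. Qed.
Lemma half_dbl1 x : (dbl 1 x)./2 = x. Proof. by rewrite /dbl; lia. Qed.
Definition dblE := (odd_dbl0, odd_dbl1, half_dbl0, half_dbl1).

(** Case analysis on the last binary digit. Identities between renamings follow by peeling off as
    many digits as there are nested tensors, while [dblE] computes. *)
Lemma dbl_ind (P : nat -> Prop) :
  (forall x, P (dbl 0 x)) -> (forall x, P (dbl 1 x)) -> forall n, P n.
Proof.
move=> P0 P1 n; have -> : n = if odd n then dbl 1 n./2 else dbl 0 n./2.
  by case: ifP; rewrite /dbl; lia.
by case: ifP.
Qed.

Lemma dbl_inj i : injective (dbl i). Proof. by rewrite /dbl => x y; lia. Qed.

Definition tens_fset X Y : {fset nat} := (dbl 0 @` X `|` dbl 1 @` Y)%fset.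

Lemma in_dbl0 X n : (n \in (dbl 0 @` X)%fset) = ~~ odd n && (n./2 \in X).
Proof.
elim/dbl_ind: n => x; rewrite dblE ?half_dbl0 /=.
  by rewrite mem_imfset//; exact: dbl_inj.
by apply/imfsetP => -[y _ /(congr1 odd)]; rewrite !dblE.
Qed.

Lemma in_dbl1 X n : (n \in (dbl 1 @` X)%fset) = odd n && (n./2 \in X).
Proof.
elim/dbl_ind: n => x; rewrite dblE ?half_dbl1 /=; last first.
  by rewrite mem_imfset//; exact: dbl_inj.
by apply/imfsetP => -[y _ /(congr1 odd)]; rewrite !dblE.
Qed.

Lemma in_tens X Y n :
  (n \in tens_fset X Y) = if odd n then n./2 \in Y else n./2 \in X.
Proof. by rewrite /tens_fset inE in_dbl0 in_dbl1; case: (odd n); rewrite //= orbF. Qed.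

Lemma disj_dbl X Y : disj (dbl 0 @` X)%fset (dbl 1 @` Y)%fset.
Proof.
by apply/fdisjointP => n; rewrite in_dbl0 in_dbl1 => /andP[/negPf -> _].
Qed.

Definition tens_fun (theta eta : nat -> nat) n :=
  if odd n then dbl 1 (eta n./2) else dbl 0 (theta n./2).

(* The associativity constraint as a renaming of N: 4a, 4b+2 and 2d+1 are sent
   to 2a, 4b+1 and 4d+3. *)
Definition assocn n :=
  if odd n then dbl 1 (dbl 1 n./2)
  else if odd n./2 then dbl 1 (dbl 0 n./2./2) else dbl 0 n./2./2.

Definition assocn' n :=
  if odd n then if odd n./2 then dbl 1 n./2./2 else dbl 0 (dbl 1 n./2./2)
  else dbl 0 (dbl 0 n./2).

(** Flips the last binary digit: the renaming behind the braiding. *)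
Definition swapn n := if odd n then dbl 0 n./2 else dbl 1 n./2.

Lemma assocnK : cancel assocn assocn'.
Proof.
elim/dbl_ind => x; last by rewrite /assocn /assocn' !dblE.
by elim/dbl_ind: x => x; rewrite /assocn /assocn' !dblE.
Qed.

Lemma assocn'K : cancel assocn' assocn.
Proof.
elim/dbl_ind => x; first by rewrite /assocn /assocn' !dblE.
by elim/dbl_ind: x => x; rewrite /assocn /assocn' !dblE.
Qed.

Lemma swapnK : involutive swapn.
Proof. by elim/dbl_ind => x; rewrite /swapn !dblE. Qed.

Definition dbl_loc i (p : nat * nat) : nat * nat := (dbl i p.1, p.2).

Lemma dbl_loc_inj i : injective (dbl_loc i).
Proof. by move=> [x j] [y k] [/dbl_inj -> ->]. Qed.

Lemma disj_dbl_loc (A B : {fset nat * nat}) : disj (dbl_loc 0 @` A)%fset (dbl_loc 1 @` B)%fset.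
Proof.
apply/fdisjointP => _ /imfsetP[p /= _ ->]; apply/negP => /imfsetP[q /= _ [/(congr1 odd)]].
by rewrite !dblE.
Qed.

Lemma dbl_loc_lev i j X : (dbl_loc i @` lev j X)%fset = lev j (dbl i @` X)%fset.
Proof. by rewrite imfset_lev /lev -imfset_comp. Qed.

End Doubling.

(** * Tensor product of morphisms *)

Section TensorProject.
Variable R : realType.
Implicit Types (X Y Z : {fset nat}) (f g h : project R (nat * nat)%type).

(** [phi] stores the level of (x, j) as the last digit of 2x + j, [psi i] records the factor as the
    new level, and [tau] exchanges digit and level: the result is (2x + i, j). *)
Lemma tensor_projectE f g X Y X' Y' : typed f X Y -> typed g X' Y' ->
  tensor_project f g = ptensor (prelabel (dbl_loc 0) f) (prelabel (dbl_loc 1) g).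
Proof.
move=> tf tg; rewrite /tensor_project prelabel_ptensor !prelabel_comp; congr ptensor.
  apply: (eq_prelabel_typed tf) => x _; rewrite /dbl_loc /= /tau /psi /phi /=.
    by rewrite -/(dbl 0 x) !dblE.
  by rewrite -/(dbl 1 x) !dblE /= /dbl addn1 addn0.
apply: (eq_prelabel_typed tg) => x _; rewrite /dbl_loc /= /tau /psi /phi /=.
  by rewrite -/(dbl 0 x) !dblE /= /dbl addn1 addn0.
by rewrite -/(dbl 1 x) !dblE.
Qed.

Lemma typed_tensor f g X Y X' Y' : typed f X Y -> typed g X' Y' ->
  typed (tensor_project f g) (tens_fset X X') (tens_fset Y Y').
Proof.
move=> tf tg; rewrite /typed (tensor_projectE tf tg) /carrier /= -!/(carrier _) tf tg.
by rewrite !imfsetU !dbl_loc_lev /tens_fset /lev !imfsetU fsetUACA.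
Qed.

Lemma tensor_peq f f' g g' X Y X' Y' : typed f X Y -> typed g X' Y' ->
  f =p f' -> g =p g' -> tensor_project f g =p tensor_project f' g'.
Proof.
move=> tf tg ff gg; rewrite (tensor_projectE tf tg).
rewrite (tensor_projectE (typed_peq ff tf) (typed_peq gg tg)).
by apply: ptensor_peq; exact: prelabel_peq.
Qed.

Lemma prelabel_dbl_loc_faxm i X theta eta : (forall x, eta (dbl i x) = dbl i (theta x)) ->
  prelabel (dbl_loc i) (faxm R X theta) =p fax (lev 0 (dbl i @` X)%fset) (fun p => (eta p.1, 1%N)).
Proof.
move=> e; rewrite -dbl_loc_lev; apply: prelabel_fax => [|p _]; first exact: in2W (@dbl_loc_inj i).
by rewrite /dbl_loc /= e.
Qed.

Lemma tensor_faxm X Y theta eta :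
  tensor_project (faxm R X theta) (faxm R Y eta) =p faxm R (tens_fset X Y) (tens_fun theta eta).
Proof.
rewrite (tensor_projectE (typed_faxm _ _ _) (typed_faxm _ _ _)).
apply: peq_trans (ptensor_peq (prelabel_dbl_loc_faxm _ (eta := tens_fun theta eta) _)
  (prelabel_dbl_loc_faxm _ (eta := tens_fun theta eta) _)) _.
- by move=> x; rewrite /tens_fun !dblE.
- by move=> x; rewrite /tens_fun !dblE.
rewrite /faxm /tens_fset /lev imfsetU; apply: fax_union => //.
apply/fdisjointP => p; rewrite !in_lev in_dbl0 in_dbl1.
by move=> /andP[/andP[/negPf ->]].
Qed.

(** The factors live on even and odd locations, so [cut_interchange] applies; [mu] and [nu] act on
    levels only and commute with [dbl_loc]. *)
Lemma tensor_pcomp f f' g g' X Y Z X' Y' Z' :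
  typed f X Y -> typed f' Y Z -> typed g X' Y' -> typed g' Y' Z' ->
  cut_defined f (prelabel mu f') -> cut_defined g (prelabel mu g') ->
  tensor_project (pcomp f' f) (pcomp g' g) =p
  pcomp (tensor_project f' g') (tensor_project f g).
Proof.
move=> tf tf' tg tg' df dg.
rewrite (tensor_projectE (typed_pcomp tf tf') (typed_pcomp tg tg')).
rewrite (tensor_projectE tf tg) (tensor_projectE tf' tg') /pcomp.
apply: peq_sym; rewrite prelabel_ptensor !prelabel_comp.
rewrite -[mu \o dbl_loc 0]/(dbl_loc 0 \o mu) -[mu \o dbl_loc 1]/(dbl_loc 1 \o mu).
rewrite -!prelabel_comp.
have Di i (a b : project R (nat * nat)%type) :
    prelabel (dbl_loc i) (cut a b) =p cut (prelabel (dbl_loc i) a) (prelabel (dbl_loc i) b).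
  by apply: cut_prelabel; exact: in2W (@dbl_loc_inj i).
have dD i (a b : project R (nat * nat)%type) :
    cut_defined a b -> cut_defined (prelabel (dbl_loc i) a) (prelabel (dbl_loc i) b).
  by rewrite /cut_defined pairing_prelabel//; exact: in2W (@dbl_loc_inj i).
have e : cut (ptensor (prelabel (dbl_loc 0) f) (prelabel (dbl_loc 1) g))
      (ptensor (prelabel (dbl_loc 0) (prelabel mu f')) (prelabel (dbl_loc 1) (prelabel mu g'))) =p
    ptensor (prelabel (dbl_loc 0) (cut f (prelabel mu f')))
      (prelabel (dbl_loc 1) (cut g (prelabel mu g'))).
  have [| | |_ ce] := @cut_interchange _ _ (prelabel (dbl_loc 0) f) (prelabel (dbl_loc 1) g)
      (prelabel (dbl_loc 0) (prelabel mu f')) (prelabel (dbl_loc 1) (prelabel mu g')).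
  - by rewrite !carrier_prelabel -!imfsetU; exact: disj_dbl_loc.
  - exact: dD.
  - exact: dD.
  apply: peq_trans ce _; by apply: ptensor_peq; exact/peq_sym/Di.
apply: peq_trans (prelabel_peq nu e) _; rewrite prelabel_ptensor !prelabel_comp.
exact: peq_refl.
Qed.

Lemma pcomp_faxm X Y theta eta : Y = (theta @` X)%fset ->
  pcomp (faxm R Y eta) (faxm R X theta) =p faxm R X (eta \o theta).
Proof.
move=> ->; apply: peq_trans (pcomp_faxml _ (typed_faxm _ _ _)) _.
apply: prelabel_faxm => //=.
- by move=> [x i] [y j]; rewrite !in_lev /= => /andP[_ /eqP ->] /andP[_ /eqP ->].
- by move=> x xX; rewrite in_lev xX.
- by move=> x xX; exists x.
Qed.

Lemma pcomp_idl f X Y : typed f X Y -> pcomp (faxm R Y id) f =p f.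
Proof.
move=> tf; apply: peq_trans (pcomp_faxml _ tf) _.
by rewrite (eq_prelabel_typed (eta := id) tf)// prelabel_id; exact: peq_refl.
Qed.

Lemma pcomp_idr f X Y : typed f X Y -> pcomp f (faxm R X id) =p f.
Proof.
move=> tf; have XE : X = (id @` X)%fset by rewrite imfset_id.
apply: peq_trans (pcomp_faxmr (eta := id) _ XE tf) _ => //.
by rewrite (eq_prelabel_typed (eta := id) tf)// prelabel_id; exact: peq_refl.
Qed.

Lemma assocn_imfset X Y Z :
  (assocn @` tens_fset (tens_fset X Y) Z)%fset = tens_fset X (tens_fset Y Z).
Proof.
apply/fsetP => n; rewrite -[n]assocn'K mem_imfset /=; last exact: can_inj assocnK.
rewrite assocn'K; elim/dbl_ind: n => n; first by rewrite /assocn' !in_tens !dblE.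
by elim/dbl_ind: n => n; rewrite /assocn' ?dblE; do ?rewrite !in_tens ?dblE.
Qed.

Lemma swapn_imfset X Y : (swapn @` tens_fset X Y)%fset = tens_fset Y X.
Proof.
apply/fsetP => n; rewrite -[n]swapnK mem_imfset /=; last exact: can_inj swapnK.
by rewrite swapnK; elim/dbl_ind: n => n; rewrite /swapn !in_tens !dblE.
Qed.

(** The left side renames targets by [assocn], the right side renames sources by its inverse. Both
    are triple tensors, compared factor by factor. *)
Lemma assoc_natural f g h X X' Y Y' Z Z' : typed f X X' -> typed g Y Y' -> typed h Z Z' ->
  pcomp (faxm R (tens_fset (tens_fset X' Y') Z') assocn)
        (tensor_project (tensor_project f g) h) =p
  pcomp (tensor_project f (tensor_project g h))
        (faxm R (tens_fset (tens_fset X Y) Z) assocn).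
Proof.
move=> tf tg th; have tfg := typed_tensor tf tg; have tgh := typed_tensor tg th.
apply: peq_trans (pcomp_faxml _ (typed_tensor tfg th)) _; apply: peq_sym.
apply: peq_trans (pcomp_faxmr (eta := assocn') _ _ (typed_tensor tf tgh)) _.
- by move=> x _; exact: assocnK.
- by rewrite assocn_imfset.
rewrite (tensor_projectE tfg th) (tensor_projectE tf tgh) (tensor_projectE tf tg).
rewrite (tensor_projectE tg th) !prelabel_ptensor !prelabel_comp; apply: peq_sym.
apply: peq_trans (ptensorA _ _ _) _.
pose L (p : nat * nat) := if p.2 == 0%N then (assocn' p.1, 0%N) else p.
rewrite (eq_prelabel_typed (eta := L \o dbl_loc 0) tf).
- rewrite (eq_prelabel_typed (eta := L \o (dbl_loc 1 \o dbl_loc 0)) tg).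
  + rewrite (eq_prelabel_typed (eta := L \o (dbl_loc 1 \o dbl_loc 1)) th).
    * exact: peq_refl.
    * by move=> x _; rewrite /= /L /dbl_loc /= /assocn' !dblE.
    * by move=> x _; rewrite /= /L /dbl_loc /= /assocn !dblE.
  + by move=> x _; rewrite /= /L /dbl_loc /= /assocn' !dblE.
  + by move=> x _; rewrite /= /L /dbl_loc /= /assocn !dblE.
- by move=> x _; rewrite /= /L /dbl_loc /= /assocn' !dblE.
- by move=> x _; rewrite /= /L /dbl_loc /= /assocn !dblE.
Qed.

Lemma swap_natural f g X X' Y Y' : typed f X X' -> typed g Y Y' ->
  pcomp (faxm R (tens_fset X' Y') swapn) (tensor_project f g) =p
  pcomp (tensor_project g f) (faxm R (tens_fset X Y) swapn).
Proof.
move=> tf tg.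
apply: peq_trans (pcomp_faxml _ (typed_tensor tf tg)) _; apply: peq_sym.
apply: peq_trans (pcomp_faxmr (eta := swapn) _ _ (typed_tensor tg tf)) _.
- by move=> x _; exact: swapnK.
- by rewrite swapn_imfset.
rewrite (tensor_projectE tf tg) (tensor_projectE tg tf) !prelabel_ptensor !prelabel_comp.
apply: peq_trans (ptensorC _ _) _.
pose L (p : nat * nat) := if p.2 == 1%N then (swapn p.1, 1%N) else p.
rewrite (eq_prelabel_typed (eta := L \o dbl_loc 0) tf).
- rewrite (eq_prelabel_typed (eta := L \o dbl_loc 1) tg).
  + exact: peq_refl.
  + by move=> x _; rewrite /= /L /dbl_loc /= /swapn !dblE.
  + by move=> x _; rewrite /= /L /dbl_loc /= /swapn !dblE.
- by move=> x _; rewrite /= /L /dbl_loc /= /swapn !dblE.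
- by move=> x _; rewrite /= /L /dbl_loc /= /swapn !dblE.
Qed.

Lemma faxm0_unit (theta : nat * nat -> nat * nat) :
  wager (prelabel theta (faxm R fset0 id)) = 0%:nng /\
  carrier (prelabel theta (faxm R fset0 id)) = fset0.
Proof. by split=> //; rewrite carrier_prelabel /carrier /= /lev !imfset0 fset0U !imfset0. Qed.

(** When one factor is empty all locations have the same parity, so [half] inverts [dbl 0] or
    [dbl 1]; it underlies both unit constraints. *)
Lemma half_imfset0 X : X = (half @` tens_fset X fset0)%fset.
Proof.
apply/fsetP => n; apply/idP/imfsetP => [nX|[m /= + ->]].
  by exists (dbl 0 n); rewrite /= ?in_tens !dblE.
by rewrite in_tens; case: ifP.
Qed.

Lemma half_imfset1 X : X = (half @` tens_fset fset0 X)%fset.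
Proof.
apply/fsetP => n; apply/idP/imfsetP => [nX|[m /= + ->]].
  by exists (dbl 1 n); rewrite /= ?in_tens !dblE.
by rewrite in_tens; case: ifP.
Qed.

Lemma half_can0 X : {in tens_fset X fset0, cancel half (dbl 0)}.
Proof. by elim/dbl_ind => n; rewrite in_tens !dblE. Qed.

Lemma half_can1 X : {in tens_fset fset0 X, cancel half (dbl 1)}.
Proof. by elim/dbl_ind => n; rewrite in_tens !dblE. Qed.

Lemma lunit_natural f X Y : typed f X Y ->
  pcomp (faxm R (tens_fset fset0 Y) half) (tensor_project (faxm R fset0 id) f) =p
  pcomp f (faxm R (tens_fset fset0 X) half).
Proof.
move=> tf; have t1 := typed_faxm R fset0 id; rewrite imfset0 in t1.
apply: peq_trans (pcomp_faxml _ (typed_tensor t1 tf)) _; apply: peq_sym.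
apply: peq_trans (pcomp_faxmr (eta := dbl 1) (@half_can1 _) (half_imfset1 _) tf) _; apply: peq_sym.
rewrite (tensor_projectE t1 tf) !prelabel_ptensor !prelabel_comp.
have [w0 c0] := faxm0_unit ((fun p => if p.2 == 1%N then (half p.1, 1%N) else p) \o dbl_loc 0).
apply: peq_trans (ptensor_unitl _ w0 c0) _.
rewrite (eq_prelabel_typed (eta := fun p => if p.2 == 0%N then (dbl 1 p.1, 0%N) else p) tf).
- exact: peq_refl.
- by [].
- by move=> x _; rewrite /= /dbl_loc /= !dblE.
Qed.

Lemma runit_natural f X Y : typed f X Y ->
  pcomp (faxm R (tens_fset Y fset0) half) (tensor_project f (faxm R fset0 id)) =p
  pcomp f (faxm R (tens_fset X fset0) half).
Proof.
move=> tf; have t1 := typed_faxm R fset0 id; rewrite imfset0 in t1.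
apply: peq_trans (pcomp_faxml _ (typed_tensor tf t1)) _; apply: peq_sym.
apply: peq_trans (pcomp_faxmr (eta := dbl 0) (@half_can0 _) (half_imfset0 _) tf) _; apply: peq_sym.
rewrite (tensor_projectE tf t1) !prelabel_ptensor !prelabel_comp.
have [w0 c0] := faxm0_unit ((fun p => if p.2 == 1%N then (half p.1, 1%N) else p) \o dbl_loc 1).
apply: peq_trans (ptensorC _ _) _.
apply: peq_trans (ptensor_unitl _ w0 c0) _.
rewrite (eq_prelabel_typed (eta := fun p => if p.2 == 0%N then (dbl 0 p.1, 0%N) else p) tf).
- exact: peq_refl.
- by [].
- by move=> x _; rewrite /= /dbl_loc /= !dblE.
Qed.

End TensorProject.

(** * Currying and evaluation as renamings *)

Section Currying.
Variable R : realType.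
Implicit Types (X Y Z : {fset nat}) (f g h : project R (nat * nat)%type).

(* The locations (2a,0), (2b+1,0) and (d,1) of a morphism from the tensor of A
   and B to D become (a,0), (2b,1) and (2d+1,1). *)
Definition curry_loc (p : nat * nat) : nat * nat :=
  if p.2 == 0%N then (if odd p.1 then (dbl 0 p.1./2, 1%N) else (p.1./2, 0%N))
  else (dbl 1 p.1, 1%N).

Definition uncurry_loc (p : nat * nat) : nat * nat :=
  if p.2 == 0%N then (dbl 0 p.1, 0%N)
  else if odd p.1 then (p.1./2, 1%N) else (dbl 1 p.1./2, 0%N).

Lemma curry_locK p : (p.2 < 2)%N -> uncurry_loc (curry_loc p) = p.
Proof.
by case: p => + [|[|//]] _; elim/dbl_ind => x; rewrite /uncurry_loc /curry_loc /= !dblE /= ?dblE.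
Qed.

Lemma uncurry_locK p : (p.2 < 2)%N -> curry_loc (uncurry_loc p) = p.
Proof.
by case: p => + [|[|//]] _; elim/dbl_ind => x; rewrite /uncurry_loc /curry_loc /= !dblE /= ?dblE.
Qed.

Lemma prelabel_curry_locK f X Y : typed f X Y -> prelabel uncurry_loc (prelabel curry_loc f) = f.
Proof.
by move=> tf; rewrite prelabel_comp (eq_prelabel_typed (eta := id) tf) ?prelabel_id// => x _;
   exact: curry_locK.
Qed.

Lemma prelabel_uncurry_locK f X Y : typed f X Y -> prelabel curry_loc (prelabel uncurry_loc f) = f.
Proof.
by move=> tf; rewrite prelabel_comp (eq_prelabel_typed (eta := id) tf) ?prelabel_id// => x _;
   exact: uncurry_locK.
Qed.

Let ev_mu X Y : prelabel mu (prelabel uncurry_loc (faxm R (tens_fset X Y) id)) =p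
  fax (lev 1 (dbl 0 @` tens_fset X Y)%fset)
      (fun p => if odd p.1./2 then (p.1./2./2, 2%N) else (dbl 1 p.1./2./2, 1%N)).
Proof.
rewrite prelabel_comp.
have -> : lev 1 (dbl 0 @` tens_fset X Y)%fset =
    ((mu \o uncurry_loc) @` lev 0 (tens_fset X Y))%fset.
  by rewrite imfset_lev /lev -imfset_comp.
apply: prelabel_fax => [[x i] [y j]|[y j]]; rewrite !in_lev /=.
  by move=> /andP[_ /eqP ->] /andP[_ /eqP ->] []; rewrite /= => /dbl_inj ->.
by move=> /andP[_ /eqP ->]; rewrite /= !dblE; elim/dbl_ind: y => y; rewrite /uncurry_loc /= !dblE.
Qed.

(** By adjunction evaluation is cut first against [h], then against the identity of [Y]. Outputs of
    [h] in [Z] move to level 2; those in [Y] move to odd locations of level 1, whence the identity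
    of [Y] brings them to level 0. *)
Lemma pcomp_ev h X Y Z : typed h X (tens_fset Y Z) ->
  pcomp (prelabel uncurry_loc (faxm R (tens_fset Y Z) id)) (tensor_project h (faxm R Y id)) =p
  prelabel uncurry_loc h.
Proof.
move=> th; have tY := typed_faxm R Y id; rewrite imfset_id in tY.
rewrite (tensor_projectE th tY) /pcomp.
set T := prelabel mu _.
pose zeta (p : nat * nat) := if odd p.1./2 then (p.1./2./2, 2%N) else (dbl 1 p.1./2./2, 1%N).
pose T0' : project R (nat * nat)%type := fax (lev 1 (dbl 0 @` tens_fset Y Z)%fset) zeta.
have TT : T =p T0' := ev_mu Y Z.
have ch : carrier (prelabel (dbl_loc 0) h) =
    (lev 0 (dbl 0 @` X) `|` lev 1 (dbl 0 @` tens_fset Y Z))%fset.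
  by rewrite carrier_prelabel th imfsetU !dbl_loc_lev.
have sub p : p \in lev 1 (dbl 0 @` tens_fset Y Z)%fset -> p \in carrier (prelabel (dbl_loc 0) h).
  by rewrite ch inE => ->; rewrite orbT.
have out p : p \in lev 1 (dbl 0 @` tens_fset Y Z)%fset ->
    zeta p \notin carrier (prelabel (dbl_loc 0) h).
  move=> _; rewrite ch inE !in_lev !in_dbl0 /zeta.
  by case: ifP => _ /=; rewrite ?dblE ?andbF.
(* [K] is the effect on [h] of the cut with evaluation alone. *)
pose K (p : nat * nat) := if p.2 == 0%N then (dbl 0 p.1, 0%N)
  else if odd p.1 then (p.1./2, 2%N) else (dbl 1 p.1./2, 1%N).
have cTh : cut T (prelabel (dbl_loc 0) h) =p prelabel K h.
  apply: peq_trans (cut_peq TT (peq_refl _)) _; apply: peq_trans (cut_fax sub out) _.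
  rewrite prelabel_comp (eq_prelabel_typed (eta := K) th); first exact: peq_refl.
    by move=> x _; rewrite /= in_lev andbF.
  by move=> y yY; rewrite /= in_lev /= in_dbl0 /zeta /K /= !dblE yY.
have dTh : cut_defined T (prelabel (dbl_loc 0) h).
  apply: (cut_defined_peq (peq_sym TT) (peq_refl _)); exact: cut_defined_fax.
have dis : disj (carrier (prelabel (dbl_loc 0) h)) (carrier (prelabel (dbl_loc 1) (faxm R Y id))).
  exact: disj_dbl_loc.
have cK : prelabel (dbl_loc 1) (faxm R Y id) =p fax (lev 1 (dbl 1 @` Y)%fset) (fun p => (p.1, 0%N)).
  apply: peq_trans (prelabel_peq _ (faxm_sym R (theta := id) (eta := id) _)) _ => //.
  by rewrite imfset_id -dbl_loc_lev; apply: prelabel_fax => //; exact: in2W (@dbl_loc_inj 1).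
have key : cut (ptensor (prelabel (dbl_loc 0) h) (prelabel (dbl_loc 1) (faxm R Y id))) T =p
    prelabel (fun v => if v \in lev 1 (dbl 1 @` Y)%fset then (v.1, 0%N) else v) (prelabel K h).
  apply: peq_trans (cutC _ _) _; apply: peq_trans (peq_sym (cut_adj dis dTh)) _.
  apply: peq_trans (cut_peq cTh cK) _; apply: peq_trans (cutC _ _) _.
  have cKh p : p \in carrier (prelabel K h) ->
      (exists2 x, x \in X & p = (dbl 0 x, 0%N)) \/ p.2 != 0%N.
    rewrite carrier_prelabel => /imfsetP[q /= /(typed_mem th)[[x xX ->]|[y yY ->]] ->].
      by left; exists x.
    by right; rewrite /K /=; case: ifP.
  apply: cut_fax => -[x i]; rewrite in_lev in_dbl1 /= => /andP[/andP[xo xY] /eqP i1].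
    rewrite i1; apply/imfsetP; exists (dbl 0 x./2, 1%N) => /=.
      by rewrite -/(carrier h) th inE !in_lev in_tens !dblE /= xY orbT.
    by move: x xo {xY}; elim/dbl_ind => x; rewrite /K /= !dblE.
  apply/negP => /cKh[[y yX [xy]]|//].
  by move: xo; rewrite xy dblE.
apply: peq_trans (prelabel_peq nu key) _; rewrite !prelabel_comp.
rewrite (eq_prelabel_typed (eta := uncurry_loc) th); first exact: peq_refl.
  by move=> x _; rewrite /= in_lev andbF.
elim/dbl_ind => y; rewrite in_tens !dblE => yY.
all: rewrite /= in_lev in_dbl1 /K /uncurry_loc /= !dblE /=.
- by rewrite yY.
- by rewrite andbF.
Qed.

(** Each dualization doubles the locations, which accounts for the factor 4. *)
Lemma bidual_fax X : let Y := tens_fset X fset0 in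
  prelabel curry_loc (pcomp (prelabel uncurry_loc (faxm R Y id)) (faxm R (tens_fset X Y) swapn))
  =p faxm R X (dbl 0 \o dbl 0).
Proof.
move=> Y; have tY := typed_faxm R Y id; rewrite imfset_id in tY.
(* As the target is empty, [uncurry_loc] puts both ends of every Fax edge on level 0. *)
have tk : typed (prelabel uncurry_loc (faxm R Y id)) (tens_fset Y X) fset0.
  rewrite /typed carrier_prelabel tY; apply/fsetP => -[n i]; apply/imfsetP/idP => /=.
    move=> [[y j] /=]; rewrite !inE !in_lev /= => /orP[]/andP[yY /eqP -> e].
      rewrite /uncurry_loc /= in e; case: e => -> ->.
      by rewrite in_tens !dblE yY.
    move: yY e; rewrite in_tens /uncurry_loc /=; case: ifP => // _ yX [-> ->].
    by rewrite in_tens !dblE yX.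
  rewrite !inE !in_lev /= orbF => /andP[+ /eqP ->].
  elim/dbl_ind: n => n; rewrite in_tens !dblE => nX.
    by exists (n, 0%N); rewrite ?inE ?in_lev ?nX.
  by exists (dbl 0 n, 1%N); rewrite /uncurry_loc /= ?dblE// inE !in_lev in_tens !dblE nX orbT.
have swY : tens_fset Y X = (swapn @` tens_fset X Y)%fset by rewrite swapn_imfset.
apply: peq_trans (prelabel_peq curry_loc (pcomp_faxmr (eta := swapn) _ swY tk)) _.
  by move=> n _; exact: swapnK.
rewrite !prelabel_comp; set L := _ \o _.
apply: peq_trans (prelabel_peq L (faxm_sym R (theta := id) (eta := id) _)) _ => //.
rewrite imfset_id.
have L1 x : x \in X -> L (dbl 0 x, 1%N) = (x, 0%N).
  by move=> xX; rewrite /L /= /uncurry_loc /= !dblE /= /swapn !dblE /curry_loc /= !dblE.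
have Y1 y : y \in Y -> exists2 x, x \in X & y = dbl 0 x.
  by elim/dbl_ind: y => y; rewrite in_tens !dblE// => yX; exists y.
have -> : faxm R X (dbl 0 \o dbl 0) =
    fax (L @` lev 1 Y)%fset (fun p => (dbl 0 (dbl 0 p.1), 1%N)).
  congr fax; apply/fsetP => -[x i]; rewrite in_lev imfset_lev; apply/idP/imfsetP => /=.
    by move=> /andP[xX /eqP ->]; exists (dbl 0 x); rewrite ?L1//= in_tens !dblE.
  by move=> [y /Y1[z zX ->]]; rewrite L1// => -[-> ->]; rewrite zX.
apply: prelabel_fax => [[x i] [y j]|[x i]]; rewrite !in_lev /=.
  move=> /andP[/Y1[x' xX ->] /eqP ->] /andP[/Y1[y' yX ->] /eqP ->].
  by rewrite !L1// => -[->].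
move=> /andP[/Y1[x' xX ->] /eqP ->]; rewrite L1//.
by rewrite /L /= /uncurry_loc /= /swapn !dblE /curry_loc /= !dblE.
Qed.

End Currying.

(** * The category of conducts *)

Section LolliTheory.
Variable R : realType.

Lemma lolli_relabel (V W : choiceType) (theta : V -> W) (S T : pset R V) f :
  carried S -> inhabited_pset S -> is_conduct T -> disj (pcar S) (pcar T) ->
  inj_on theta (pcar S `|` pcar T)%fset -> lolli S T f ->
  lolli (relabel_set theta S) (relabel_set theta T) (prelabel theta f).
Proof. by move=> cS S0 cT ST ti lf; rewrite -relabel_lolli//; exact: relabel_mem. Qed.

(** It is enough to test elementary tensors, on which the interchange law yields the tensor of f::s
    and g::t. *)
Lemma lolli_ptensor (V : choiceType) (S S' T T' : pset R V) f g :
  is_conduct S -> is_conduct S' -> is_conduct T -> is_conduct T' ->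
  disj (pcar S) (pcar S') -> disj (pcar T) (pcar T') ->
  disj (pcar S `|` pcar S')%fset (pcar T `|` pcar T')%fset ->
  lolli S S' f -> lolli T T' g ->
  lolli (tensor S T) (tensor S' T') (ptensor f g).
Proof.
move=> cS cS' cT cT' SS TT ST lf lg.
have [kS kS' kT kT'] := And4 (conduct_carried cS) (conduct_carried cS')
  (conduct_carried cT) (conduct_carried cT').
have cf := lolli_carrier kS (conduct_inhabited cS) cS' SS lf.
have cg := lolli_carrier kT (conduct_inhabited cT) cT' TT lg.
have [[ST1 ST2] [ST3 ST4]] : (disj (pcar S) (pcar T) /\ disj (pcar S) (pcar T')) /\
    (disj (pcar S') (pcar T) /\ disj (pcar S') (pcar T')).
  by move: ST; rewrite /disj fdisjointUX !fdisjointXU => /andP[/andP[-> ->] /andP[-> ->]].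
rewrite (@lolli_biperp _ _ (ptens S T)).
- move=> _ [s [t [Ss Tt ->]]]; have [fs Sfs] := lf _ Ss; have [gt Tgt] := lg _ Tt.
  have [||| dc ce] := @cut_interchange _ _ f g s t; rewrite ?cf ?cg.
  + rewrite (kS s)// (kT t)//; move: ST; rewrite /disj.
    by rewrite !fdisjointUX !fdisjointXU => /andP[/andP[-> ->] /andP[-> ->]].
  + exact: fs.
  + exact: gt.
  split=> //; apply: conduct_peq (peq_sym ce) _; first exact: tensor_conduct.
  exact: ptensor_tensor.
- exact: ptens_carried.
- by apply: ptens_inhabited; exact: conduct_inhabited.
- exact: tensor_conduct.
- by apply: disjU4 => //; exact: disjC.
Qed.

End LolliTheory.

(** * Objects, composition and morphisms given by Faxes *)

Section Objects.
Variable R : realType.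
Implicit Types A B E F : conduct R.

Definition at_level i (S : pset R nat) : pset R (nat * nat)%type := relabel_set (psi i) S.

Lemma at_level_conduct i A : is_conduct (at_level i A).
Proof. by apply: is_conduct_relabel (conductP A); exact: inj_on_psi. Qed.

Lemma at_level_carried i A : carried (at_level i A).
Proof. exact/conduct_carried/at_level_conduct. Qed.

Lemma at_level_inhabited i A : inhabited_pset (at_level i A).
Proof. exact/conduct_inhabited/at_level_conduct. Qed.

Hint Resolve at_level_conduct at_level_carried at_level_inhabited : core.

Lemma relabel_lev (theta : nat * nat -> nat * nat) i j S : (forall x, theta (x, i) = (x, j)) ->
  relabel_set theta (at_level i S) = at_level j S.
Proof.
by move=> e; rewrite /at_level relabel_set_comp; congr relabel_set; apply/funext => x; exact: e.
Qed.

Section Morphisms.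
Variables (A B E : conduct R).

Lemma typed_morphism (f : morphism A B) : typed (mproj f) (pcar A) (pcar B).
Proof.
rewrite /typed; apply: (@lolli_carrier _ _ (at_level 0 A) (at_level 1 B)) => //.
  exact: disj_lev.
exact: morphismP.
Qed.

Lemma inj_on_nu (X Y : {fset nat}) : inj_on nu (lev 0 X `|` lev 2 Y)%fset.
Proof.
move=> [x i] [y j]; rewrite !inE !in_lev /= => /orP[]/andP[_ /eqP ->].
all: by move=> /orP[]/andP[_ /eqP ->] [] // ->.
Qed.

Lemma morphism_comp (g : morphism B E) (f : morphism A B) :
  cut_defined (mproj f) (prelabel mu (mproj g)) /\
  lolli (at_level 0 A) (at_level 1 E) (pcomp (mproj g) (mproj f)).
Proof.
have lg : lolli (at_level 1 B) (at_level 2 E) (prelabel mu (mproj g)).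
  rewrite -(@relabel_lev mu 0 1)// -(@relabel_lev mu 1 2)//.
  apply: lolli_relabel => //; [exact: disj_lev|exact: in2W mu_inj|exact: morphismP].
have [d l] := lolli_cut (@at_level_carried 0 A) (@at_level_inhabited 0 A)
  (@at_level_conduct 1 B) (@at_level_conduct 2 E) (@disj_lev 0 1 _ _ isT) (@disj_lev 0 2 _ _ isT)
  (@disj_lev 1 2 _ _ isT) (morphismP f) lg.
split=> //; rewrite -[at_level 0 A](@relabel_lev nu 0 0)// -(@relabel_lev nu 2 1)//.
apply: lolli_relabel => //; [exact: disj_lev|exact: inj_on_nu].
Qed.

(** The cut of the Fax with an element of [A] renames it by [theta] onto level 1. Each structural
    isomorphism is thus obtained from an equality of conducts. *)
Lemma faxm_morphism theta : relabel_set theta A = B ->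
  lolli (at_level 0 A) (at_level 1 B) (faxm R (pcar A) theta).
Proof.
move=> AB _ [a Aa ->].
have ca : carrier (prelabel (psi 0) a) = lev 0 (pcar A).
  by rewrite carrier_prelabel (conduct_carried (conductP A)).
have sub p : p \in lev 0 (pcar A) -> p \in carrier (prelabel (psi 0) a) by rewrite ca.
have out p : p \in lev 0 (pcar A) -> (theta p.1, 1%N) \notin carrier (prelabel (psi 0) a).
  by rewrite ca !in_lev andbF.
split; first exact: cut_defined_fax.
apply: conduct_peq (peq_sym (cut_fax sub out)) _ => //.
exists (prelabel theta a); first by rewrite -AB; exact: relabel_mem.
rewrite !prelabel_comp; apply: eq_prelabel => x.
by rewrite (conduct_carried (conductP A)) //= in_lev /= => ->.
Qed.

End Morphisms.

Definition comp_morphism A B E (g : morphism B E) (f : morphism A B) : morphism A E :=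
  Morphism (morphism_comp g f).2.

Definition fax_morphism A B theta (AB : relabel_set theta A = B) : morphism A B :=
  Morphism (faxm_morphism AB).

Definition id_morphism A : morphism A A := fax_morphism (relabel_set_id A).

Lemma pcompA_morphism A B E F (h : morphism E F) (g : morphism B E) (f : morphism A B) :
  pcomp (mproj h) (pcomp (mproj g) (mproj f)) =p
  pcomp (pcomp (mproj h) (mproj g)) (mproj f).
Proof.
apply: pcompA (typed_morphism f) (typed_morphism g) (typed_morphism h) _ _.
  exact: (morphism_comp g f).1.
exact: (morphism_comp h g).1.
Qed.

Definition conduct_category : category_on (conduct_quiver R) :=
  @Category (conduct_quiver R) id_morphism comp_morphism
    (fun A B f => peq_refl (mproj f))
    (fun A B f g => @peq_sym _ _ (mproj f) (mproj g))
    (fun A B f g h => @peq_trans _ _ (mproj f) (mproj g) (mproj h))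
    (fun A B E g g' f f' gg ff => pcomp_peq ff gg)
    (fun A B f => pcomp_idl (typed_morphism f))
    (fun A B f => pcomp_idr (typed_morphism f))
    (fun A B E F h g f => pcompA_morphism h g f).

Lemma inj_on_dbl i (X : {fset nat}) : inj_on (dbl i) X.
Proof. exact: in2W (@dbl_inj i). Qed.

Lemma dbl_conduct i A : is_conduct (relabel_set (dbl i) A).
Proof. by apply: is_conduct_relabel (conductP A); exact: inj_on_dbl. Qed.

Lemma dbl_carried i A : carried (relabel_set (dbl i) A).
Proof. exact/conduct_carried/dbl_conduct. Qed.

Lemma dbl_inhabited i A : inhabited_pset (relabel_set (dbl i) A).
Proof. exact/conduct_inhabited/dbl_conduct. Qed.

Hint Resolve dbl_conduct dbl_carried dbl_inhabited : core.

Lemma inj_on_phi (X Y : {fset nat}) : inj_on phi (lev 0 X `|` lev 1 Y)%fset.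
Proof.
move=> [x i] [y j]; rewrite !inE !in_lev /= => /orP[]/andP[_ /eqP ->] /orP[]/andP[_ /eqP ->].
all: rewrite /phi /=.
- by move=> /(@dbl_inj 0) ->.
- by move=> /(congr1 odd); rewrite -/(dbl 0 x) -/(dbl 1 y) !dblE.
- by move=> /(congr1 odd); rewrite -/(dbl 1 x) -/(dbl 0 y) !dblE.
- by move=> /(@dbl_inj 1) ->.
Qed.

Lemma tensor_objectE A B :
  tensor_object A B = tensor (relabel_set (dbl 0) A) (relabel_set (dbl 1) B).
Proof.
rewrite /tensor_object -/(at_level 0 A) -/(at_level 1 B) relabel_tensor//.
  by rewrite /at_level !relabel_set_comp.
exact: inj_on_phi.
Qed.

Lemma tensor_object_conduct A B : is_conduct (tensor_object A B).
Proof. by rewrite tensor_objectE; exact: tensor_conduct. Qed.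

Definition tensc A B : conduct R := Conduct (tensor_object_conduct A B).

Lemma tenscE A B :
  cset (tensc A B) = tensor (relabel_set (dbl 0) A) (relabel_set (dbl 1) B).
Proof. exact: tensor_objectE. Qed.

Lemma pcar_tens A B : pcar (tensc A B) = tens_fset (pcar A) (pcar B).
Proof. by rewrite tenscE. Qed.

Lemma at_level_tens i A B : at_level i (tensc A B) =
  tensor (relabel_set (dbl_loc 0) (at_level i A)) (relabel_set (dbl_loc 1) (at_level i B)).
Proof.
rewrite /at_level tenscE relabel_tensor//; last exact: inj_on_psi.
by rewrite !relabel_set_comp.
Qed.

Lemma dbl_loc_conduct i j A : is_conduct (relabel_set (dbl_loc i) (at_level j A)).
Proof. by apply: is_conduct_relabel => //; exact: in2W (@dbl_loc_inj i). Qed.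

Hint Resolve dbl_loc_conduct : core.

Lemma tensor_morphism A A' B B' (f : morphism A A') (g : morphism B B') :
  lolli (at_level 0 (tensc A B)) (at_level 1 (tensc A' B'))
    (tensor_project (mproj f) (mproj g)).
Proof.
rewrite (tensor_projectE (typed_morphism f) (typed_morphism g)) !at_level_tens.
apply: lolli_ptensor => //.
- by rewrite /= -!/(lev _ _) !dbl_loc_lev; exact: disj_lev.
- by rewrite /= -!/(lev _ _) !dbl_loc_lev; exact: disj_lev.
- by rewrite /= -!imfsetU; exact: disj_dbl_loc.
- apply: lolli_relabel => //; [exact: disj_lev|exact: in2W (@dbl_loc_inj 0)|exact: morphismP].
- apply: lolli_relabel => //; [exact: disj_lev|exact: in2W (@dbl_loc_inj 1)|exact: morphismP].
Qed.

Definition tensm_morphism A A' B B' (f : morphism A A') (g : morphism B B') :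
  morphism (tensc A B) (tensc A' B') := Morphism (tensor_morphism f g).

Definition unitc : conduct R := Conduct (@unit_conduct R nat).
Definition botc : conduct R := Conduct (@bot_conduct R nat).

Lemma eq1_relabel_set (V W : choiceType) (theta eta : V -> W) (S : pset R V) :
  theta =1 eta -> relabel_set theta S = relabel_set eta S.
Proof. by move=> /funext ->. Qed.

Lemma relabel_conduct (V W : choiceType) (theta : V -> W) (S : pset R V) :
  injective theta -> is_conduct S -> is_conduct (relabel_set theta S).
Proof. by move=> ti; apply: is_conduct_relabel; exact: in2W ti. Qed.

(** Both sides are tensors of copies of [A], [B] and [E] placed at 2a, 4b+1 and 4e+3. These
    locations are disjoint by parity, so [tensorA] applies. *)
Lemma assoc_object A B E :
  relabel_set assocn (tensc (tensc A B) E) = tensc A (tensc B E).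
Proof.
rewrite !tenscE.
pose S := relabel_set (dbl 0) A.
pose T := relabel_set (dbl 1 \o dbl 0) B.
pose U := relabel_set (dbl 1 \o dbl 1) E.
have cS : is_conduct S by exact: dbl_conduct.
have cT : is_conduct T.
  by apply: relabel_conduct (conductP B); apply: inj_comp; exact: dbl_inj.
have cU : is_conduct U.
  by apply: relabel_conduct (conductP E); apply: inj_comp; exact: dbl_inj.
have cAB := tensor_conduct (@dbl_carried 0 A) (@dbl_carried 1 B).
have ai X : inj_on assocn X by exact: in2W (can_inj assocnK).
have -> : relabel_set assocn (tensor (relabel_set (dbl 0)
    (tensor (relabel_set (dbl 0) A) (relabel_set (dbl 1) B))) (relabel_set (dbl 1) E))
    = tensor (tensor S T) U.
  rewrite relabel_tensor//; last first.
    by apply: carried_relabel; exact: conduct_carried.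
  congr tensor; last first.
    by rewrite relabel_set_comp; apply: eq1_relabel_set => x; rewrite /= /assocn !dblE.
  rewrite (@relabel_tensor _ _ _ (dbl 0))//; last exact: inj_on_dbl.
  rewrite relabel_tensor//; last 2 first.
  - by apply: carried_relabel.
  - by apply: carried_relabel.
  by rewrite !relabel_set_comp; congr tensor; apply: eq1_relabel_set => x;
     rewrite /= /assocn !dblE.
rewrite (@relabel_tensor _ _ _ (dbl 1))//; last exact: inj_on_dbl.
rewrite !relabel_set_comp tensorA//; try exact: conduct_carried; try exact: conduct_inhabited.
all: apply/fdisjointP => _ /imfsetP[x /= _ ->]; apply/negP => /imfsetP[y /= _].
- by move=> /(congr1 odd); rewrite !dblE.
- by move=> /(congr1 odd); rewrite !dblE.
- by move=> /dbl_inj /(congr1 odd); rewrite !dblE.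
Qed.

Lemma swap_object A B : relabel_set swapn (tensc A B) = tensc B A.
Proof.
rewrite !tenscE relabel_tensor//; last exact: in2W (can_inj swapnK).
rewrite !relabel_set_comp tensorC.
by congr tensor; apply: eq1_relabel_set => x; rewrite /= /swapn !dblE.
Qed.

Lemma relabel_unit theta : relabel_set theta unitc = unitc.
Proof.
rewrite -[RHS]relabel_set_id; apply: eq_relabel_set => //.
exact/conduct_carried/conductP.
Qed.

Lemma relabel_bot theta : relabel_set theta botc = botc.
Proof.
rewrite -[RHS]relabel_set_id; apply: eq_relabel_set => //.
exact/conduct_carried/conductP.
Qed.

Lemma lunit_object A : relabel_set half (tensc unitc A) = A.
Proof.
rewrite !tenscE (@relabel_unit (dbl 0)) tensor_unitl// relabel_set_comp.
by rewrite -[RHS]relabel_set_id; apply: eq1_relabel_set => x; rewrite /= dblE.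
Qed.

Lemma runit_object A : relabel_set half (tensc A unitc) = A.
Proof.
rewrite !tenscE (@relabel_unit (dbl 1)) tensor_unitr// relabel_set_comp.
by rewrite -[RHS]relabel_set_id; apply: eq1_relabel_set => x; rewrite /= dblE.
Qed.

Lemma tens_fun_imfset theta eta (X Y : {fset nat}) :
  (tens_fun theta eta @` tens_fset X Y)%fset = tens_fset (theta @` X)%fset (eta @` Y)%fset.
Proof.
rewrite /tens_fset imfsetU -!imfset_comp.
by congr (_ `|` _)%fset; apply: eq_imfset => //= x; rewrite /= /tens_fun !dblE.
Qed.

(** Together with [is_fax_tensor], this evaluates a composite of structural morphisms to the Fax of
    one function, so that a coherence diagram becomes an identity of functions on a carrier. *)
Lemma is_fax_comp f g (X Y : {fset nat}) theta eta zeta :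
  f =p faxm R X theta -> g =p faxm R Y eta -> Y = (theta @` X)%fset ->
  {in X, eta \o theta =1 zeta} -> pcomp g f =p faxm R X zeta.
Proof.
move=> fX gY YX e; apply: peq_trans (pcomp_peq fX gY) _.
exact: peq_trans (pcomp_faxm R eta YX) (eq_faxm R e).
Qed.

Lemma is_fax_tensor f g (X Y : {fset nat}) theta eta :
  f =p faxm R X theta -> g =p faxm R Y eta ->
  tensor_project f g =p faxm R (tens_fset X Y) (tens_fun theta eta).
Proof.
move=> fX gY; apply: peq_trans (tensor_faxm R _ _ _ _).
exact: tensor_peq (typed_peq (peq_sym fX) (typed_faxm _ _ _))
  (typed_peq (peq_sym gY) (typed_faxm _ _ _)) fX gY.
Qed.

Lemma fax_morphism_iso A B theta eta (AB : relabel_set theta A = B)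
    (BA : relabel_set eta B = A) : {in pcar A, cancel theta eta} ->
  is_iso conduct_category (fax_morphism AB).
Proof.
move=> te; exists (fax_morphism BA).
have pB : pcar B = (theta @` pcar A)%fset by rewrite -AB.
split; first by apply: is_fax_comp (peq_refl _) (peq_refl _) pB _.
apply: is_fax_comp (peq_refl _) (peq_refl _) _ _; first by rewrite -[in LHS]BA.
by move=> y; rewrite pB => /imfsetP[x /= xA ->]; rewrite /= te.
Qed.

End Objects.

Section StarAutonomy.
Variable R : realType.
Implicit Types A B E F : conduct R.

Local Notation C := (conduct_category R).

Definition assocm A B E : morphism (tensc (tensc A B) E) (tensc A (tensc B E)) :=
  fax_morphism (assoc_object A B E).
Definition braidm A B : morphism (tensc A B) (tensc B A) := fax_morphism (swap_object A B).
Definition lunitm A : morphism (tensc (unitc R) A) A := fax_morphism (lunit_object A).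
Definition runitm A : morphism (tensc A (unitc R)) A := fax_morphism (runit_object A).

Lemma assoc_object' A B E :
  relabel_set assocn' (tensc A (tensc B E)) = tensc (tensc A B) E.
Proof.
rewrite -assoc_object relabel_set_comp -[RHS]relabel_set_id.
by apply: eq1_relabel_set => x; exact: assocnK.
Qed.

Lemma lunit_object' A : relabel_set (dbl 1) A = tensc (unitc R) A.
Proof. by rewrite tenscE relabel_unit tensor_unitl//; exact: dbl_conduct. Qed.

Lemma runit_object' A : relabel_set (dbl 0) A = tensc A (unitc R).
Proof. by rewrite tenscE relabel_unit tensor_unitr//; exact: dbl_conduct. Qed.

Ltac unfold_conducts :=
  cbv [heq hom ob conduct_quiver idm compm conduct_category comp_morphism
       tensm_morphism assocm lunitm runitm braidm fax_morphism id_morphism mproj].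

Lemma tens_fun_id : tens_fun id id =1 id.
Proof. by elim/dbl_ind => x; rewrite /tens_fun !dblE. Qed.

(** Left transparent: the final theorem reads the data of this structure by computation, and so does
    [to_bidual_fax]. *)
Definition conduct_monoidal : symmetric_monoidal C.
Proof.
refine (@SymMonoidal (conduct_quiver R) C (@tensc R) (@tensm_morphism R) (unitc R)
  assocm lunitm runitm braidm _ _ _ _ _ _ _ _ _ _ _ _ _ _).
- move=> A A' B B' f f' g g' ff gg.
  exact: tensor_peq (typed_morphism f) (typed_morphism g) ff gg.
- move=> A B; unfold_conducts; apply: peq_trans (is_fax_tensor (peq_refl _) (peq_refl _)) _.
  by rewrite -pcar_tens; apply: eq_faxm => x _; exact: tens_fun_id.
- move=> A A' A'' B B' B'' f' f g' g.
  apply: tensor_pcomp (typed_morphism f) (typed_morphism f') (typed_morphism g)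
    (typed_morphism g') (morphism_comp f' f).1 (morphism_comp g' g).1.
- move=> A B E; apply: fax_morphism_iso (assoc_object' A B E) _ => x _; exact: assocnK.
- move=> A; apply: fax_morphism_iso (lunit_object' A) _.
  rewrite pcar_tens; exact: half_can1.
- move=> A; apply: fax_morphism_iso (runit_object' A) _.
  rewrite pcar_tens; exact: half_can0.
- move=> A A' B B' E E' f g h; unfold_conducts; rewrite !pcar_tens.
  exact: assoc_natural (typed_morphism f) (typed_morphism g) (typed_morphism h).
- move=> A A' f; unfold_conducts; rewrite !pcar_tens; exact: lunit_natural (typed_morphism f).
- move=> A A' f; unfold_conducts; rewrite !pcar_tens; exact: runit_natural (typed_morphism f).
- move=> A A' B B' f g; unfold_conducts; rewrite !pcar_tens.
  exact: swap_natural (typed_morphism f) (typed_morphism g).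
- move=> A B E F; unfold_conducts; rewrite !pcar_tens.
  apply: peq_trans (is_fax_comp (peq_refl _) (peq_refl _) _ (fun x _ => erefl)) _.
    by rewrite assocn_imfset.
  apply: peq_sym.
  apply: is_fax_comp
    (is_fax_comp (is_fax_tensor (peq_refl _) (peq_refl _)) (peq_refl _) _ (fun x _ => erefl))
    (is_fax_tensor (peq_refl _) (peq_refl _)) _ _.
  + by rewrite tens_fun_imfset assocn_imfset imfset_id.
  + by rewrite imfset_comp tens_fun_imfset imfset_id !assocn_imfset.
  (* At most three digits decide to which of the four factors a location belongs. *)
  + elim/dbl_ind => x _; last by rewrite /= /tens_fun /assocn !dblE.
    elim/dbl_ind: x => x; last by rewrite /= /tens_fun /assocn !dblE.
    by elim/dbl_ind: x => x; rewrite /= /tens_fun /assocn !dblE.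
- move=> A B; unfold_conducts; rewrite !pcar_tens.
  apply: peq_trans (is_fax_comp (peq_refl _)
    (is_fax_tensor (peq_refl _) (peq_refl _)) _ (fun x _ => erefl)) _.
    by rewrite assocn_imfset.
  apply: peq_sym; apply: peq_trans (is_fax_tensor (peq_refl _) (peq_refl _)) _.
  apply: eq_faxm; elim/dbl_ind => x; rewrite in_tens !dblE; last first.
    by rewrite /= /tens_fun /assocn !dblE.
  (* The middle factor is the unit, whose carrier is empty, so the locations with its digits do not
     occur. *)
  by elim/dbl_ind: x => x; rewrite in_tens !dblE// /= /tens_fun /assocn !dblE.
- move=> A B E; unfold_conducts; rewrite !pcar_tens.
  apply: peq_trans (is_fax_comp (is_fax_comp (peq_refl _) (peq_refl _) _ (fun x _ => erefl))
    (peq_refl _) _ (fun x _ => erefl)) _.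
  + by rewrite assocn_imfset.
  + by rewrite imfset_comp assocn_imfset swapn_imfset.
  apply: peq_sym.
  apply: is_fax_comp
    (is_fax_comp (is_fax_tensor (peq_refl _) (peq_refl _)) (peq_refl _) _ (fun x _ => erefl))
    (is_fax_tensor (peq_refl _) (peq_refl _)) _ _.
  + by rewrite tens_fun_imfset swapn_imfset imfset_id.
  + by rewrite imfset_comp tens_fun_imfset imfset_id swapn_imfset assocn_imfset.
  + elim/dbl_ind => x _; last by rewrite /= /tens_fun /assocn /swapn !dblE.
    by elim/dbl_ind: x => x; rewrite /= /tens_fun /assocn /swapn !dblE.
- move=> A B; unfold_conducts; rewrite !pcar_tens.
  apply: is_fax_comp (peq_refl _) (peq_refl _) _ _; first by rewrite swapn_imfset.
  by move=> x _; exact: swapnK.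
Defined.

Lemma at_level_disj i j A B : i != j -> disj (pcar (at_level i A)) (pcar (at_level j B)).
Proof. exact: disj_lev. Qed.

Hint Resolve at_level_conduct at_level_carried at_level_inhabited : core.
Hint Resolve dbl_conduct dbl_carried dbl_inhabited : core.

Lemma lolli_object_conduct A B :
  is_conduct (relabel_set phi (lolli (at_level 0 A) (at_level 1 B))).
Proof.
apply: is_conduct_relabel; first exact: inj_on_phi.
by apply: lolli_conduct => //; exact: at_level_disj.
Qed.

Definition ihomc A B : conduct R := Conduct (lolli_object_conduct A B).

Lemma dbl_disj A B : disj (pcar (relabel_set (dbl 0) A)) (pcar (relabel_set (dbl 1) B)).
Proof. exact: disj_dbl. Qed.

Lemma ihomcE A B : cset (ihomc A B) = lolli (relabel_set (dbl 0) A) (relabel_set (dbl 1) B).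
Proof.
rewrite /ihomc /= relabel_lolli//.
- by rewrite /at_level !relabel_set_comp.
- exact: at_level_disj.
- exact: inj_on_phi.
Qed.

Lemma pcar_ihomc A B : pcar (ihomc A B) = tens_fset (pcar A) (pcar B).
Proof. by rewrite ihomcE. Qed.

Lemma inj_on_curry_loc (X Y : {fset nat}) : inj_on curry_loc (lev 0 X `|` lev 1 Y)%fset.
Proof.
move=> [x i] [y j]; rewrite !inE !in_lev /= => xi yj /(congr1 uncurry_loc).
by rewrite !curry_locK//=; [case/orP: yj|case/orP: xi] => /andP[_ /eqP ->].
Qed.

(** The copies of [A], [B] and [E] have pairwise disjoint carriers, so [lolli_tensor] makes currying
    an equality of conducts; [curry_loc] only moves the copies to their locations in the internal
    hom. *)
Lemma lolli_curry A B E : relabel_set curry_loc (lolli (at_level 0 (tensc A B)) (at_level 1 E)) =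
  lolli (at_level 0 A) (at_level 1 (ihomc B E)).
Proof.
pose S := relabel_set (dbl_loc 0) (at_level 0 A); pose T := relabel_set (dbl_loc 1) (at_level 0 B).
have cS : is_conduct S by exact: dbl_loc_conduct.
have cT : is_conduct T by exact: dbl_loc_conduct.
have [kS kT] := (conduct_carried cS, conduct_carried cT).
have [iS iT] := (conduct_inhabited cS, conduct_inhabited cT).
have pS : pcar S = lev 0 (dbl 0 @` pcar A)%fset by rewrite /S /= -/(lev _ _) dbl_loc_lev.
have pT : pcar T = lev 0 (dbl 1 @` pcar B)%fset by rewrite /T /= -/(lev _ _) dbl_loc_lev.
have ST : disj (pcar S) (pcar T) by exact: disj_dbl_loc.
have SE : disj (pcar S) (pcar (at_level 1 E)) by rewrite pS; exact: disj_lev.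
have TE : disj (pcar T) (pcar (at_level 1 E)) by rewrite pT; exact: disj_lev.
rewrite at_level_tens -/S -/T lolli_tensor//.
have cTE := lolli_conduct kT iT (at_level_conduct 1 E) TE.
have kinj X Y Z : inj_on curry_loc (lev 0 X `|` (lev 0 Y `|` lev 1 Z))%fset.
  by rewrite fsetUA /lev -imfsetU; exact: inj_on_curry_loc.
rewrite relabel_lolli//; last 2 first.
- by rewrite /disj fdisjointXU; apply/andP.
- by rewrite -[pcar (lolli _ _)]/(pcar T `|` lev 1 (pcar E))%fset pS pT; exact: kinj.
rewrite (@relabel_lolli _ _ _ curry_loc T)//; last by rewrite pT; exact: inj_on_curry_loc.
rewrite -[at_level 1 (ihomc B E)]/(relabel_set (psi 1) (ihomc B E)) ihomcE.
rewrite (@relabel_lolli _ _ _ (psi 1))//; last 2 first.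
- exact: dbl_disj.
- exact: inj_on_psi.
rewrite /S /T /at_level !relabel_set_comp; congr (lolli _ (lolli _ _)); apply: eq1_relabel_set => x.
- by rewrite /= /dbl_loc /= /curry_loc /= !dblE.
- by rewrite /= /dbl_loc /= /curry_loc /= !dblE.
Qed.

Lemma curry_morphism A B E (f : morphism (tensc A B) E) :
  lolli (at_level 0 A) (at_level 1 (ihomc B E)) (prelabel curry_loc (mproj f)).
Proof. by rewrite -lolli_curry; apply/relabel_mem/morphismP. Qed.

Lemma uncurry_morphism A B E (g : morphism A (ihomc B E)) :
  lolli (at_level 0 (tensc A B)) (at_level 1 E) (prelabel uncurry_loc (mproj g)).
Proof.
have := morphismP g; rewrite -lolli_curry => -[f lf e]; have fm : mproj (Morphism lf) = f by [].
by rewrite e -fm (prelabel_curry_locK (typed_morphism _)).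
Qed.

Definition currym A B E (f : morphism (tensc A B) E) : morphism A (ihomc B E) :=
  Morphism (curry_morphism f).
Definition uncurrym A B E (g : morphism A (ihomc B E)) : morphism (tensc A B) E :=
  Morphism (uncurry_morphism g).

Definition evm B E : morphism (tensc (ihomc B E) B) E := uncurrym (id_morphism (ihomc B E)).

Lemma evm_uncurry A B E (h : morphism A (ihomc B E)) :
  pcomp (mproj (evm B E)) (tensor_project (mproj h) (mproj (id_morphism B)))
  =p prelabel uncurry_loc (mproj h).
Proof.
have := typed_morphism h; cbv [evm uncurrym id_morphism fax_morphism mproj].
rewrite pcar_ihomc; exact: pcomp_ev.
Qed.

(** Evaluation after the tensor of [h] with an identity is the renaming of [h] by [uncurry_loc],
    which [curry_loc] inverts on morphisms: existence and uniqueness of the curried map are the two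
    cancellation laws. *)
Definition conduct_closed : closed_structure conduct_monoidal.
Proof.
refine (@Closed (conduct_quiver R) C conduct_monoidal ihomc evm currym _ _).
- move=> A B E f; apply: peq_trans (evm_uncurry (currym f)) _.
  rewrite /= (prelabel_curry_locK (typed_morphism f)); exact: peq_refl.
- move=> A B E f h hf.
  have := prelabel_peq curry_loc (peq_trans (peq_sym (evm_uncurry h)) hf).
  by rewrite (prelabel_uncurry_locK (typed_morphism h)).
Defined.

Lemma ihomc_bot A : cset (ihomc A (botc R)) = relabel_set (dbl 0) (perp A).
Proof.
rewrite ihomcE (@relabel_bot R (dbl 1)) lolli_bot// perp_relabel//; first exact: inj_on_dbl.
exact/conduct_carried/conductP.
Qed.

(** The internal hom into the dualizing object is the orthogonal on doubled locations, so this is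
    the equality of a conduct with its biorthogonal. *)
Lemma bidual_object A : relabel_set (dbl 0 \o dbl 0) A = ihomc (ihomc A (botc R)) (botc R).
Proof.
rewrite !ihomc_bot perp_relabel; last 2 first.
- exact: inj_on_dbl.
- exact: perp_carried.
by rewrite relabel_set_comp (conduct_biperp (conductP A)).
Qed.

Lemma bidual_object' A :
  relabel_set (half \o half) (ihomc (ihomc A (botc R)) (botc R)) = A.
Proof.
rewrite -bidual_object relabel_set_comp -[RHS]relabel_set_id.
by apply: eq1_relabel_set => x; rewrite /= !half_dbl0.
Qed.

Lemma to_bidual_fax A :
  mproj (to_bidual conduct_closed (botc R) A) =p mproj (fax_morphism (bidual_object A)).
Proof.
pose Y := pcar (ihomc A (botc R)).
have -> : mproj (to_bidual conduct_closed (botc R) A) =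
    prelabel curry_loc (pcomp (prelabel uncurry_loc (faxm R Y id))
      (faxm R (pcar (tensc A (ihomc A (botc R)))) swapn)) by [].
rewrite pcar_tens /Y pcar_ihomc; exact: bidual_fax.
Qed.

(** The map to the bidual is a Fax only up to [=p]; the inverse of that Fax still works because
    composition respects [=p]. *)
Lemma conduct_star_autonomous : star_autonomous conduct_monoidal (botc R).
Proof.
exists conduct_closed => A.
have [|g [gf fg]] := @fax_morphism_iso R _ _ _ _ (bidual_object A) (bidual_object' A).
  by move=> x _; rewrite /= !half_dbl0.
exists g; split.
  by apply: peq_trans gf; apply: pcomp_peq (to_bidual_fax A) (peq_refl _).
by apply: peq_trans fg; apply: pcomp_peq (peq_refl _) (to_bidual_fax A).
Qed.

End StarAutonomy.

Theorem mainTheorem1 (R : realType) :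
  exists (C : category_on (conduct_quiver R)) (M : symmetric_monoidal C)
         (D : conduct R),
    (forall A : conduct R, mproj (idm C A) = id_project (pcar A)) /\
    (forall (A B E : conduct R) (g : morphism B E) (f : morphism A B),
        cut_defined (mproj f) (prelabel mu (mproj g)) /\
        mproj (compm C g f)
          = prelabel nu (cut (mproj f) (prelabel mu (mproj g)))) /\
    (forall A B : conduct R, cset (tens M A B) = tensor_object A B) /\
    (forall (A A' B B' : conduct R) (f : morphism A A') (g : morphism B B'),
        mproj (tensm M f g) = tensor_project (mproj f) (mproj g)) /\
    cset (tunit M) = unit_pset /\
    cset D = bot_pset /\
    star_autonomous M D.
Proof.
exists (conduct_category R), (conduct_monoidal R), (botc R); do ![split=> //].
  exact: (morphism_comp g f).1.
exact: conduct_star_autonomous.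
Qed.
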